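(* Let $x^*\in\mathbb{R}^d$ and let $f:\mathbb{R}^d\to\mathbb{R}^d$ be $C^1$ in a convex neighborhood $\mathcal{N}^*$ of $x^*$. Let $(X_n)_{n\in\mathbb{N}}$ be a random sequence in $\mathbb{R}^d$, adapted to a filtration $(\mathcal{F}_n)_{n\in\mathbb{N}}$, such that for all $n\ge0$ $$X_{n+1}-X_n=\gamma_{n+1}f(X_n)+c_{n+1}(\varepsilon_{n+1}+r_{n+1}),$$ with $\gamma,c,\varepsilon,r$ as in the context. Let $\Gamma$ be an event and suppose $x^*$ is an unstable equilibrium of $f$. Suppose that for some $a>2$, almost surely on $\Gamma$, $$0<\liminf_{n\to\infty}\mathbb{E}[\|\varepsilon^+_n\|^2|\mathcal{F}_{n-1}],\qquad\limsup_{n\to\infty}\mathbb{E}[\|\varepsilon_n\|^a|\mathcal{F}_{n-1}]<\infty,\qquad\sum_n\|r_n\|^2<\infty.$$ Set $\alpha(t)=\sqrt{\sum_{n>t}c_n^2}$ and suppose that one of the two following conditions is satisfied: \begin{enumerate} \item[(i)] $x^*$ is repulsive; \item[(ii)] $\sum_{n>t}\gamma_n^2=O(\alpha(t))$ as $t\to\infty$ (which is satisfied if $\gamma_n=O(c_n)$), and there is $\nu\in(0,1]$ such that $f\in C^{1+\nu}(\mathcal{N}^* )$ and $\sum_{n>t}c_n^{1+\nu}\|\varepsilon^-_n\|^{1+\nu}=o(\alpha(t))$ as $t\to\infty$ on $\Gamma\cap\{\lim_{n\to\infty}X_n=x^*\}$. \end{enumerate} Then $\mathbb{P}\big[\Ga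mma\cap\{\lim_{n\to\infty}X_n=x^*\}\big]=0$.
   Context: $\|\cdot\|$ is the norm of an inner product on the Euclidean space considered. $(\gamma_n)_{n\ge0}$ and $(c_n)_{n\ge0}$ are non-negative deterministic sequences with $c_n\ne0$ infinitely often and $\sum_nc_n^2<\infty$. $(\varepsilon_n)_{n\ge0}$ and $(r_n)_{n\ge0}$ are $\mathbb{R}^d$-valued sequences adapted to $(\mathcal{F}_n)$ such that for all $n\ge0$, $\mathbb{E}[\varepsilon_{n+1}|\mathcal{F}_n]=0$ and $\mathbb{E}[\|\varepsilon_{n+1}\|^2|\mathcal{F}_n]<\infty$. $x^*$ is an equilibrium of $f$ if $f(x^* )=0$; it is repulsive (resp. unstable) if all eigenvalues (resp. at least one eigenvalue) of $Df(x^* )$ have (has) a positive real part. $f\in C^{1+\nu}(\mathcal{N}^* )$ means that $f|_{\mathcal{N}^*}$ is $C^1$ with $\nu$-Hölder differential. Fix an integer $\delta^+\in\{1,\dots,d\}$, $\delta^-=d-\delta^+$, an invertible real $d\times d$ matrix $P$ and real square matrices $H^\pm$ of size $\delta^\pm$ with $P^{-1}Df(x^* )P=\mathrm{diag}[H^+,H^-]$ (block diagonal), all eigenvalues of $H^+$ having positive real part and all eigenvalues of $H^-$ having non-positive real part. For $y\in\mathbb{R}^d$ write $y=(y^+,y^-)\in\mathbb{R}^{\delta^+}\times\mathbb{R}^{\delta^-}$ and set $\varepsilon_n^\pm=(P^{-1}\varepsilon_n)^\pm$. *)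

(* Defs.v *)
From HB Require Import structures.
From mathcomp Require Import all_boot all_order all_algebra.
From mathcomp Require Import complex.
From mathcomp Require Import all_classical all_reals all_analysis.
From mathcomp Require Import measurable_realfun.

Set Implicit Arguments.
Unset Strict Implicit.
Unset Printing Implicit Defensive.

Import Order.TTheory GRing.Theory Num.Theory.
Import numFieldNormedType.Exports.

Local Open Scope classical_set_scope.
Local Open Scope ring_scope.

Definition ip_norm (R : realType) (U : lmodType R) (b : {dot U for idfun})
    (u : U) : R :=
  Num.sqrt (b u u).

(* [Dmx f x *m v] is the differential of [f] at [x] applied to the column [v]; the
   library's ['J f x] is the transposed matrix, for functions of rows. *)
Definition Dmx (R : realType) (n : nat) (f : 'cV[R]_n -> 'cV[R]_n)
    (x : 'cV[R]_n) : 'M[R]_n :=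
  \matrix_(i, j) ('d f x (delta_mx j 0)) i 0.

(* A neighbourhood is not assumed to be open, whence the interior: this is
   where the differential makes sense whatever [f] is outside of [N]. *)
Definition C1_on (R : realType) (n : nat) (N : set 'cV[R]_n)
    (f : 'cV[R]_n -> 'cV[R]_n) : Prop :=
  forall x, N° x -> differentiable f x /\ {for x, continuous (Dmx f)}.

(* The norms are the entrywise maximum; any other choice only changes [K]. *)
Definition C1_holder_on (R : realType) (n : nat) (nu : R) (N : set 'cV[R]_n)
    (f : 'cV[R]_n -> 'cV[R]_n) : Prop :=
  C1_on N f /\
  exists K : R, forall x y, N° x -> N° y ->
    `|Dmx f x - Dmx f y| <= K * `|x - y| `^ nu.

Definition complex_eigenvalue (R : realType) (n : nat) (A : 'M[R]_n)
    (z : R[i]) : bool :=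
  eigenvalue (map_mx (real_complex R) A) z.

Definition equilibrium (R : realType) (n : nat) (f : 'cV[R]_n -> 'cV[R]_n)
    (x : 'cV[R]_n) : Prop :=
  f x = 0.

Definition repulsive (R : realType) (n : nat) (f : 'cV[R]_n -> 'cV[R]_n)
    (x : 'cV[R]_n) : Prop :=
  equilibrium f x /\
  forall z, complex_eigenvalue (Dmx f x) z -> 0 < complex.Re z.

Definition unstable (R : realType) (n : nat) (f : 'cV[R]_n -> 'cV[R]_n)
    (x : 'cV[R]_n) : Prop :=
  equilibrium f x /\
  exists2 z, complex_eigenvalue (Dmx f x) z & 0 < complex.Re z.

Definition filtration (d : measure_display) (Omega : measurableType d)
    (F : nat -> set (set Omega)) : Prop :=
  [/\ forall n, sigma_algebra setT (F n),
      forall n, F n `<=` measurable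
    & forall m n, (m <= n)%N -> F m `<=` F n].

Definition measurable_wrt (d d' : measure_display) (Omega : measurableType d)
    (T : measurableType d') (G : set (set Omega)) (g : Omega -> T) : Prop :=
  forall B, measurable B -> G (g @^-1` B).

(* Borel measurability of a vector is that of its coordinates. *)
Definition adapted (R : realType) (d : measure_display)
    (Omega : measurableType d) (n : nat) (F : nat -> set (set Omega))
    (Y : nat -> Omega -> 'cV[R]_n) : Prop :=
  forall k i, measurable_wrt (F k) (fun w => Y k w i 0).

(* [Z] is a version of E[Y | G], for [Y] with values in [0, +oo]. *)
Definition is_cond_exp_nneg (R : realType) (d : measure_display)
    (Omega : measurableType d) (P : probability Omega R)
    (G : set (set Omega)) (Y Z : Omega -> \bar R) : Prop :=
  [/\ forall w, (0 <= Z w)%E,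
      measurable_wrt G Z
    & forall A, G A ->
        (\int[P]_(w in A) Z w = \int[P]_(w in A) Y w)%E].

(* [Z] is a version of E[Y | G] = E[Y^+ | G] - E[Y^- | G], both terms being
   almost surely finite; [Y] itself need not be integrable. *)
Definition is_cond_exp (R : realType) (d : measure_display)
    (Omega : measurableType d) (P : probability Omega R)
    (G : set (set Omega)) (Y Z : Omega -> R) : Prop :=
  exists Zp Zm : Omega -> \bar R,
    [/\ is_cond_exp_nneg P G (EFin \o Y^\+) Zp,
        is_cond_exp_nneg P G (EFin \o Y^\-) Zm
      & {ae P, forall w, [/\ (Zp w < +oo)%E, (Zm w < +oo)%E
                           & ((Z w)%:E = Zp w - Zm w)%E]}].

(* For a nonnegative sequence, convergence of the series. *)
Definition finite_sum (R : realType) (u : nat -> R) : Prop :=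
  (\sum_(0 <= n <oo) (u n)%:E < +oo)%E.

(* The sum over n > t, meaningful only for nonnegative [u] with
   [finite_sum u]. *)
Definition tail_sum (R : realType) (u : nat -> R) (t : nat) : R :=
  fine (\sum_(t.+1 <= n <oo) (u n)%:E)%E.

Definition alpha (R : realType) (c : nat -> R) (t : nat) : R :=
  Num.sqrt (tail_sum (fun n => c n ^+ 2) t).

(* Main.v *)
Require Import Defs.
From HB Require Import structures.
From mathcomp Require Import all_boot all_order all_algebra.
From mathcomp Require Import complex.
From mathcomp Require Import all_classical all_reals all_analysis.
From mathcomp Require Import measurable_realfun.
From mathcomp Require Import ring lra.

Set Implicit Arguments.
Unset Strict Implicit.
Unset Printing Implicit Defensive.

Import Order.TTheory GRing.Theory Num.Theory.
Import numFieldNormedType.Exports.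

Local Open Scope classical_set_scope.
Local Open Scope ring_scope.

(* In the coordinates [y = Q^-1 (x - xs) = (u, v)], one noiseless step expands
   [u] and barely expands [v].  Pulling the plane [u = 0] back from a far
   horizon [m] therefore gives graphs [u = phi_n v] of small Lipschitz constant
   such that the drift does not decrease the norm of [Z_n = u_n - phi_n v_n].
   In the repulsive case there is no [v], and [Z_n = u_n].  The noise acts on
   [Z_n] through [eps^+ - L eps^-], [L] being the linear part of [phi_n], and
   its conditional variance is bounded below since [L] is small; the remainders
   [c |r|] and [(c |eps^-|)^(1 + nu)] sum over [n > t] to [o(alpha t)].

   The potential [1 / (1 + |Z|^2 / b)], with [b] of the order of [alpha(t)^2],
   is pushed away from [1] by the noise, and over the times [n > t] by an amount
   of order one.  As [Z_m] is close to [0] for large [m] on the event [E] of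
   being trapped, [P (A & E) <= (1 - p) P A] for every [A] of [F_t], with [p > 0]
   independent of [t] and [A].  Approximating [E] by such [A] gives [P E = 0]. *)

(** * Norms *)

(** Nothing assumed is uniform: the moment bounds hold on [Gamma] only eventually, with random
    constants, and [Gamma] need not be generated by the filtration. So the event is covered by
    countably many windows, indexed by integers [k] and [t1], on which the bounds hold with constant
    [k.+1] from time [t1] on. Inside a window the constants have a forced order: the norms, the
    excitation [bl] and moment bound [Ba], the slope [del], the chart with its [rho] and [K], the
    error tolerance [kappa], and last the starting time. The finite horizon spares the construction
    of an invariant manifold; all constants are independent of it. A Lipschitz graph alone would not
    do: the noise has mean zero, but only a linear term inherits this, so each graph must carry a
    linear part with a superlinear remainder. The exponent [1 + nu] of condition (ii) is that of
    this remainder. The potential is bounded, so its integrals exist although nothing is known on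
    the moments of [X], and the decay of its gradient makes the first-order noise term
    integrable. *)

Section Euclidean.
Variable R : realType.
Implicit Types k n : nat.

Definition edot k (x y : 'cV[R]_k) : R := \sum_i x i 0 * y i 0.
Definition enorm k (x : 'cV[R]_k) : R := Num.sqrt (edot x x).

Lemma edotC k (x y : 'cV[R]_k) : edot x y = edot y x.
Proof. by apply: eq_bigr => i _; rewrite mulrC. Qed.

Lemma edotDl k (x y z : 'cV[R]_k) : edot (x + y) z = edot x z + edot y z.
Proof. by rewrite -big_split; apply: eq_bigr => i _; rewrite mxE mulrDl. Qed.

Lemma edotZl k a (x z : 'cV[R]_k) : edot (a *: x) z = a * edot x z.
Proof. by rewrite mulr_sumr; apply: eq_bigr => i _; rewrite mxE mulrA. Qed.

Lemma edotNl k (x z : 'cV[R]_k) : edot (- x) z = - edot x z.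
Proof. by rewrite -scaleN1r edotZl mulN1r. Qed.

Lemma edotDr k (x y z : 'cV[R]_k) : edot z (x + y) = edot z x + edot z y.
Proof. by rewrite !(edotC z) edotDl. Qed.

Lemma edotZr k a (x z : 'cV[R]_k) : edot z (a *: x) = a * edot z x.
Proof. by rewrite !(edotC z) edotZl. Qed.

Lemma edotNr k (x z : 'cV[R]_k) : edot z (- x) = - edot z x.
Proof. by rewrite !(edotC z) edotNl. Qed.

Lemma edot_ge0 k (x : 'cV[R]_k) : 0 <= edot x x.
Proof. by apply: sumr_ge0 => i _; rewrite -expr2 sqr_ge0. Qed.

Lemma enorm_ge0 k (x : 'cV[R]_k) : 0 <= enorm x.
Proof. exact: sqrtr_ge0. Qed.

Lemma sqr_enorm k (x : 'cV[R]_k) : enorm x ^+ 2 = edot x x.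
Proof. by rewrite sqr_sqrtr ?edot_ge0. Qed.

Lemma enorm0 k : enorm (0 : 'cV[R]_k) = 0.
Proof. by rewrite /enorm /edot big1 ?sqrtr0// => i _; rewrite mxE mul0r. Qed.

Lemma enormZ k a (x : 'cV[R]_k) : enorm (a *: x) = `|a| * enorm x.
Proof.
by rewrite /enorm edotZl edotZr mulrA -expr2 sqrtrM ?sqr_ge0// sqrtr_sqr.
Qed.

Lemma enormN k (x : 'cV[R]_k) : enorm (- x) = enorm x.
Proof. by rewrite /enorm edotNl edotNr opprK. Qed.

(** Cauchy-Schwarz, from the square of [enorm y *: x - enorm x *: y]; a vanishing norm is treated
    apart because the factor [enorm x * enorm y] is cancelled. *)
Lemma edot_le k (x y : 'cV[R]_k) : edot x y <= enorm x * enorm y.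
Proof.
have [x0|x0] := eqVneq (enorm x) 0.
  suff -> : edot x y = 0 by rewrite x0 mul0r.
  apply: big1 => i _; suff -> : x i 0 = 0 by rewrite mul0r.
  have /eqP : edot x x = 0 by rewrite -sqr_enorm x0 expr0n.
  rewrite psumr_eq0; last by move=> j _; rewrite -expr2 sqr_ge0.
  by move=> /allP/(_ i (mem_index_enum i))/=; rewrite mulf_eq0 orbb => /eqP.
have [y0|y0] := eqVneq (enorm y) 0.
  suff -> : edot x y = 0 by rewrite y0 mulr0.
  apply: big1 => i _; suff -> : y i 0 = 0 by rewrite mulr0.
  have /eqP : edot y y = 0 by rewrite -sqr_enorm y0 expr0n.
  rewrite psumr_eq0; last by move=> j _; rewrite -expr2 sqr_ge0.
  by move=> /allP/(_ i (mem_index_enum i))/=; rewrite mulf_eq0 orbb => /eqP.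
have := edot_ge0 (enorm y *: x - enorm x *: y).
rewrite !(edotDl, edotDr, edotNl, edotNr, edotZl, edotZr) (edotC y x).
rewrite -!sqr_enorm.
have hx : 0 < enorm x by rewrite lt_def x0 enorm_ge0.
have hy : 0 < enorm y by rewrite lt_def y0 enorm_ge0.
have hxy := mulr_gt0 hx hy => h.
rewrite -(ler_pM2l hxy); nra.
Qed.

Lemma edot_norm_le k (x y : 'cV[R]_k) : `|edot x y| <= enorm x * enorm y.
Proof. by rewrite ler_norml edot_le lerNl -edotNl -(enormN x) edot_le. Qed.

Lemma enormD k (x y : 'cV[R]_k) : enorm (x + y) <= enorm x + enorm y.
Proof.
rewrite -(@ler_pXn2r _ 2)// ?nnegrE ?addr_ge0 ?enorm_ge0//.
rewrite sqr_enorm edotDl !edotDr (edotC y x) -!sqr_enorm.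
have := edot_le x y; nra.
Qed.

Lemma sum_const_ord k (a : R) : \sum_(i < k) a = k%:R * a.
Proof. by rewrite big_const_ord iter_addr_0 mulr_natl. Qed.

Lemma entry_le_norm m n (A : 'M[R]_(m, n)) i j : `|A i j| <= `|A|.
Proof.
rewrite [leRHS]/Num.norm/= mx_normrE.
exact: (le_bigmax _ (fun ij : 'I_m * 'I_n => `|A ij.1 ij.2|) (i, j)).
Qed.

Lemma norm_le_entries m n (A : 'M[R]_(m, n)) e :
  0 <= e -> (forall i j, `|A i j| <= e) -> `|A| <= e.
Proof.
move=> e0 h; rewrite [leLHS]/Num.norm/= mx_normrE.
by apply/bigmax_leP; split => // -[i j] _; exact: h.
Qed.

Lemma norm_mulmx_le m n k (A : 'M[R]_(m, n)) (B : 'M[R]_(n, k)) :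
  `|A *m B| <= n%:R * (`|A| * `|B|).
Proof.
apply: norm_le_entries => [|i j]; first by rewrite !mulr_ge0.
rewrite mxE (le_trans (ler_norm_sum _ _ _))//.
rewrite mulr_natl -[X in _ *+ X]card_ord -sumr_const ler_sum// => l _.
by rewrite normrM ler_pM// entry_le_norm.
Qed.

Lemma norm_le_enorm k (x : 'cV[R]_k) : `|x| <= enorm x.
Proof.
apply: norm_le_entries => [|i j]; first exact: enorm_ge0.
rewrite (ord1 j) -sqrtr_sqr ler_wsqrtr// /edot (bigD1 i)//= expr2 lerDl.
by apply: sumr_ge0 => l _; rewrite -expr2 sqr_ge0.
Qed.

Lemma enorm_le_norm k (x : 'cV[R]_k) : enorm x <= k%:R * `|x|.
Proof.
case: k x => [|k] x.
  by rewrite /enorm /edot big_ord0 sqrtr0 mul0r.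
rewrite -(@ler_pXn2r _ 2)// ?nnegrE ?mulr_ge0 ?enorm_ge0//.
rewrite sqr_enorm (@le_trans _ _ (k.+1%:R * `|x| ^+ 2))//.
  rewrite mulr_natl -[X in _ *+ X]card_ord -sumr_const ler_sum// => l _.
  by rewrite -expr2 -real_normK ?num_real// lerXn2r ?nnegrE// entry_le_norm.
rewrite exprMn ler_wpM2r ?sqr_ge0// expr2 ler_peMl// ler1n//.
Qed.

Lemma Re_mulmx m n k (A : 'M[R[i]]_(m, n)) (B : 'M[R[i]]_(n, k)) :
  map_mx (@complex.Re R) (A *m B) =
  map_mx (@complex.Re R) A *m map_mx (@complex.Re R) B
  - map_mx (@complex.Im R) A *m map_mx (@complex.Im R) B.
Proof.
apply/matrixP => i j; rewrite !mxE -sumrB.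
rewrite (big_morph (@complex.Re R) (id1 := 0) (op1 := +%R))//; last by case=> ? ? [].
by apply: eq_bigr => l _; rewrite !mxE; case: (A i l) (B l j) => [? ?] [].
Qed.

Lemma Im_mulmx m n k (A : 'M[R[i]]_(m, n)) (B : 'M[R[i]]_(n, k)) :
  map_mx (@complex.Im R) (A *m B) =
  map_mx (@complex.Re R) A *m map_mx (@complex.Im R) B
  + map_mx (@complex.Im R) A *m map_mx (@complex.Re R) B.
Proof.
apply/matrixP => i j; rewrite !mxE -big_split/=.
rewrite (big_morph (@complex.Im R) (id1 := 0) (op1 := +%R))//; last by case=> ? ? [].
by apply: eq_bigr => l _; rewrite !mxE; case: (A i l) (B l j) => [? ?] [].
Qed.

(** The right-hand side is the real part of [conj(x) t y]: four real products, each absorbed by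
    [2 |u v| <= u^2 + v^2]. It bounds what an off-diagonal entry [t] can take away from the
    hermitian form. *)
Lemma complex_mul_form_ge (t x y : R[i]) (e : R) :
  `|complex.Re t| <= e -> `|complex.Im t| <= e ->
  - (e * (complex.Re x ^+ 2 + complex.Im x ^+ 2
      + (complex.Re y ^+ 2 + complex.Im y ^+ 2))) <=
  complex.Re x * complex.Re (t * y) + complex.Im x * complex.Im (t * y).
Proof.
case: t x y => [a b] [p q] [r s] /=; rewrite !ler_norml => /andP[a1 a2] /andP[b1 b2].
have key (c u v : R) : - e <= c -> c <= e ->
    - (e * (u ^+ 2 + v ^+ 2)) <= 2 * (c * (u * v)).
  move=> c1 c2.
  have := mulr_ge0 (_ : 0 <= e + c) (sqr_ge0 (u + v)).
  have := mulr_ge0 (_ : 0 <= e - c) (sqr_ge0 (u - v)).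
  by move=> /(_ ltac:(lra)) h1 /(_ ltac:(lra)) h2; nra.
have h1 := key a p r a1 a2; have h2 := key a q s a1 a2.
have h3 := key (- b) p s ltac:(lra) ltac:(lra).
have h4 := key b q r b1 b2.
nra.
Qed.

(* The Schur form is made almost diagonal by the weights [tau ^ i], and the
   hermitian norm obtained is split into real and imaginary parts. *)
Lemma adapted_norm n (A : 'M[R]_n) (mu : R) :
  (forall z, complex_eigenvalue A z -> mu < complex.Re z) ->
  exists m (S : 'M[R]_(m, n)) (S' : 'M[R]_(n, m)), S' *m S = 1%:M /\
    forall u, mu * edot (S *m u) (S *m u) <= edot (S *m (A *m u)) (S *m u).
Proof.
case: n A => [|n] A Aeig.
  exists 0%N, 0, 0; split; first by apply/matrixP => -[].
  by move=> u; rewrite /edot !big_ord0 mulr0.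
pose Ac := map_mx (real_complex R) A.
have [P Pu] := @Schur _ _ Ac (ltn0Sn n).
have Punit := unitarymx_unit Pu.
rewrite /similar_to /=; set T := conjmx P Ac => Ttrig.
have PA : P *m Ac = T *m P by rewrite /T conjumx// mulmxKV.
have Tdiag i : mu < complex.Re (T i i).
  have ev : eigenvalue T (T i i).
    rewrite eigenvalue_root_char char_poly_trig//.
    by rewrite /root horner_prod (bigD1 i)//= hornerXsubC subrr mul0r.
  apply: Aeig; rewrite /complex_eigenvalue -/Ac.
  apply: (@eigenvalue_conjmx _ _ _ P); rewrite ?row_free_unit//.
  by rewrite PA submxMl.
clearbody T.
have [g g0 gP] : exists2 g : R, 0 < g & forall i, mu + g <= complex.Re (T i i).
  pose g := \big[Order.min/1]_i (complex.Re (T i i) - mu).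
  exists g; first by apply: lt_bigmin => // i _; rewrite subr_gt0.
  by move=> i; rewrite -lerBrDl; apply: bigmin_le_cond.
pose M := \sum_i \sum_j (`|complex.Re (T i j)| + `|complex.Im (T i j)|).
have TM i j : `|complex.Re (T i j)| + `|complex.Im (T i j)| <= M.
  rewrite /M (bigD1 i)//= (bigD1 j)//= -addrA lerDl addr_ge0//.
    by apply: sumr_ge0 => *; rewrite addr_ge0.
  by apply: sumr_ge0 => *; apply: sumr_ge0 => *; rewrite addr_ge0.
have M0 : 0 <= M by apply: le_trans (TM ord0 ord0); rewrite addr_ge0.
pose N : R := 2 * n.+1%:R * (M + 1).
have N0 : 0 < N by rewrite /N mulr_gt0 ?mulr_gt0 ?ltr0n ?ltr_wpDl.
(* Chosen for [2 (n + 1) tau M <= g]: entries damped to [tau M] then consume no more than the gap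
   [g] between [mu] and the diagonal. *)
pose tau := g / (g + N).
have tau0 : 0 < tau by rewrite divr_gt0 ?addr_gt0.
have tau1 : tau <= 1 by rewrite ler_pdivrMr ?addr_gt0// mul1r lerDl ltW.
have tauN : 2 * n.+1%:R * (tau * M) <= g.
  rewrite [leLHS](_ : _ = g * (2 * n.+1%:R * M) / (g + N)); last first.
    by rewrite /tau; field; rewrite gt_eqF// addr_gt0.
  rewrite ler_pdivrMr ?addr_gt0// ler_pM2l// /N.
  by have := ler0n R n.+1; lra.
pose cc := real_complex R.
have ccE x : cc x = (x +i* 0)%C by [].
have ccM x y : cc (x * y) = cc x * cc y by exact: rmorphM.
pose D := diag_mx (\row_(i < n.+1) cc (tau ^+ i)).
pose E := diag_mx (\row_(i < n.+1) cc (tau ^- i)).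
have ED : E *m D = 1%:M.
  apply/matrixP => i j; rewrite /E mul_diag_mx !mxE; case: eqVneq => [->|_].
    by rewrite !mulr1n -rmorphM mulVf ?rmorph1// expf_neq0// gt_eqF.
  by rewrite !mulr0n mulr0.
pose W := D *m P; pose V := invmx P *m E; pose T' := D *m T *m E.
have VW : V *m W = 1%:M.
  by rewrite /V /W mulmxA -(mulmxA _ E) ED mulmx1 mulVmx.
have WA : W *m Ac = T' *m W.
  rewrite /W /T' -(mulmxA D P) PA.
  by rewrite -!mulmxA (mulmxA E) ED mul1mx.
have T'E i j : T' i j = cc (tau ^+ i * tau ^- j) * T i j.
  rewrite ccM mulrAC; by rewrite /T' mul_mx_diag mxE mul_diag_mx !mxE.
(* The complex change of basis [W] is made real by stacking its real and imaginary parts. Hence the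
   doubled dimension, and a left inverse read off the real part of [V *m W = 1%:M]. *)
exists (n.+1 + n.+1)%N.
exists (col_mx (map_mx (@complex.Re R) W) (map_mx (@complex.Im R) W)).
exists (row_mx (map_mx (@complex.Re R) V) (- map_mx (@complex.Im R) V)).
split.
  rewrite mul_row_col mulNmx -Re_mulmx VW.
  by apply/matrixP => i j; rewrite !mxE; case: eqP.
move=> u; pose uc := map_mx cc u; pose y := W *m uc.
have SE v : col_mx (map_mx (@complex.Re R) W) (map_mx (@complex.Im R) W) *m v =
    col_mx (map_mx (@complex.Re R) (W *m map_mx cc v))
           (map_mx (@complex.Im R) (W *m map_mx cc v)).
  rewrite mul_col_mx Re_mulmx Im_mulmx.
  have -> : map_mx (@complex.Im R) (map_mx cc v) = 0 by apply/matrixP => ? ?; rewrite !mxE.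
  have -> : map_mx (@complex.Re R) (map_mx cc v) = v by apply/matrixP => ? ?; rewrite !mxE.
  by rewrite !mulmx0 subr0 add0r.
have SA : W *m map_mx cc (A *m u) = T' *m y.
  have -> : map_mx cc (A *m u) = Ac *m uc by exact: map_mxM.
  by rewrite mulmxA WA -mulmxA.
pose s i := complex.Re (y i 0) ^+ 2 + complex.Im (y i 0) ^+ 2.
have s0 i : 0 <= s i by rewrite addr_ge0 ?sqr_ge0.
rewrite !SE SA -/uc -/y; clearbody y T'.
rewrite /edot !big_split_ord/= -!big_split/=.
under eq_bigr do rewrite !col_mxEu !col_mxEd !mxE -!expr2 -/(s _).
under [leRHS]eq_bigr do rewrite !col_mxEu !col_mxEd.
pose q i j := complex.Re (y i 0) * complex.Re (T' i j * y j 0)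
  + complex.Im (y i 0) * complex.Im (T' i j * y j 0).
have qE i : map_mx (@complex.Re R) (T' *m y) i 0 * map_mx (@complex.Re R) y i 0
    + map_mx (@complex.Im R) (T' *m y) i 0 * map_mx (@complex.Im R) y i 0
    = \sum_j q i j.
  rewrite !mxE /q big_split/= -!mulr_sumr.
  rewrite (big_morph (@complex.Re R) (id1 := 0) (op1 := +%R))//; last by case=> ? ? [].
  rewrite (big_morph (@complex.Im R) (id1 := 0) (op1 := +%R))//; last by case=> ? ? [].
  by congr (_ + _); rewrite mulrC.
under [leRHS]eq_bigr do rewrite qE.
(* [T] is lower triangular, so off the diagonal only [j < i] contributes, with a factor
   [tau ^ (i - j) <= tau]. The loss is charged to every pair, which makes the double sum
   symmetric. *)
have qle i j : (if j == i then (mu + g) * s i else 0) - tau * M * (s i + s j) <= q i j.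
  have := TM i j; set t := T i j => tM.
  have [->|ji] := eqVneq j i.
    rewrite /q T'E mulfV ?expf_neq0 ?gt_eqF// mul1r.
    have -> : (mu + g) * s i - tau * M * (s i + s i) = (mu + g - 2 * (tau * M)) * s i by ring.
    rewrite [leRHS](_ : _ = complex.Re (T i i) * s i); last first.
      by rewrite /s; case: (T i i) (y i 0) => [? ?] [? ?] /=; ring.
    apply: ler_wpM2r => //; have := gP i.
    by have := mulr_ge0 (ltW tau0) M0; lra.
  rewrite sub0r; have [lij|lij] := ltnP i j.
    rewrite /q T'E /t (is_trig_mxP Ttrig)// mulr0 mul0r !mulr0 addr0 oppr_le0.
    exact: mulr_ge0 (mulr_ge0 (ltW tau0) M0) (addr_ge0 (s0 i) (s0 j)).
  have lij' : (j < i)%N by rewrite ltn_neqAle (inj_eq val_inj) ji.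
  have hT : tau ^+ i * tau ^- j <= tau.
    rewrite -(subnK (ltnW lij')) exprD mulfK ?expf_neq0 ?gt_eqF//.
    by rewrite ler_iXnr ?subn_gt0// ltW.
  have hT0 : 0 <= tau ^+ i * tau ^- j by rewrite mulr_ge0 ?invr_ge0 ?exprn_ge0// ltW.
  apply: complex_mul_form_ge; rewrite T'E -/t.
    rewrite [X in `|X|](_ : _ = tau ^+ i * tau ^- j * complex.Re t).
      rewrite normrM (ger0_norm hT0) ler_pM// (le_trans _ tM)// lerDl//.
    by rewrite ccE; case: (t) => [a b] /=; ring.
  rewrite [X in `|X|](_ : _ = tau ^+ i * tau ^- j * complex.Im t).
    rewrite normrM (ger0_norm hT0) ler_pM// (le_trans _ tM)// lerDr//.
  by rewrite ccE; case: (t) => [a b] /=; ring.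
clearbody s.
apply: (@le_trans _ _ (\sum_i ((mu + g) * s i
    - (n.+1%:R * (tau * M) * s i + tau * M * \sum_j s j)))).
  rewrite sumrB big_split/= -!mulr_sumr.
  rewrite sum_const_ord.
  have : 0 <= \sum_j s j by exact: sumr_ge0.
  nra.
apply: ler_sum => i _; apply: le_trans (ler_sum _ (fun j _ => qle i j)).
rewrite sumrB -big_mkcond/= big_pred1_eq lerD2l lerN2.
rewrite -mulr_sumr big_split/= sum_const_ord.
by rewrite mulrDr mulrA (mulrC (tau * M)).
Qed.
End Euclidean.

(** * Comparison of inner product norms with the maximum norm *)

Section DotNorm.
Variables (R : realType) (k : nat) (ip : {dot 'cV[R]_k for idfun}).
Implicit Types u v : 'cV[R]_k.

Lemma dot_sym u v : ip u v = ip v u.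
Proof. by have := @hermitian_subproof _ _ false idfun ip u v; rewrite expr0 mul1r. Qed.

Lemma dot_addl u v w : ip (u + v) w = ip u w + ip v w.
Proof. by rewrite linearDl. Qed.

Lemma dot_scalel a u v : ip (a *: u) v = a * ip u v.
Proof. by rewrite linearZl_LR. Qed.

Lemma dot0l v : ip 0 v = 0.
Proof. by rewrite linear0l. Qed.

Lemma dot_gt0 u : u != 0 -> 0 < ip u u.
Proof. by move=> u0; rewrite neq0_dnorm_gt0. Qed.

Lemma dot_ge0 u : 0 <= ip u u.
Proof.
have [->|u0] := eqVneq u 0; last by rewrite ltW// neq0_dnorm_gt0.
by rewrite dot0l.
Qed.

Lemma dot_expand u v : ip u v = \sum_i u i 0 * ip (delta_mx i 0) v.
Proof.
rewrite {1}[u]matrix_sum_delta.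
rewrite (big_morph (fun w => ip w v) (id1 := 0) (op1 := +%R)).
- by apply: eq_bigr => i _; rewrite big_ord1 dot_scalel.
- by move=> x y; rewrite dot_addl.
- by rewrite dot0l.
Qed.

Lemma sqr_ip_norm u : ip_norm ip u ^+ 2 = ip u u.
Proof. by rewrite sqr_sqrtr// dot_ge0. Qed.

Lemma ip_norm_ge0 u : 0 <= ip_norm ip u.
Proof. exact: sqrtr_ge0. Qed.

Lemma ip_CauchySchwarz u v : `|ip u v| <= ip_norm ip u * ip_norm ip v.
Proof.
rewrite -(@ler_pXn2r _ 2)// ?nnegrE ?mulr_ge0 ?ip_norm_ge0//.
rewrite exprMn !sqr_ip_norm real_normK ?num_real//.
have [->|v0] := eqVneq v 0.
  by rewrite dot_sym !dot0l expr0n mulr0.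
have vv := dot_gt0 v0.
have := dot_ge0 (ip v v *: u + (- ip u v) *: v).
rewrite dot_addl !dot_scalel ![ip _ (_ + _)]dot_sym !dot_addl !dot_scalel.
rewrite (dot_sym v u) => h; rewrite -(ler_pM2l vv); nra.
Qed.

Lemma ip_norm_le_norm : exists2 C : R, 0 < C & forall u, ip_norm ip u <= C * `|u|.
Proof.
pose C := \sum_i \sum_j `|ip (delta_mx i 0) (delta_mx j 0)|.
have C0 : 0 <= C by apply: sumr_ge0 => *; apply: sumr_ge0.
exists (Num.sqrt C + 1) => [|u]; first by rewrite ltr_wpDl ?sqrtr_ge0.
rewrite (@le_trans _ _ (Num.sqrt C * `|u|))//; last by rewrite ler_wpM2r// lerDl.
rewrite -(@ler_pXn2r _ 2)// ?nnegrE ?mulr_ge0 ?sqrtr_ge0 ?ip_norm_ge0//.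
rewrite sqr_ip_norm exprMn sqr_sqrtr//.
have -> : ip u u = \sum_i \sum_j u i 0 * u j 0 * ip (delta_mx i 0) (delta_mx j 0).
  rewrite {1}dot_expand; apply: eq_bigr => i _.
  rewrite dot_sym dot_expand mulr_sumr; apply: eq_bigr => j _.
  by rewrite dot_sym mulrA.
rewrite mulr_suml; apply: ler_sum => i _; rewrite mulr_suml; apply: ler_sum => j _.
rewrite (le_trans (ler_norm _))// normrM mulrC ler_wpM2l// normrM expr2.
by rewrite ler_pM// entry_le_norm.
Qed.

(* Each coordinate of [u] is the product of [u] with a fixed vector, read off
   the inverse of the Gram matrix. *)
Lemma norm_le_ip_norm : exists2 C : R, 0 < C & forall u, `|u| <= C * ip_norm ip u.
Proof.
pose G : 'M[R]_k := \matrix_(i, j) ip (delta_mx i 0) (delta_mx j 0).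
have GE u v : ip u v = (u^T *m G *m v) 0 0.
  rewrite dot_expand -mulmxA mxE; apply: eq_bigr => i _.
  rewrite dot_sym dot_expand !mxE; congr (_ * _); apply: eq_bigr => j _.
  by rewrite dot_sym mxE mulrC.
have Gu : G \in unitmx.
  rewrite -row_free_unit -kermx_eq0; apply/rowV0P => x /sub_kermxP xG.
  apply/eqP/negPn/negP => x0.
  have xT0 : x^T != 0 by rewrite trmx_eq0.
  have := dot_gt0 xT0.
  by rewrite GE trmxK xG mul0mx mxE ltxx.
pose a i : 'cV[R]_k := (row i (invmx G))^T.
have aE i u : ip (a i) u = u i 0.
  by rewrite GE trmxK -row_mul mulVmx// -row_mul mul1mx mxE.
exists (1 + \sum_i ip_norm ip (a i)) => [|u].
  by rewrite ltr_wpDr// sumr_ge0// => *; rewrite ip_norm_ge0.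
apply: norm_le_entries => [|i j].
  by rewrite mulr_ge0 ?ip_norm_ge0// addr_ge0// sumr_ge0// => *; rewrite ip_norm_ge0.
rewrite (ord1 j) -aE (le_trans (ip_CauchySchwarz _ _))// ler_wpM2r ?ip_norm_ge0//.
rewrite (bigD1 i)//= addrCA lerDl addr_ge0// sumr_ge0// => *.
exact: ip_norm_ge0.
Qed.
End DotNorm.

(** * Graph transform *)

Section SNorm.
Variable R : realType.

(** A norm as soon as [S] has a left inverse. Rectangular matrices are allowed because
    [adapted_norm] delivers its norms in this form. *)
Definition snorm m n (S : 'M[R]_(m, n)) (u : 'cV[R]_n) : R := enorm (S *m u).

Variables (m n : nat) (S : 'M[R]_(m, n)).
Implicit Types u v : 'cV[R]_n.

Lemma snorm_ge0 u : 0 <= snorm S u. Proof. exact: enorm_ge0. Qed.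

Lemma snorm0 : snorm S 0 = 0. Proof. by rewrite /snorm mulmx0 enorm0. Qed.

Lemma snormD u v : snorm S (u + v) <= snorm S u + snorm S v.
Proof. by rewrite /snorm mulmxDr enormD. Qed.

Lemma snormN u : snorm S (- u) = snorm S u.
Proof. by rewrite /snorm mulmxN enormN. Qed.

Lemma snormB u v : snorm S (u - v) <= snorm S u + snorm S v.
Proof. by rewrite -(snormN v) snormD. Qed.

Lemma snormBC u v : snorm S (u - v) = snorm S (v - u).
Proof. by rewrite -opprB snormN. Qed.

Lemma snormZ a u : snorm S (a *: u) = `|a| * snorm S u.
Proof. by rewrite /snorm -scalemxAr enormZ. Qed.

Lemma snorm_lbD u v : snorm S u - snorm S v <= snorm S (u + v).
Proof. by rewrite lerBlDr -(snormN v) -{1}(addrK v u) snormD. Qed.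

Lemma snorm_le_norm : exists2 C, 0 <= C & forall u, snorm S u <= C * `|u|.
Proof.
exists (m%:R * (n%:R * `|S|)) => [|u]; first by rewrite !mulr_ge0.
rewrite (le_trans (enorm_le_norm _))// -!mulrA ler_wpM2l//.
exact: norm_mulmx_le.
Qed.

Lemma norm_le_snorm (S' : 'M[R]_(n, m)) : S' *m S = 1%:M ->
  exists2 C, 0 <= C & forall u, `|u| <= C * snorm S u.
Proof.
move=> S'S; exists (m%:R * `|S'|) => [|u]; first by rewrite mulr_ge0.
rewrite -{1}(mul1mx u) -S'S -mulmxA (le_trans (norm_mulmx_le _ _))//.
by rewrite -!mulrA !ler_wpM2l// norm_le_enorm.
Qed.

(** Cauchy-Schwarz against [S *m u]: the component along [S *m u] alone already expands, whatever
    the size of [g]. *)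
Lemma snorm_expansion (H : 'M[R]_n) (lam g : R) :
  0 <= g -> (forall u, lam * edot (S *m u) (S *m u) <= edot (S *m (H *m u)) (S *m u)) ->
  forall u, (1 + g * lam) * snorm S u <= snorm S (u + g *: (H *m u)).
Proof.
move=> g0 h u; have [u0|u0] := eqVneq (snorm S u) 0.
  by rewrite u0 mulr0 snorm_ge0.
have up : 0 < snorm S u by rewrite lt_def u0 snorm_ge0.
rewrite -(ler_pM2r up) mulrAC -mulrA -expr2 sqr_enorm.
apply: le_trans (edot_le _ _).
rewrite mulmxDr edotDl mulrDl mul1r lerD2l -scalemxAr edotZl -mulrA ler_wpM2l//.
Qed.

(** Squaring leaves a term [g^2 |H u|^2], which [g * C ^+ 2 <= 2 * mu] turns into a first-order one;
    then [1 + 4 g mu <= (1 + 2 g mu)^2]. *)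
Lemma snorm_nonexpansion (H : 'M[R]_n) (mu C g : R) :
  0 <= g -> 0 <= mu -> (forall u, snorm S (H *m u) <= C * snorm S u) ->
  g * C ^+ 2 <= 2 * mu ->
  (forall u, edot (S *m (H *m u)) (S *m u) <= mu * edot (S *m u) (S *m u)) ->
  forall u, snorm S (u + g *: (H *m u)) <= (1 + g * (2 * mu)) * snorm S u.
Proof.
move=> g0 mu0 hC gC h u.
have e0 : 0 <= 1 + g * (2 * mu) by rewrite addr_ge0// !mulr_ge0.
rewrite -(@ler_pXn2r _ 2)// ?nnegrE ?mulr_ge0 ?snorm_ge0//.
rewrite /snorm mulmxDr -scalemxAr sqr_enorm.
rewrite edotDl !edotDr !(edotZl, edotZr) (edotC (S *m u) (S *m (H *m u))).
rewrite -!sqr_enorm -!/(snorm _ _).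
have := h u; rewrite -sqr_enorm -/(snorm _ _).
have : snorm S (H *m u) ^+ 2 <= C ^+ 2 * snorm S u ^+ 2.
  rewrite -exprMn; apply: lerXn2r; rewrite ?nnegrE ?snorm_ge0//.
  by rewrite (le_trans _ (hC u))// snorm_ge0.
set a := edot _ _; set b := snorm S (H *m u); set x := snorm S u => hb ha.
have x2 := sqr_ge0 x.
have h1 : g * (g * b ^+ 2) <= g * (2 * mu * x ^+ 2).
  rewrite ler_wpM2l//; apply: le_trans (ler_wpM2l g0 hb) _.
  by rewrite mulrA ler_wpM2r.
nra.
Qed.
End SNorm.

Lemma inj_unitmx (R : realType) n (A : 'M[R]_n) :
  (forall u : 'cV[R]_n, A *m u = 0 -> u = 0) -> A \in unitmx.
Proof.
move=> h; rewrite -unitmx_tr -row_free_unit -kermx_eq0; apply/rowV0P => x /sub_kermxP xA.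
by apply: trmx_inj; rewrite trmx0; apply: h; rewrite -[A]trmxK -trmx_mul xA trmx0.
Qed.

Section VectorEntries.
Variables (R : realType) (m n : nat).
Implicit Types A B : 'M[R]_(m, n).
Lemma addmx_entry A B i j : (A + B) i j = A i j + B i j. Proof. by rewrite mxE. Qed.
Lemma oppmx_entry A i j : (- A) i j = - A i j. Proof. by rewrite mxE. Qed.
Lemma scalemx_entry a A i j : (a *: A) i j = a * A i j. Proof. by rewrite mxE. Qed.
Lemma zeromx_entry i j : (0 : 'M[R]_(m, n)) i j = 0. Proof. by rewrite mxE. Qed.
Definition mx_entry := (addmx_entry, oppmx_entry, scalemx_entry, zeromx_entry).
End VectorEntries.

(* An alias, so that no instance is added on ['cV_n] itself. *)
Definition complete_cV (R : realType) (n : nat) := 'cV[R]_n.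
HB.instance Definition _ (R : realType) (n : nat) := Complete.on (complete_cV R n).
HB.instance Definition _ (R : realType) (n : nat) := NormedModule.on (complete_cV R n).

Lemma cV_contraction_fixpoint (R : realType) n (Th : 'cV[R]_n -> 'cV[R]_n) :
  (forall u u', `|Th u - Th u'| <= 1 / 2 * `|u - u'|) -> exists u, u = Th u.
Proof.
move=> h.
pose X : completeNormedModType R := complete_cV R n.
have [|||u _ uE] := @banach_fixed_point R X setT (totalfun_ setT (Th : X -> X)).
- exists (1/2)%:nng; split => /=; first lra.
  by move=> [x y] _ /=; exact: h.
- exact: closedT.
- by exists 0.
- by exists u.
Qed.

Section GraphTransform.
Variable R : realType.
Variables (p q mp mq : nat) (S : 'M[R]_(mp, p)) (T : 'M[R]_(mq, q)).
Variables (Hp : 'M[R]_p) (Hm : 'M[R]_q).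
Variables (gp : 'cV[R]_p -> 'cV[R]_q -> 'cV[R]_p) (gm : 'cV[R]_p -> 'cV[R]_q -> 'cV[R]_q).
Variables (lam del nu C K : R).
Hypotheses (lam0 : 0 < lam) (del0 : 0 < del) (del1 : del <= 1).
Hypotheses (nu0 : 0 < nu) (nu1 : nu <= 1) (C0 : 0 <= C) (CK : 64 * C <= lam * K).
Let np := snorm S.
Let nm := snorm T.
Let d0 := del * lam / 32.

Definition graph_lip (phi : 'cV[R]_q -> 'cV[R]_p) :=
  forall v v', np (phi v - phi v') <= del * nm (v - v').

(** A [C^(1 + nu)] bound stated pointwise. Continuity of [L] in [v] is not asked: a remainder with
    one constant [K] is all that the noise estimate consumes, and this property is stable under
    pullback. *)
Definition graph_lin (phi : 'cV[R]_q -> 'cV[R]_p) :=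
  forall v, exists L : 'M[R]_(p, q), (forall h, np (L *m h) <= del * nm h) /\
    forall h, np (phi (v + h) - phi v - L *m h) <= K * nm h `^ (1 + nu).

Definition stepp g (u : 'cV[R]_p) (v : 'cV[R]_q) : 'cV[R]_p := u + g *: (Hp *m u + gp u v).
Definition stepm g (u : 'cV[R]_p) (v : 'cV[R]_q) : 'cV[R]_q := v + g *: (Hm *m v + gm u v).

Hypothesis gp_lip : forall u v u' v',
  np (gp u v - gp u' v') <= d0 * (np (u - u') + nm (v - v')).
Hypothesis gm_lip : forall u v u' v',
  nm (gm u v - gm u' v') <= d0 * (np (u - u') + nm (v - v')).
Hypothesis gp_lin : forall u v, exists (A : 'M[R]_p) (B : 'M[R]_(p, q)),
  (forall a h, np (A *m a + B *m h) <= d0 * (np a + nm h)) /\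
  forall a h, np (gp (u + a) (v + h) - gp u v - (A *m a + B *m h))
    <= C * (np a + nm h) `^ (1 + nu).
Hypothesis gm_lin : forall u v, exists (A : 'M[R]_(q, p)) (B : 'M[R]_q),
  (forall a h, nm (A *m a + B *m h) <= d0 * (np a + nm h)) /\
  forall a h, nm (gm (u + a) (v + h) - gm u v - (A *m a + B *m h))
    <= C * (np a + nm h) `^ (1 + nu).

Variable g : R.
Hypotheses (g0 : 0 <= g) (glam : g * lam <= 1).
Hypothesis Hp_exp : forall u, (1 + g * lam) * np u <= np (u + g *: (Hp *m u)).
Hypothesis Hm_nexp : forall v, nm (v + g *: (Hm *m v)) <= (1 + g * (lam / 16)) * nm v.
Variables (c1 c2 CH : R).
Hypotheses (c1P : forall u, `|u| <= c1 * np u) (c10 : 0 <= c1).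
Hypotheses (c2P : forall u, np u <= c2 * `|u|) (c20 : 0 <= c2).
Hypotheses (CHP : forall u, np (Hp *m u) <= CH * np u) (CH0 : 0 <= CH).
Hypothesis g_small : c1 * c2 * (g * (CH + lam)) <= 1 / 2.

Let d00 : 0 <= d0. Proof. by rewrite /d0 !mulr_ge0 ?invr_ge0// ltW. Qed.

(** [x] and [y] are the sizes of an increment along [u] and [v], and [w] that of its image along
    [v]. With [e = g * lam], the expansion [1 + e] of [x] outweighs the growth [1 + e / 16] of [y]
    and the coupling [d0], so the slope [del] reproduces itself instead of degrading from step to
    step. Serves for [phi] and again for its linear part. *)
Lemma graph_bound x y w : 0 <= x -> 0 <= y ->
  (1 + g * lam) * x <= del * w + g * (d0 * (x + y)) ->
  w <= (1 + g * (lam / 16)) * y + g * (d0 * (x + y)) -> x <= del * y.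
Proof.
move=> x0 y0 h1 h2.
have gl : 0 <= g * lam by rewrite mulr_ge0// ltW.
have := ler_wpM2l (ltW del0) h2.
have e1 : g * (d0 * (x + y)) = del * (g * lam / 32 * (x + y)).
  by rewrite /d0; field.
rewrite e1 in h1 *; set e := g * lam in gl h1 *.
have -> : g * (lam / 16) = e / 16 by rewrite /e mulrA.
move=> h3.
have xy : 0 <= e * (x + y) by rewrite mulr_ge0// addr_ge0.
have dxy : del * (del * (e * (x + y))) <= del * (e * (x + y)).
  by rewrite ler_wpM2l ?(ltW del0)// ler_piMl.
have dx : del * (e * x) <= e * x by rewrite ler_piMl// mulr_ge0.
have k : (1 + 7/8 * e) * x <= (1 + 7/8 * e) * (del * y).
  have : 0 <= e * (del * y) by rewrite mulr_ge0// mulr_ge0// ltW.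
  nra.
by rewrite -(ler_pM2l (_ : 0 < 1 + 7/8 * e))//; lra.
Qed.

Lemma stepm_lip u v u' v' : nm (stepm g u v - stepm g u' v')
  <= (1 + g * (lam / 16)) * nm (v - v') + g * (d0 * (np (u - u') + nm (v - v'))).
Proof.
have -> : stepm g u v - stepm g u' v' =
    ((v - v') + g *: (Hm *m (v - v'))) + g *: (gm u v - gm u' v').
  rewrite /stepm mulmxBr; apply/matrixP => i j; rewrite !mx_entry; ring.
apply: le_trans (snormD _ _ _) _; apply: lerD; first exact: Hm_nexp.
by rewrite snormZ ger0_norm// ler_wpM2l.
Qed.

(* The graph of [phi] is the preimage of the graph of [phi1] under one step;
   [phi v] is found as a fixed point. *)
Lemma graph_exists phi1 : graph_lip phi1 ->
  exists phi : 'cV[R]_q -> 'cV[R]_p, forall v, stepp g (phi v) v = phi1 (stepm g (phi v) v).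
Proof.
move=> lip1.
suff : forall v, exists u : 'cV[R]_p, stepp g u v = phi1 (stepm g u v).
  by move/choice => [phi phiP]; exists phi.
(* The equation for [u] as a fixed point. The contraction is estimated in [np], where the slope
   bounds live, and carried to the maximum norm at the cost [c1 * c2], which [g_small] covers. *)
move=> v; pose Th u := phi1 (stepm g u v) - g *: (Hp *m u + gp u v).
have ThP u u' : `|Th u - Th u'| <= 1 / 2 * `|u - u'|.
  apply: le_trans (c1P _) _.
  have -> : Th u - Th u' = (phi1 (stepm g u v) - phi1 (stepm g u' v))
      - g *: (Hp *m (u - u') + (gp u v - gp u' v)).
    rewrite /Th mulmxBr; apply/matrixP => i j; rewrite !mx_entry; ring.
  have h1 := lip1 (stepm g u v) (stepm g u' v).
  have h2 : nm (stepm g u v - stepm g u' v) <= g * (d0 * np (u - u')).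
    have := stepm_lip u v u' v; rewrite subrr /nm snorm0 mulr0 add0r addr0.
    exact.
  have h3 := gp_lip u v u' v; rewrite subrr /nm snorm0 addr0 in h3.
  have h4 : np (Hp *m (u - u') + (gp u v - gp u' v)) <= (CH + d0) * np (u - u').
    by apply: le_trans (snormD _ _ _) _; rewrite mulrDl lerD.
  have h5 : np ((phi1 (stepm g u v) - phi1 (stepm g u' v))
      - g *: (Hp *m (u - u') + (gp u v - gp u' v)))
      <= g * (CH + lam) * np (u - u').
    apply: le_trans (snormB _ _ _) _; rewrite snormZ ger0_norm//.
    have n0 := snorm_ge0 S (u - u').
    have h6 := ler_wpM2l g0 h4.
    have h7 := ler_wpM2l (ltW del0) h2.
    have h8 : del * (g * (d0 * np (u - u'))) <= g * (d0 * np (u - u')).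
      exact: (ler_piMl (mulr_ge0 g0 (mulr_ge0 d00 n0)) del1).
    have h9 : d0 <= lam / 32 by rewrite /d0 -mulrA ler_piMl// divr_ge0// ltW.
    have h10 : g * (d0 * np (u - u')) <= g * (lam / 32 * np (u - u')).
      exact: (ler_wpM2l g0 (ler_wpM2r n0 h9)).
    have h11 := mulr_ge0 g0 (mulr_ge0 (ltW lam0) n0).
    apply: le_trans (lerD (le_trans h1 (le_trans h7 h8)) h6) _.
    move: h10 h11; rewrite -/(np _); move: (np _) (d0) => x y; lra.
  apply: le_trans (ler_wpM2l c10 h5) _.
  have h12 : c1 * (g * (CH + lam) * np (u - u')) <= c1 * (g * (CH + lam) * (c2 * `|u - u'|)).
    by rewrite ler_wpM2l// ler_wpM2l// mulr_ge0// addr_ge0// ltW.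
  apply: le_trans h12 _.
  have -> : c1 * (g * (CH + lam) * (c2 * `|u - u'|)) = c1 * c2 * (g * (CH + lam)) * `|u - u'|.
    by ring.
  by rewrite ler_wpM2r.
have [u uE] := cV_contraction_fixpoint ThP.
exists u; rewrite /stepp {1}uE /Th subrK//.
Qed.

Let np_ge0 u : 0 <= np u. Proof. exact: snorm_ge0. Qed.
Let nm_ge0 v : 0 <= nm v. Proof. exact: snorm_ge0. Qed.

(** All claims use that differences along [u] expand, while the graph [phi1] gives back only [del]
    times a barely expanded difference. For the last claim, [(u, v)] is compared with the point
    [(phi v, v)] of the new graph over the same [v]. *)
Lemma graph_step phi1 : graph_lip phi1 -> graph_lin phi1 ->
  exists phi, [/\ graph_lip phi, graph_lin phi &
    forall u v, np (u - phi v) <= np (stepp g u v - phi1 (stepm g u v))].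
Proof.
move=> lip1 lin1; have [phi phiE] := graph_exists lip1.
have exp_diff u v u' v' :
    (1 + g * lam) * np (u - u') - g * (d0 * (np (u - u') + nm (v - v')))
    <= np (stepp g u v - stepp g u' v').
  have -> : stepp g u v - stepp g u' v' =
      ((u - u') + g *: (Hp *m (u - u'))) + g *: (gp u v - gp u' v').
    rewrite /stepp mulmxBr; apply/matrixP => i j; rewrite !mx_entry; ring.
  apply: le_trans (snorm_lbD _ _ _); rewrite snormZ ger0_norm//.
  exact: lerB (Hp_exp _) (ler_wpM2l g0 (gp_lip _ _ _ _)).
have lip : graph_lip phi.
  move=> v v'; have h1 := exp_diff (phi v) v (phi v') v'.
  rewrite !phiE in h1.
  have h2 := lip1 (stepm g (phi v) v) (stepm g (phi v') v').
  apply: (graph_bound (np_ge0 _) (nm_ge0 _) _ (stepm_lip (phi v) v (phi v') v')).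
  by rewrite -lerBlDr; exact: le_trans h1 h2.
exists phi; split => //; last first.
  move=> u v.
  have -> : stepp g u v - phi1 (stepm g u v) = (stepp g u v - stepp g (phi v) v)
      - (phi1 (stepm g u v) - phi1 (stepm g (phi v) v)).
    by rewrite phiE opprB addrA subrK.
  have h1 := exp_diff u v (phi v) v.
  have h2 := lip1 (stepm g u v) (stepm g (phi v) v).
  have h3 := stepm_lip u v (phi v) v.
  rewrite subrr /nm snorm0 mulr0 add0r addr0 -/nm in h3.
  rewrite subrr /nm snorm0 addr0 -/nm in h1.
  have := snorm_lbD S (stepp g u v - stepp g (phi v) v)
      (- (phi1 (stepm g u v) - phi1 (stepm g (phi v) v))).
  rewrite snormN => h4; apply: le_trans h4; rewrite -!/(np _).
  have := ler_wpM2l (ltW del0) h3 => {}h3.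
  apply: le_trans (lerB h1 (le_trans h2 h3)).
  have x0 := np_ge0 (u - phi v).
  have h5 := ler_piMl (mulr_ge0 g0 (mulr_ge0 d00 x0)) del1.
  have h6 : d0 <= lam / 32.
    by rewrite /d0 -mulrA ler_piMl// divr_ge0// ltW.
  have h7 := ler_wpM2l g0 (ler_wpM2r x0 h6).
  have h8 := mulr_ge0 g0 (mulr_ge0 (ltW lam0) x0).
  move: h5 h7 h8 x0; move: (np _) (d0) => x y; lra.
move=> v; have [L1 [L1b L1P]] := lin1 (stepm g (phi v) v).
have [Ap [Bp [Apb ApP]]] := gp_lin (phi v) v.
have [Am [Bm [Amb AmP]]] := gm_lin (phi v) v.
(* Differentiating the defining equation of [phi] gives [M *m L = Rh] for its linear part [L]. As
   [M] is a perturbation of an expanding map, it is injective, hence invertible. *)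
pose M : 'M[R]_p := 1%:M + g *: Hp + g *: Ap - g *: (L1 *m Am).
pose Rh : 'M[R]_(p, q) := L1 *m (1%:M + g *: Hm + g *: Bm) - g *: Bp.
have ME (u : 'cV[R]_p) : M *m u = (u + g *: (Hp *m u)) + (g *: (Ap *m u) - g *: (L1 *m (Am *m u))).
  rewrite /M mulmxBl !mulmxDl mul1mx -!scalemxAl mulmxA.
  by apply/matrixP => i j; rewrite !mx_entry; ring.
have Apb1 u : np (Ap *m u) <= d0 * np u.
  by have := Apb u 0; rewrite mulmx0 /nm snorm0 !addr0.
have Amb1 u : nm (Am *m u) <= d0 * np u.
  by have := Amb u 0; rewrite mulmx0 /nm snorm0 !addr0.
have Mexp u : (1 + g * lam / 2) * np u <= np (M *m u).
  rewrite ME; apply: le_trans (snorm_lbD _ _ _).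
  have h1 : np (g *: (Ap *m u) - g *: (L1 *m (Am *m u))) <=
      g * (d0 * np u) + g * (d0 * np u).
    apply: le_trans (snormB _ _ _) _; rewrite !snormZ ger0_norm//.
    apply: lerD; first by rewrite ler_wpM2l.
    rewrite ler_wpM2l//; apply: le_trans (L1b _) _.
    apply: le_trans (ler_wpM2l (ltW del0) (Amb1 _)) _.
    exact: (ler_piMl (mulr_ge0 d00 (np_ge0 u)) del1).
  apply: le_trans (lerB (Hp_exp u) h1).
  have h6 : d0 <= lam / 32.
    by rewrite /d0 -mulrA ler_piMl// divr_ge0// ltW.
  have h7 := ler_wpM2l g0 (ler_wpM2r (np_ge0 u) h6).
  have h8 := mulr_ge0 g0 (mulr_ge0 (ltW lam0) (np_ge0 u)).
  move: h7 h8 (np_ge0 u); move: (np _) (d0) => x y; lra.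
have gl0 : 0 <= g * lam by rewrite mulr_ge0// ltW.
have Mu : M \in unitmx.
  apply: inj_unitmx => u Mu0.
  have := Mexp u; rewrite Mu0 /np snorm0 -/np => h.
  have np0 : np u <= 0.
    by rewrite -(ler_pM2l (_ : 0 < 1 + g * lam / 2)) ?mulr0//; lra.
  apply/eqP; rewrite -normr_le0; apply: le_trans (c1P u) _.
  by rewrite -(mulr0 c1) ler_wpM2l.
pose L := invmx M *m Rh.
have MLE (h : 'cV[R]_q) : M *m (L *m h) = Rh *m h by rewrite /L mulmxA mulKVmx.
have RhE (h : 'cV[R]_q) : Rh *m h =
    L1 *m h + g *: (L1 *m (Hm *m h)) + g *: (L1 *m (Bm *m h)) - g *: (Bp *m h).
  rewrite /Rh mulmxBl -mulmxA !mulmxDl mul1mx -!scalemxAl !mulmxDr -!scalemxAr.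
  by [].
exists L; split => [h|h].
  set x := L *m h.
  pose y := (h + g *: (Hm *m h)) + g *: (Am *m x + Bm *m h).
  have xE : x + g *: (Hp *m x) = L1 *m y - g *: (Ap *m x + Bp *m h).
    have := MLE h; rewrite -/x ME RhE /y !mulmxDr -!scalemxAr !mulmxDr.
    move=> /matrixP e; apply/matrixP => i j; have := e i j.
    rewrite !mx_entry; lra.
  apply: (@graph_bound _ _ (nm y) (np_ge0 _) (nm_ge0 _)).
    apply: le_trans (Hp_exp x) _; rewrite xE.
    apply: le_trans (snormB _ _ _) _; apply: lerD; first exact: L1b.
    by rewrite snormZ ger0_norm// ler_wpM2l.
  apply: le_trans (snormD _ _ _) _; apply: lerD; first exact: Hm_nexp.
  by rewrite snormZ ger0_norm// ler_wpM2l.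
set u := phi v; set u' := phi (v + h).
have du : np (u' - u) <= nm h.
  have := lip (v + h) v; rewrite addrAC subrr add0r => /le_trans; apply.
  by rewrite ler_piMl ?nm_ge0.
have := ApP (u' - u) h; have := AmP (u' - u) h.
rewrite -/u (addrC u) subrK => hm hp.
pose v1 := stepm g u v; pose dv := stepm g u' (v + h) - v1.
have hdv : nm dv <= (1 + g * lam / 8) * nm h.
  have := stepm_lip u' (v + h) u v.
  have -> : v + h - v = h by rewrite addrAC subrr add0r.
  rewrite -/v1 -/dv.
  have h6 : d0 <= lam / 32.
    by rewrite /d0 -mulrA ler_piMl// divr_ge0// ltW.
  have s0 : 0 <= np (u' - u) + nm h by rewrite addr_ge0.
  have h7 := ler_wpM2l g0 (ler_wpM2r s0 h6).
  have h8 := ler_wpM2l gl0 du.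
  move: h7 h8 (nm_ge0 h); move: (np _) (nm h) (d0) => a b d; lra.
have := L1P dv; rewrite -/v1 [v1 + dv]addrC subrK => h1.
pose N := nm h `^ (1 + nu).
have NN : 0 <= N by exact: powR_ge0.
have pow2 a : 1 <= a -> a `^ (1 + nu) <= a ^+ 2.
  move=> a1; rewrite -powR_mulrn ?(le_trans ler01 a1)//.
  by apply: ler_powR => //; move: nu1; lra.
have nu2 : 0 <= 1 + nu by rewrite addr_ge0// ltW.
have N1 : (np (u' - u) + nm h) `^ (1 + nu) <= 4 * N.
  apply: (@le_trans _ _ ((2 * nm h) `^ (1 + nu))).
    apply: ge0_ler_powR; rewrite ?nnegrE ?addr_ge0 ?mulr_ge0//.
      exact: ltW.
    by rewrite mulr_natl mulr2n lerD2r.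
  rewrite (powRM _ (ler0n _ 2) (nm_ge0 h)) -/N; apply: (ler_wpM2r NN).
  by apply: le_trans (pow2 2 _) _; lra.
have N2 : nm dv `^ (1 + nu) <= (1 + 3 / 8 * (g * lam)) * N.
  have e0 : 0 <= 1 + g * lam / 8 by lra.
  apply: (@le_trans _ _ (((1 + g * lam / 8) * nm h) `^ (1 + nu))).
    by apply: ge0_ler_powR; rewrite ?nnegrE ?mulr_ge0//; exact: ltW.
  rewrite (powRM _ e0 (nm_ge0 h)) -/N; apply: (ler_wpM2r NN).
  apply: le_trans (pow2 _ _) _; first lra.
  by move: glam gl0; move: (g * lam) => e; nra.
rewrite -/N in h1 hm hp *; clearbody N.
set rp := gp u' _ - _ - _ in hp; set rm := gm u' _ - _ - _ in hm.
set r1 := phi1 _ - _ - _ in h1.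
have rE : M *m (u' - u - L *m h) = r1 + (g *: (L1 *m rm) - g *: rp).
  rewrite mulmxBr MLE RhE ME /r1 /rm /rp /v1 -!phiE -/u -/u' /dv /v1 /stepp /stepm.
  rewrite ?(mulmxDr, mulmxBr, mulmxN) -?scalemxAr.
  rewrite ?(mulmxDr, mulmxBr, mulmxN) -?scalemxAr.
  by apply/matrixP => i j; rewrite !mx_entry; ring.
(* With [e = g * lam], [M] expands by [1 + e / 2], whereas the remainder of [phi1] grows by
   [(1 + e / 8) ^ (1 + nu) <= 1 + 3/8 e]. The difference [K e / 8] absorbs the [8 g C] of the two
   nonlinear remainders: this is [64 * C <= lam * K]. *)
have h2 : (1 + g * lam / 2) * np (u' - u - L *m h) <= (1 + g * lam / 2) * (K * N).
  apply: le_trans (Mexp _) _; rewrite rE.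
  apply: le_trans (snormD _ _ _) _.
  have K0 : 0 <= K by rewrite -(ler_pM2l lam0) mulr0; apply: le_trans CK; rewrite mulr_ge0.
  have a1 : np r1 <= K * ((1 + 3 / 8 * (g * lam)) * N).
    exact: le_trans h1 (ler_wpM2l K0 N2).
  have a2 : nm rm <= C * (4 * N) := le_trans hm (ler_wpM2l C0 N1).
  have a3 : np rp <= C * (4 * N) := le_trans hp (ler_wpM2l C0 N1).
  have a4 : np (g *: (L1 *m rm) - g *: rp) <= g * (C * (4 * N)) + g * (C * (4 * N)).
    apply: le_trans (snormB _ _ _) _; rewrite !snormZ ger0_norm//.
    apply: lerD; last by rewrite ler_wpM2l.
    rewrite ler_wpM2l//; apply: le_trans (L1b _) _.
    apply: le_trans a2; exact: (ler_piMl (nm_ge0 _) del1).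
  apply: le_trans (lerD a1 a4) _.
  have a5 := ler_wpM2l g0 (ler_wpM2r NN CK).
  by move: a5; lra.
by rewrite -(ler_pM2l (_ : 0 < 1 + g * lam / 2))//; lra.
Qed.
End GraphTransform.

(** * Charts at the equilibrium *)

Section MeanValue.
Variables (R : realType) (n : nat) (f : 'cV[R]_n -> 'cV[R]_n).

Lemma diff_Dmx x k : differentiable f x -> 'd f x k = Dmx f x *m k.
Proof.
move=> dfx; rewrite {1}[k]matrix_sum_delta linear_sum.
apply/matrixP => i j; rewrite (ord1 j) summxE mxE.
by apply: eq_bigr => l _; rewrite big_ord1 linearZ/= !mxE mulrC.
Qed.

(** The scalar mean value theorem coordinate by coordinate; the intermediate points differ, but
    [eta] holds along the whole segment. [M] is free: the differential at the equilibrium gives the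
    Lipschitz bound, the one at the base point the Hölder remainder. *)
Lemma mean_value x k (M : 'M[R]_n) eta : 0 <= eta ->
  (forall t, 0 <= t <= 1 -> differentiable f (x + t *: k) /\
     `|Dmx f (x + t *: k) - M| <= eta) ->
  `|f (x + k) - f x - M *m k| <= n%:R * (eta * `|k|).
Proof.
move=> eta0 h; apply: norm_le_entries => [|i j]; first by rewrite !mulr_ge0.
rewrite (ord1 j); pose F (z : 'cV[R]_n) : R := f z i 0.
pose phi (t : R) : R := F (x + t *: k).
pose df (t : R) : R := (Dmx f (x + t *: k) *m k) i 0.
have hD (t : R) : 0 <= t <= 1 -> is_derive t 1 phi (df t).
  move=> /h[dft _].
  have dF : is_derive (x + t *: k) k F (df t).
    have dc := differentiable_coord (f (x + t *: k)) i 0.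
    have dFx : differentiable F (x + t *: k).
      by apply: (@differentiable_comp _ _ _ _ f (fun N : 'cV[R]_n => N i 0 : R)).
    split; first exact: diff_derivable.
    have dv : derivable f (x + t *: k) k by exact: diff_derivable.
    have := derive_mx dv; rewrite deriveE// diff_Dmx// => /matrixP/(_ i 0).
    by rewrite /df [in RHS]mxE => ->.
  have e : (fun h => h^-1 *: ((phi \o shift t) (h *: 1) - phi t)) =
           (fun h => h^-1 *: ((F \o shift (x + t *: k)) (h *: k) - F (x + t *: k))).
    apply/funext => z /=; congr (_ *: (_ - _)); rewrite /phi; congr F.
    by rewrite scalerDl addrCA [z *: 1]mulr1.
  split; first by rewrite /derivable e; case: dF.
  by rewrite /derive e; case: dF.
have [|||c c01] := @MVT_segment R phi df 0 1 => //.
- by move=> t; rewrite in_itv/= => /andP[t0 t1]; apply: hD; rewrite !ltW.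
- apply: derivable_within_continuous => t; rewrite in_itv/= => /hD dt.
  by case: dt.
rewrite subr0 mulr1 /phi scale1r scale0r addr0 /F => e.
have -> : (f (x + k) - f x - M *m k) i 0 = ((Dmx f (x + c *: k) - M) *m k) i 0.
  by rewrite mulmxBl !mx_entry -/(df c) -e.
apply: le_trans (entry_le_norm _ _ _) _; apply: le_trans (norm_mulmx_le _ _) _.
rewrite ler_wpM2l// ler_wpM2r//.
by move: c01; rewrite in_itv/= => /h[].
Qed.
End MeanValue.

(** * Truncation with a Lipschitz derivative *)

Section Cutoff.
Variable R : realType.
Implicit Types s h r : R.

(** [tau] vanishes up to 1, equals [s - 2] from 3 on, and its derivative [dtau] is linear in
    between. So [clamp] is the identity on [-1, 1] and constant on each side beyond 3, with a
    Lipschitz derivative; a piecewise linear truncation would have no superlinear remainder at its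
    corners. *)
Let tau s := (Num.max (s - 1) 0) ^+ 2 / 4 - (Num.max (s - 3) 0) ^+ 2 / 4.
Let dtau s := Num.max (s - 1) 0 / 2 - Num.max (s - 3) 0 / 2.

Let tau_incr s h : 0 <= h -> 0 <= tau (s + h) - tau s <= h.
Proof.
by move=> h0; rewrite /tau /Num.max; do 4 case: ifP => ?; apply/andP; split; nra.
Qed.

Let dtau_bound s : 0 <= dtau s <= 1.
Proof. by rewrite /dtau /Num.max; do 2 case: ifP => ?; apply/andP; split; lra. Qed.

Let tau_lin s h : `|tau (s + h) - tau s - dtau s * h| <= h ^+ 2 / 2.
Proof.
have key x : `|Num.max (x + h) 0 ^+ 2 - Num.max x 0 ^+ 2 - 2 * Num.max x 0 * h| <= h ^+ 2.
  rewrite ler_norml /Num.max; do 2 case: ifP => ?; apply/andP; split; nra.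
have := key (s - 1); have := key (s - 3).
rewrite /tau /dtau [s + h - 1]addrAC [s + h - 3]addrAC !ler_norml => /andP[a b] /andP[c d].
by apply/andP; split; lra.
Qed.

Definition clamp s := s - tau s + tau (- s).
Definition dclamp s := 1 - dtau s - dtau (- s).

Lemma clamp_id s : `|s| <= 1 -> clamp s = s.
Proof.
rewrite ler_norml => /andP[h1 h2].
rewrite /clamp /tau !max_r ?subr_le0//; lra.
Qed.

Lemma clamp_bound s : `|clamp s| <= 2.
Proof.
rewrite ler_norml /clamp /tau /Num.max.
by do 4 case: ifP => ?; apply/andP; split; nra.
Qed.

Lemma clamp_lip s s' : `|clamp s - clamp s'| <= `|s - s'|.
Proof.
wlog ss : s s' / s' <= s.
  by move=> H; have [/H//|/ltW/H] := leP s' s; rewrite distrC [leRHS]distrC.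
have h0 : 0 <= s - s' by rewrite subr_ge0.
have := tau_incr s' h0; have := tau_incr (- s) h0.
rewrite (addrC s') subrK addrA addNr add0r => /andP[a b] /andP[c d].
rewrite [leRHS]ger0_norm// ler_norml /clamp; apply/andP; split; lra.
Qed.

Lemma dclamp_bound s : `|dclamp s| <= 1.
Proof.
have /andP[a b] := dtau_bound s; have /andP[c d] := dtau_bound (- s).
by rewrite ler_norml /dclamp; apply/andP; split; lra.
Qed.

Lemma clamp_lin s h : `|clamp (s + h) - clamp s - dclamp s * h| <= h ^+ 2.
Proof.
have := tau_lin s h; have := tau_lin (- s) (- h).
rewrite /clamp /dclamp [- (s + h)]opprD sqrrN !ler_norml => /andP[a b] /andP[c d].
by apply/andP; split; lra.
Qed.

Variable n : nat.
Implicit Types y : 'cV[R]_n.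

Definition clampv r y : 'cV[R]_n := \col_i (r * clamp (y i 0 / r)).
Definition dclampv r y : 'M[R]_n := diag_mx (\row_i dclamp (y i 0 / r)).

Lemma clampv_id r y : 0 < r -> `|y| <= r -> clampv r y = y.
Proof.
move=> r0 yr; apply/matrixP => i j; rewrite (ord1 j) mxE clamp_id.
  by rewrite mulrC divfK ?gt_eqF.
rewrite normrM normfV (gtr0_norm r0) ler_pdivrMr// mul1r.
exact: le_trans (entry_le_norm _ _ _) yr.
Qed.

Lemma clampv_bound r y : 0 < r -> `|clampv r y| <= 2 * r.
Proof.
move=> r0; apply: norm_le_entries => [|i j]; first by rewrite mulr_ge0// ltW.
rewrite (ord1 j) mxE normrM (gtr0_norm r0) mulrC ler_wpM2r ?(ltW r0)//.
exact: clamp_bound.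
Qed.

Lemma clampv_lip r y y' : 0 < r -> `|clampv r y - clampv r y'| <= `|y - y'|.
Proof.
move=> r0; apply: norm_le_entries => // i j; rewrite (ord1 j) !mxE -mulrBr.
rewrite normrM (gtr0_norm r0).
apply: le_trans (ler_wpM2l (ltW r0) (clamp_lip _ _)) _.
rewrite -mulrBl normrM normfV (gtr0_norm r0) mulrC divfK ?gt_eqF//.
by have := entry_le_norm (y - y') i 0; rewrite !mxE.
Qed.

Lemma dclampv_bound r y (h : 'cV[R]_n) : `|dclampv r y *m h| <= `|h|.
Proof.
apply: norm_le_entries => // i j; rewrite mul_diag_mx !mxE (ord1 j) normrM.
rewrite (le_trans _ (entry_le_norm h i 0))// ler_piMl//; exact: dclamp_bound.
Qed.

(** Two regimes: the quadratic remainder [|h|^2 / r] for [|h| <= 1], the Lipschitz bound [2 |h|]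
    beyond. Both lie below [2 / r * |h| ^ (1 + nu)] since [r <= 1] and [nu <= 1]. *)
Lemma clampv_lin r nu y (h : 'cV[R]_n) : 0 < r <= 1 -> 0 <= nu <= 1 ->
  `|clampv r (y + h) - clampv r y - dclampv r y *m h| <= 2 / r * `|h| `^ (1 + nu).
Proof.
move=> /andP[r0 r1] /andP[nu0 nu1].
have h2 : `|clampv r (y + h) - clampv r y - dclampv r y *m h| <= 2 * `|h|.
  apply: le_trans (ler_normB _ _) _; rewrite mulr_natl mulr2n lerD ?dclampv_bound//.
  by apply: le_trans (clampv_lip _ _ r0) _; rewrite addrAC subrr add0r.
have h1 : `|clampv r (y + h) - clampv r y - dclampv r y *m h| <= `|h| ^+ 2 / r.
  apply: norm_le_entries => [|i j]; first by rewrite divr_ge0// ltW.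
  rewrite (ord1 j) !mx_entry mul_diag_mx !mxE mulrDl.
  set a := y i 0 / r; set b := h i 0.
  have -> : r * clamp (a + b / r) - r * clamp a - dclamp a * b =
      r * (clamp (a + b / r) - clamp a - dclamp a * (b / r)).
    by field; rewrite gt_eqF.
  rewrite normrM (gtr0_norm r0).
  apply: le_trans (ler_wpM2l (ltW r0) (clamp_lin _ _)) _.
  have -> : r * (b / r) ^+ 2 = b ^+ 2 / r by field; rewrite gt_eqF.
  rewrite ler_wpM2r ?invr_ge0 ?(ltW r0)// -real_normK ?num_real//.
  by rewrite lerXn2r ?nnegrE// entry_le_norm.
have [hs|hs] := leP `|h| 1.
  apply: le_trans h1 _; rewrite mulrC [leRHS]mulrAC mulrC.
  rewrite ler_wpM2r ?invr_ge0 ?(ltW r0)//.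
  have [->|h0] := eqVneq `|h| 0; first by rewrite expr0n mulr_ge0 ?powR_ge0.
  rewrite -powR_mulrn// (@le_trans _ _ (`|h| `^ (1 + nu)))//; last first.
    by rewrite ler_peMl ?powR_ge0// ler1n.
  apply: ger_powR; first by rewrite lt_def h0 hs normr_ge0.
  by rewrite -[leRHS]/(1 + 1) lerD2l.
apply: le_trans h2 _; rewrite -mulrA ler_wpM2l//.
rewrite (@le_trans _ _ (`|h| `^ (1 + nu)))//; last first.
  by rewrite ler_peMl ?powR_ge0// invf_ge1.
rewrite -{1}[`|h|]powRr1// ler_powR ?(ltW hs)//; by rewrite lerDl.
Qed.
End Cutoff.

Section BlockNorms.
Variables (R : realType) (p q : nat).

Lemma norm_usubmx_le (y : 'cV[R]_(p + q)) : `|usubmx y| <= `|y|.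
Proof. by apply: norm_le_entries => // i j; rewrite mxE entry_le_norm. Qed.

Lemma norm_dsubmx_le (y : 'cV[R]_(p + q)) : `|dsubmx y| <= `|y|.
Proof. by apply: norm_le_entries => // i j; rewrite mxE entry_le_norm. Qed.

Lemma norm_col_mx_le (u : 'cV[R]_p) (v : 'cV[R]_q) : `|col_mx u v| <= `|u| + `|v|.
Proof.
apply: norm_le_entries => [|i j]; first by rewrite addr_ge0.
rewrite mxE; case: fintype.split => k; apply: le_trans (entry_le_norm _ _ _) _.
  by rewrite lerDl.
by rewrite lerDr.
Qed.

Lemma usubmx_mul_col (D : 'M[R]_(p + q)) (u : 'cV[R]_p) (v : 'cV[R]_q) :
  usubmx (D *m col_mx u v) = ulsubmx D *m u + ursubmx D *m v.
Proof. by rewrite -{1}[D]submxK mul_block_col col_mxKu. Qed.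

Lemma dsubmx_mul_col (D : 'M[R]_(p + q)) (u : 'cV[R]_p) (v : 'cV[R]_q) :
  dsubmx (D *m col_mx u v) = dlsubmx D *m u + drsubmx D *m v.
Proof. by rewrite -{1}[D]submxK mul_block_col col_mxKd. Qed.
End BlockNorms.

(** * The nonlinear part of the field near the equilibrium *)

Section LocalNonlinearity.
Variables (R : realType) (n : nat) (f : 'cV[R]_n -> 'cV[R]_n) (N : set 'cV[R]_n).
Variables (xs : 'cV[R]_n) (Q iQ H : 'M[R]_n).
Hypotheses (nbhs_N : nbhs xs N) (C1_f : C1_on N f).
Hypothesis HE : H = iQ *m Dmx f xs *m Q.

Definition conj_field (y : 'cV[R]_n) : 'cV[R]_n := iQ *m f (xs + Q *m y).
Definition nonlin (y : 'cV[R]_n) : 'cV[R]_n := conj_field y - H *m y.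

Lemma C1_ball eta : 0 < eta -> exists2 rho, 0 < rho &
  forall z, `|z - xs| <= rho -> N° z /\ `|Dmx f z - Dmx f xs| <= eta.
Proof.
move=> eta0; have Ni : nbhs xs N° by apply: nbhs_interior.
have [_ cD] := C1_f (nbhs_singleton Ni).
have near1 : \forall z \near xs, N° z /\ `|Dmx f z - Dmx f xs| <= eta.
  near=> z; split; first by near: z.
  by rewrite distrC; near: z; move/cvgrPdist_le : cD; apply.
have [e /= e0 eP] := (@nbhs_normP _ _ _ _).1 near1.
exists (e / 2) => [|z hz]; first by rewrite divr_gt0.
apply: eP; rewrite /ball_/= distrC (le_lt_trans hz)//.
by rewrite ltr_pdivrMr// ltr_pMr// ltr1n.
Unshelve. all: by end_near. Qed.

Let A : R := n%:R * `|iQ| * (n%:R * (n%:R * `|Q|)).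
Let A0 : 0 <= A. Proof. by rewrite /A !mulr_ge0. Qed.

Let conj_mean y y' (M : 'M[R]_n) eta : 0 <= eta ->
  (forall t, 0 <= t <= 1 -> N° (xs + Q *m (y + t *: (y' - y))) /\
     `|Dmx f (xs + Q *m (y + t *: (y' - y))) - M| <= eta) ->
  `|conj_field y' - conj_field y - iQ *m M *m Q *m (y' - y)| <= A * (eta * `|y' - y|).
Proof.
move=> eta0 h.
have e t : xs + Q *m y + t *: (Q *m (y' - y)) = xs + Q *m (y + t *: (y' - y)).
  by rewrite -addrA scalemxAr -mulmxDr.
have hm : `|f (xs + Q *m y + Q *m (y' - y)) - f (xs + Q *m y) - M *m (Q *m (y' - y))|
    <= n%:R * (eta * `|Q *m (y' - y)|).
  apply: (mean_value eta0) => t /h[Nt Mt]; rewrite e; split; last exact: Mt.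
  by have [] := C1_f Nt.
have -> : conj_field y' - conj_field y - iQ *m M *m Q *m (y' - y) =
  iQ *m (f (xs + Q *m y + Q *m (y' - y)) - f (xs + Q *m y) - M *m (Q *m (y' - y))).
  have ey : xs + Q *m y + Q *m (y' - y) = xs + Q *m y'.
    by rewrite -addrA -mulmxDr [y + _]addrC subrK.
  by rewrite ey /conj_field !mulmxBr !mulmxA.
apply: le_trans (norm_mulmx_le _ _) _.
rewrite /A -!mulrA ler_wpM2l// ler_wpM2l//; apply: le_trans hm _.
rewrite ler_wpM2l// mulrCA [leRHS]mulrA [leRHS]mulrCA ler_wpM2l//.
by rewrite (mulrC `|Q|) -mulrA; exact: norm_mulmx_le.
Qed.

Let segment_bound y y' rho rx : `|y| <= rho -> `|y'| <= rho ->
  n%:R * `|Q| * rho <= rx ->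
  forall t, 0 <= t <= 1 -> `|xs + Q *m (y + t *: (y' - y)) - xs| <= rx.
Proof.
move=> hy hy' hr t /andP[t0 t1].
rewrite addrAC subrr add0r; apply: le_trans hr.
apply: le_trans (norm_mulmx_le _ _) _; rewrite -mulrA ler_wpM2l// ler_wpM2l//.
have -> : y + t *: (y' - y) = (1 - t) *: y + t *: y'.
  by apply/matrixP => i j; rewrite !mx_entry; ring.
apply: le_trans (ler_normD _ _) _; rewrite !normrZ (ger0_norm t0) ger0_norm ?subr_ge0//.
have := ler_wpM2l t0 hy'; have := ler_wpM2l (_ : 0 <= 1 - t) hy.
by rewrite subr_ge0 => /(_ t1); lra.
Qed.

Lemma nonlin_lip eta : 0 < eta -> exists2 rho, 0 < rho &
  forall y y', `|y| <= rho -> `|y'| <= rho -> `|nonlin y' - nonlin y| <= eta * `|y' - y|.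
Proof.
move=> eta0; have e0 : 0 < eta / (A + 1) by rewrite divr_gt0// ltr_wpDl.
have [rx rx0 rxP] := C1_ball e0.
exists (rx / (n%:R * `|Q| + 1)) => [|y y' hy hy']; first by rewrite divr_gt0// ltr_wpDl.
have hr : n%:R * `|Q| * (rx / (n%:R * `|Q| + 1)) <= rx.
  by rewrite mulrCA ler_piMr ?(ltW rx0)// ler_pdivrMr ?ltr_wpDl// mul1r lerDl.
have -> : nonlin y' - nonlin y = conj_field y' - conj_field y - H *m (y' - y).
  by rewrite /nonlin mulmxBr; apply/matrixP => i j; rewrite !mx_entry; ring.
rewrite HE; apply: le_trans (conj_mean (ltW e0) _) _.
  by move=> t /(segment_bound hy hy' hr)/rxP.
rewrite mulrA ler_wpM2r// mulrCA ler_piMr ?(ltW eta0)//.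
by rewrite ler_pdivrMr ?ltr_wpDl// mul1r lerDl.
Qed.

(** [D] is the conjugated difference of the differentials of [f] at the base point and at the
    equilibrium, small by continuity. Hölder continuity along the segment adds the power [nu] to the
    remainder. *)
Lemma nonlin_lin nu eta : 0 < eta -> 0 <= nu -> C1_holder_on nu N f ->
  exists2 rho, 0 < rho & exists2 C, 0 <= C &
  forall y, `|y| <= rho -> exists D : 'M[R]_n, (forall h : 'cV[R]_n, `|D *m h| <= eta * `|h|) /\
   forall y', `|y'| <= rho ->
    `|nonlin y' - nonlin y - D *m (y' - y)| <= C * `|y' - y| `^ (1 + nu).
Proof.
move=> eta0 nu0 [_ [K KP]].
have e0 : 0 < eta / (A + 1) by rewrite divr_gt0// ltr_wpDl.
have [rx rx0 rxP] := C1_ball e0.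
exists (rx / (n%:R * `|Q| + 1)); first by rewrite divr_gt0// ltr_wpDl.
have hr : n%:R * `|Q| * (rx / (n%:R * `|Q| + 1)) <= rx.
  by rewrite mulrCA ler_piMr ?(ltW rx0)// ler_pdivrMr ?ltr_wpDl// mul1r lerDl.
pose B := `|K| * (n%:R * `|Q|) `^ nu.
have B0 : 0 <= B by rewrite mulr_ge0 ?powR_ge0.
exists (A * B) => [|y hy]; first exact: mulr_ge0.
pose x := xs + Q *m y.
exists (iQ *m Dmx f x *m Q - H); split => [h|y' hy'].
  rewrite HE -mulmxBl -mulmxBr -!mulmxA.
  have [_ hx] : N° x /\ `|Dmx f x - Dmx f xs| <= eta / (A + 1).
    apply: rxP; have := segment_bound hy hy hr (t := 0).
    by rewrite lexx ler01 scale0r addr0; apply.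
  apply: le_trans (norm_mulmx_le _ _) _.
  apply: (@le_trans _ _ (A * (eta / (A + 1) * `|h|))).
    rewrite [leRHS](_ : _ = n%:R * (`|iQ| * (n%:R * (eta / (A + 1) *
      (n%:R * (`|Q| * `|h|)))))); last by rewrite /A; ring.
    rewrite ler_wpM2l// ler_wpM2l//; apply: le_trans (norm_mulmx_le _ _) _.
    by rewrite ler_wpM2l// ler_pM// norm_mulmx_le.
  rewrite mulrA ler_wpM2r// mulrCA ler_piMr ?(ltW eta0)//.
  by rewrite ler_pdivrMr ?ltr_wpDl// mul1r lerDl.
have -> : nonlin y' - nonlin y - (iQ *m Dmx f x *m Q - H) *m (y' - y) =
    conj_field y' - conj_field y - iQ *m Dmx f x *m Q *m (y' - y).
  rewrite [(_ - H) *m _]mulmxBl; move: (_ *m Q *m _) => Z; rewrite /nonlin mulmxBr.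
  by apply/matrixP => i j; rewrite !mx_entry; ring.
apply: le_trans (@conj_mean _ _ (Dmx f x) (B * `|y' - y| `^ nu) _ _) _.
- by rewrite mulr_ge0 ?powR_ge0.
- move=> t t01; have [Nt _] := rxP _ (segment_bound hy hy' hr t01); split => //.
  have Nx : N° x.
    have [] // := rxP x; have := segment_bound hy hy hr (t := 0).
    by rewrite lexx ler01 scale0r addr0; apply.
  apply: le_trans (KP _ _ Nt Nx) _.
  apply: (@le_trans _ _ (`|K| * `|xs + Q *m (y + t *: (y' - y)) - x| `^ nu)).
    by rewrite ler_wpM2r ?powR_ge0// ler_norm.
  rewrite /B -mulrA ler_wpM2l// -powRM//.
  apply: ge0_ler_powR => //; rewrite ?nnegrE ?mulr_ge0//.
  rewrite /x mulmxDr addrA [xs + _ + _ - _]addrAC subrr add0r.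
  apply: le_trans (norm_mulmx_le _ _) _; rewrite -mulrA ler_wpM2l// ler_wpM2l//.
  by case/andP: t01 => t0 t1; rewrite normrZ ger0_norm// ler_piMl.
suff -> : `|y' - y| `^ (1 + nu) = `|y' - y| `^ nu * `|y' - y| by rewrite !mulrA.
have [->|h0] := eqVneq `|y' - y| 0.
  by rewrite mulr0 powR0// gt_eqF// ltr_pwDl.
by rewrite powRD ?h0 ?implybT// powRr1// mulrC.
Qed.
End LocalNonlinearity.

Section Charts.
Variables (R : realType) (p q : nat).
Variables (f : 'cV[R]_(p + q) -> 'cV[R]_(p + q)) (N : set 'cV[R]_(p + q)).
Variables (xs : 'cV[R]_(p + q)) (Q iQ : 'M[R]_(p + q)) (Hp : 'M[R]_p) (Hm : 'M[R]_q).
Hypotheses (nbhs_N : nbhs xs N) (C1_f : C1_on N f) (fxs : f xs = 0).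
Let H := block_mx Hp 0 0 Hm.
Hypothesis HE : H = iQ *m Dmx f xs *m Q.
Let F := conj_field f xs Q iQ.
Let G := nonlin f xs Q iQ H.

(** The estimates on the drift are wanted at all points. Composition with the truncation keeps the
    nonlinearity near 0 and makes its small Lipschitz constant global. *)
Lemma cut_nonlin eta : 0 < eta -> exists2 rho, 0 < rho &
  exists g : 'cV[R]_(p + q) -> 'cV[R]_(p + q),
  (forall y, `|y| <= rho -> g y = G y) /\
  (forall y y', `|g y - g y'| <= eta * `|y - y'|).
Proof.
move=> eta0; have [rho rho0 rhoP] := nonlin_lip nbhs_N C1_f HE eta0.
have r0 : 0 < rho / 2 by rewrite divr_gt0.
exists (rho / 2) => //; exists (G \o clampv (rho / 2)); split => [y hy|y y'] /=.
  by rewrite clampv_id.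
have hr (z : 'cV[R]_(p + q)) : `|clampv (rho / 2) z| <= rho.
  by apply: le_trans (clampv_bound _ r0) _; rewrite mulrC divfK.
have h := rhoP _ _ (hr y') (hr y); apply: (le_trans h).
by rewrite ler_wpM2l ?(ltW eta0)// clampv_lip.
Qed.

Lemma cut_nonlin_holder nu eta : 0 < nu <= 1 -> C1_holder_on nu N f -> 0 < eta ->
  exists2 rho, 0 < rho & exists g : 'cV[R]_(p + q) -> 'cV[R]_(p + q),
  [/\ (forall y, `|y| <= rho -> g y = G y),
      (forall y y', `|g y - g y'| <= eta * `|y - y'|) &
      exists2 C, 0 <= C & forall y, exists D : 'M[R]_(p + q),
        (forall h : 'cV[R]_(p + q), `|D *m h| <= eta * `|h|) /\
        forall h, `|g (y + h) - g y - D *m h| <= C * `|h| `^ (1 + nu)].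
Proof.
move=> /andP[nu0 nu1] hf eta0.
have [rho1 rho10 rho1P] := nonlin_lip nbhs_N C1_f HE eta0.
have [rho2 rho20 [C C0 CP]] := nonlin_lin nbhs_N C1_f HE eta0 (ltW nu0) hf.
pose r := Num.min 1 (Num.min (rho1 / 2) (rho2 / 2)).
have r0 : 0 < r by rewrite !lt_min ltr01 !divr_gt0.
have r1 : r <= 1 by rewrite ge_min lexx.
have hr1 (z : 'cV[R]_(p + q)) : `|clampv r z| <= rho1.
  apply: le_trans (clampv_bound _ r0) _; rewrite mulrC -ler_pdivlMr//.
  by rewrite !ge_min lexx !orbT.
have hr2 (z : 'cV[R]_(p + q)) : `|clampv r z| <= rho2.
  apply: le_trans (clampv_bound _ r0) _; rewrite mulrC -ler_pdivlMr//.
  by rewrite !ge_min lexx !orbT.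
exists r => //; exists (G \o clampv r); split => [y hy|y y'|] /=.
- by rewrite clampv_id.
- have h := rho1P _ _ (hr1 y') (hr1 y); apply: (le_trans h).
  by rewrite ler_wpM2l ?(ltW eta0)// clampv_lip.
exists (C + eta * (2 / r)) => [|y].
  by rewrite addr_ge0// mulr_ge0 ?(ltW eta0)// divr_ge0// ltW.
have [D [DE DP]] := CP _ (hr2 y).
exists (D *m dclampv r y); split => h.
  rewrite -mulmxA; apply: le_trans (DE _) _.
  by rewrite ler_wpM2l ?(ltW eta0)// dclampv_bound.
set a := clampv r y; set b := clampv r (y + h).
(* Chain rule: the remainder of [G] between the truncated points, plus [D] applied to the remainder
   of the truncation. *)
have -> : G b - G a - D *m dclampv r y *m h =
    (G b - G a - D *m (b - a)) + D *m (b - a - dclampv r y *m h).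
  rewrite [D *m (_ - dclampv _ _ *m _)]mulmxBr -mulmxA.
  by apply/matrixP => i j; rewrite !mx_entry; ring.
apply: le_trans (ler_normD _ _) _; rewrite mulrDl; apply: lerD.
  have h1 := DP _ (hr2 (y + h)); apply: (le_trans h1); rewrite ler_wpM2l//.
  apply: ge0_ler_powR; rewrite ?nnegrE//; first by rewrite addr_ge0// ltW.
  by apply: le_trans (clampv_lip _ _ r0) _; rewrite addrAC subrr add0r.
apply: le_trans (DE _) _; rewrite -mulrA ler_wpM2l ?(ltW eta0)//.
by apply: clampv_lin; rewrite ?r0 ?r1// (ltW nu0) nu1.
Qed.

Variables (mp mq : nat) (S : 'M[R]_(mp, p)) (S' : 'M[R]_(p, mp)).
Variables (T : 'M[R]_(mq, q)) (T' : 'M[R]_(q, mq)) (lam : R).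
Hypotheses (S'S : S' *m S = 1%:M) (T'T : T' *m T = 1%:M) (lam0 : 0 < lam).
Hypothesis HpP : forall u : 'cV[R]_p,
  lam * edot (S *m u) (S *m u) <= edot (S *m (Hp *m u)) (S *m u).
Hypothesis HmP : forall v : 'cV[R]_q,
  edot (T *m (Hm *m v)) (T *m v) <= lam / 32 * edot (T *m v) (T *m v).

Definition chart_step (del nu K : R) (Ft : 'cV[R]_(p + q) -> 'cV[R]_(p + q)) (g : R) :=
  forall phi1, graph_lip S T del phi1 -> graph_lin S T del nu K phi1 ->
  exists phi, [/\ graph_lip S T del phi, graph_lin S T del nu K phi &
    forall y, snorm S (usubmx y - phi (dsubmx y)) <=
      snorm S (usubmx (y + g *: Ft y) - phi1 (dsubmx (y + g *: Ft y)))].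

Lemma norm_const : exists2 c, 0 < c &
  [/\ forall u, snorm S u <= c * `|u|, forall u, `|u| <= c * snorm S u,
      forall v, snorm T v <= c * `|v| & forall v, `|v| <= c * snorm T v].
Proof.
have [a a0 aP] := snorm_le_norm S; have [b b0 bP] := norm_le_snorm S'S.
have [c c0 cP] := snorm_le_norm T; have [d d0 dP] := norm_le_snorm T'T.
exists (a + b + c + d + 1); first by rewrite ltr_wpDl// !addr_ge0.
by split => u; [apply: le_trans (aP u) _|apply: le_trans (bP u) _|
  apply: le_trans (cP u) _|apply: le_trans (dP u) _];
  rewrite ler_wpM2r// ?snorm_ge0//; lra.
Qed.

Let step_block g (G' : 'cV[R]_(p + q) -> 'cV[R]_(p + q)) y :
  y + g *: (H *m y + G' y) =
  col_mx (stepp Hp (fun u v => usubmx (G' (col_mx u v))) g (usubmx y) (dsubmx y))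
         (stepm Hm (fun u v => dsubmx (G' (col_mx u v))) g (usubmx y) (dsubmx y)).
Proof.
have eH : H *m y = col_mx (Hp *m usubmx y) (Hm *m dsubmx y).
  by rewrite -{1}[y]vsubmxK /H mul_block_col !mul0mx addr0 add0r.
have eG : G' y = col_mx (usubmx (G' y)) (dsubmx (G' y)) by rewrite vsubmxK.
rewrite /stepp /stepm vsubmxK eH {1}eG add_col_mx scale_col_mx.
by rewrite -{1}[y]vsubmxK add_col_mx.
Qed.

Let field_lip eta (g : 'cV[R]_(p + q) -> 'cV[R]_(p + q)) :
  (forall y y', `|g y - g y'| <= eta * `|y - y'|) ->
  exists kap, forall y y', `|(H *m y + g y) - (H *m y' + g y')| <= kap * `|y - y'|.
Proof.
move=> hg; exists ((p + q)%:R * `|H| + eta) => y y'.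
have -> : (H *m y + g y) - (H *m y' + g y') = H *m (y - y') + (g y - g y').
  by rewrite mulmxBr; apply/matrixP => i j; rewrite !mx_entry; ring.
apply: le_trans (ler_normD _ _) _; rewrite mulrDl lerD// -mulrA.
exact: norm_mulmx_le.
Qed.

Let block_lip eta c (g : 'cV[R]_(p + q) -> 'cV[R]_(p + q)) : 0 <= eta -> 0 <= c ->
  (forall u, `|u| <= c * snorm S u) -> (forall v, `|v| <= c * snorm T v) ->
  (forall y y', `|g y - g y'| <= eta * `|y - y'|) ->
  forall u v u' v', `|g (col_mx u v) - g (col_mx u' v')| <=
    eta * (c * (snorm S (u - u') + snorm T (v - v'))).
Proof.
move=> eta0 c0 cS cT hg u v u' v'; apply: le_trans (hg _ _) _.
rewrite ler_wpM2l// opp_col_mx add_col_mx.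
by apply: le_trans (norm_col_mx_le _ _) _; rewrite mulrDr lerD.
Qed.

(** Without [v] there is nothing to pull back, and the linear part gains [g * lam] against at most
    [g * lam] lost to the nonlinearity, for every [g]. The bound [lam / (c * c)] pays for the two
    changes of norm. *)
Lemma chart_repulsive : (forall v : 'cV[R]_q, v = 0) ->
  exists2 rho, 0 < rho & exists Ft, [/\
    exists kap, forall y y', `|Ft y - Ft y'| <= kap * `|y - y'|,
    forall y, `|y| <= rho -> Ft y = F y &
    forall g y, 0 <= g -> snorm S (usubmx y) <= snorm S (usubmx (y + g *: Ft y))].
Proof.
move=> flat.
have [c c0 [c1 c2 c3 c4]] := norm_const.
have eta0 : 0 < lam / (c * c) by rewrite divr_gt0// mulr_gt0.
have [rho rho0 [g [gE g_lip]]] := cut_nonlin eta0.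
exists rho => //; exists (fun y => H *m y + g y); split.
- exact: field_lip g_lip.
- by move=> y /gE ->; rewrite /G /nonlin addrC subrK.
move=> gam y gam0.
have g0 : g 0 = 0.
  rewrite gE ?normr0 ?(ltW rho0)// /G /nonlin /conj_field !mulmx0 addr0 fxs.
  by rewrite mulmx0 subrr.
rewrite step_block col_mxKu /stepp vsubmxK scalerDr addrA.
have [u u0] : exists u, u = usubmx y by exists (usubmx y).
rewrite -u0.
apply: le_trans (snorm_lbD _ _ _); rewrite snormZ ger0_norm//.
have h1 := snorm_expansion gam0 HpP u.
have h2 : snorm S (usubmx (g y)) <= lam * snorm S u.
  apply: le_trans (c1 _) _.
  apply: (@le_trans _ _ (c * (lam / (c * c) * (c * snorm S u)))); last first.
    by rewrite le_eqVlt; apply/orP; left; apply/eqP; field; rewrite gt_eqF.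
  rewrite ler_wpM2l ?(ltW c0)//; apply: le_trans (norm_usubmx_le _) _.
  have := block_lip (ltW eta0) (ltW c0) c2 c4 g_lip u 0 0 0.
  rewrite !subr0 col_mx0 g0 subr0 snorm0 addr0.
  by rewrite -(flat (dsubmx y)) u0 vsubmxK.
have := ler_wpM2l gam0 h2; lra.
Qed.

(* [phi n] is the pullback to time [n] of the plane [u = 0] taken at the
   horizon [m]; steps are only controlled from time [n0] on. *)
Definition chart_family (del nu K : R) Ft (gamma : nat -> R) (n0 : nat) :=
  forall m, exists phi : nat -> 'cV[R]_q -> 'cV[R]_p, [/\ phi m = fun=> 0,
    forall n, graph_lip S T del (phi n) /\ graph_lin S T del nu K (phi n) &
    forall n, (n0 <= n < m)%N -> forall y, snorm S (usubmx y - phi n (dsubmx y)) <=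
      snorm S (usubmx (y + gamma n.+1 *: Ft y) - phi n.+1 (dsubmx (y + gamma n.+1 *: Ft y)))].

Lemma zero_graph del nu K : 0 <= del -> 0 <= K ->
  graph_lip S T del (fun=> 0) /\ graph_lin S T del nu K (fun=> 0).
Proof.
move=> del0 K0; split => [v v'|v]; first by rewrite subrr snorm0 mulr_ge0 ?snorm_ge0.
exists 0; split => h; first by rewrite mul0mx snorm0 mulr_ge0 ?snorm_ge0.
by rewrite mul0mx !subr0 snorm0 mulr_ge0 ?powR_ge0.
Qed.

Lemma chart_family_repulsive del nu K Ft gamma : 0 <= del -> 0 <= K ->
  (forall g y, 0 <= g -> snorm S (usubmx y) <= snorm S (usubmx (y + g *: Ft y))) ->
  (forall n, 0 <= gamma n) -> chart_family del nu K Ft gamma 0.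
Proof.
move=> del0 K0 h gamma0 m; exists (fun=> fun=> 0); split => // [n|n _ y].
  exact: zero_graph.
by rewrite !subr0; exact: h.
Qed.

Lemma chart_family_holder del nu K Ft gamma n0 : 0 <= del -> 0 <= K ->
  (forall n, (n0 < n)%N -> chart_step del nu K Ft (gamma n)) ->
  chart_family del nu K Ft gamma n0.
Proof.
move=> del0 K0 h m.
pose good phi := graph_lip S T del phi /\ graph_lin S T del nu K phi.
pose adv g phi1 phi := forall y, snorm S (usubmx y - phi (dsubmx y)) <=
  snorm S (usubmx (y + g *: Ft y) - phi1 (dsubmx (y + g *: Ft y))).
have [B BP] : exists B : nat * ('cV[R]_q -> 'cV[R]_p) -> 'cV[R]_q -> 'cV[R]_p,
    forall np, good np.2 -> good (B np) /\ ((n0 < np.1)%N -> adv (gamma np.1) np.2 (B np)).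
  suff : forall np : nat * ('cV[R]_q -> 'cV[R]_p), exists phi : 'cV[R]_q -> 'cV[R]_p,
      good np.2 -> good phi /\ ((n0 < np.1)%N -> adv (gamma np.1) np.2 phi).
    by move/choice => [B BP]; exists B.
  move=> [n phi1]; have [[l1 l2]|ng] := pselect (good phi1); last first.
    by exists (fun=> 0) => /ng.
  have [nn|nn] := boolP (n0 < n)%N.
    by have [phi [a b c]] := h _ nn _ l1 l2; exists phi.
  by exists phi1 => _; split.
(* [Psi k] is the graph at time [m - k]; from time [n0] backwards [B] may merely copy it. After [m]
   the truncated subtraction returns the zero graph. *)
pose Psi := fix Psi k := if k is k'.+1 then B ((m - k')%N, Psi k') else (fun=> 0).
have Pgood k : good (Psi k).
  elim: k => [|k ih] /=; first exact: zero_graph.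
  by have [] := BP ((m - k)%N, Psi k) ih.
exists (fun n => Psi (m - n)%N); split => [|n|n /andP[n0n nm] y].
- by rewrite subnn.
- exact: Pgood.
have e : (m - n)%N = (m - n.+1).+1 by rewrite subnSK.
have := BP ((m - (m - n.+1))%N, Psi (m - n.+1)%N) (Pgood _).
by rewrite /= subKn// => -[_ /(_ n0n)/(_ y)]; rewrite e /= subKn.
Qed.

Lemma chart_holder nu del : 0 < nu <= 1 -> C1_holder_on nu N f -> 0 < del <= 1 ->
  exists2 rho, 0 < rho & exists2 K, 0 <= K & exists Ft, [/\
    exists kap, forall y y', `|Ft y - Ft y'| <= kap * `|y - y'|,
    forall y, `|y| <= rho -> Ft y = F y &
    exists2 g1, 0 < g1 & forall g, 0 <= g <= g1 -> chart_step del nu K Ft g].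
Proof.
move=> /andP[nu0 nu1] hf /andP[del0 del1].
have [c c0 [c1 c2 c3 c4]] := norm_const.
pose d0 := del * lam / 32.
have d00 : 0 < d0 by rewrite /d0 !mulr_gt0 ?invr_gt0.
have eta0 : 0 < d0 / (c * c) by rewrite divr_gt0// mulr_gt0.
have nu01 : 0 < nu <= 1 by rewrite nu0.
have [rho rho0 [g [gE g_lip [C C0 CP]]]] := cut_nonlin_holder nu01 hf eta0.
have c0' := ltW c0.
have ec x : c * (d0 / (c * c) * (c * x)) = d0 * x by field; rewrite gt_eqF.
pose gp (u : 'cV[R]_p) (v : 'cV[R]_q) := usubmx (g (col_mx u v)).
pose gm (u : 'cV[R]_p) (v : 'cV[R]_q) := dsubmx (g (col_mx u v)).
have blk := block_lip (ltW eta0) c0' c2 c4 g_lip.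
pose C1 := c * (C * c `^ (1 + nu)).
have C10 : 0 <= C1 by rewrite !mulr_ge0 ?powR_ge0.
pose K := 64 * C1 / lam.
have K0 : 0 <= K := divr_ge0 (mulr_ge0 (ler0n R 64) C10) (ltW lam0).
exists rho => //; exists K => //; exists (fun y => H *m y + g y).
have colb a h : `|col_mx a h| <= c * (snorm S a + snorm T h).
  by apply: le_trans (norm_col_mx_le _ _) _; rewrite mulrDr lerD.
have linb (D : 'M[R]_(p + q)) : (forall h : 'cV[R]_(p + q), `|D *m h| <= d0 / (c * c) * `|h|) ->
    forall (a : 'cV[R]_p) (h : 'cV[R]_q), c * `|D *m col_mx a h| <= d0 * (snorm S a + snorm T h).
  move=> DE a h; rewrite -ec ler_wpM2l//; apply: le_trans (DE _) _.
  by rewrite ler_wpM2l// ltW.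
have remb y (D : 'M[R]_(p + q)) : (forall h, `|g (y + h) - g y - D *m h| <= C * `|h| `^ (1 + nu)) ->
    forall (a : 'cV[R]_p) (h : 'cV[R]_q), c * `|g (y + col_mx a h) - g y - D *m col_mx a h| <=
      C1 * (snorm S a + snorm T h) `^ (1 + nu).
  move=> DP a h; rewrite /C1 -mulrA ler_wpM2l//; apply: le_trans (DP _) _.
  rewrite -mulrA ler_wpM2l// -powRM ?addr_ge0 ?snorm_ge0//.
  apply: ge0_ler_powR; rewrite ?nnegrE ?mulr_ge0 ?addr_ge0 ?snorm_ge0//.
  exact: ltW.
have [bS bS0 bSP] : exists2 b, 0 <= b & forall u, snorm S (Hp *m u) <= b * snorm S u.
  exists (c * (p%:R * (`|Hp| * c))) => [|u]; first by rewrite !mulr_ge0.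
  rewrite -!mulrA; apply: le_trans (c1 _) _; rewrite ler_wpM2l//.
  apply: le_trans (norm_mulmx_le _ _) _; rewrite ler_wpM2l// ler_wpM2l//.
have [bT bT0 bTP] : exists2 b, 0 <= b & forall u, snorm T (Hm *m u) <= b * snorm T u.
  exists (c * (q%:R * (`|Hm| * c))) => [|u]; first by rewrite !mulr_ge0.
  rewrite -!mulrA; apply: le_trans (c3 _) _; rewrite ler_wpM2l//.
  apply: le_trans (norm_mulmx_le _ _) _; rewrite ler_wpM2l// ler_wpM2l//.
split.
- exact: field_lip g_lip.
- by move=> y /gE ->; rewrite /G /nonlin addrC subrK.
(* [M] adds up the requirements on the step size: [gam * lam <= 1], the condition of
   [snorm_nonexpansion], and the contraction constant of the graph equation. *)
pose M := lam + bT ^+ 2 * 16 / lam + c * c * (bS + lam) * 2 + 1.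
have M1 : 0 <= bT ^+ 2 * 16 / lam by rewrite divr_ge0 ?mulr_ge0 ?sqr_ge0// ltW.
have M2 : 0 <= c * c * (bS + lam) * 2 by rewrite !mulr_ge0// addr_ge0// ltW.
have M0 : 0 < M by rewrite /M ltr_wpDl// !addr_ge0// ltW.
exists M^-1; first by rewrite invr_gt0.
move=> gam /andP[gam0 gamM].
have gM : gam * M <= 1 by rewrite -(ler_pdivlMr _ _ M0) mul1r.
have gM1 : gam * lam <= 1.
  by apply: le_trans gM; rewrite ler_wpM2l// /M; lra.
have gM2 : gam * (bT ^+ 2 * 16 / lam) <= 1.
  by apply: le_trans gM; rewrite ler_wpM2l// /M; move: (ltW lam0); lra.
have gM3 : gam * (c * c * (bS + lam) * 2) <= 1.
  by apply: le_trans gM; rewrite ler_wpM2l// /M; move: (ltW lam0); lra.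
move=> phi1 lip1 lin1.
have e1 : 64 * C1 <= lam * K by rewrite (mulrC lam) /K divfK ?lexx// gt_eqF.
have hgp u v u' v' : snorm S (gp u v - gp u' v') <= d0 * (snorm S (u - u') + snorm T (v - v')).
  apply: le_trans (c1 _) _; rewrite -ec ler_wpM2l//.
  apply: le_trans (blk u v u' v').
  by rewrite /gp -linearB norm_usubmx_le.
have hgm u v u' v' : snorm T (gm u v - gm u' v') <= d0 * (snorm S (u - u') + snorm T (v - v')).
  apply: le_trans (c3 _) _; rewrite -ec ler_wpM2l//.
  apply: le_trans (blk u v u' v').
  by rewrite /gm -linearB norm_dsubmx_le.
have hgpl u v : exists (A : 'M[R]_p) (B : 'M[R]_(p, q)),
    (forall a h, snorm S (A *m a + B *m h) <= d0 * (snorm S a + snorm T h)) /\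
    forall a h, snorm S (gp (u + a) (v + h) - gp u v - (A *m a + B *m h))
      <= C1 * (snorm S a + snorm T h) `^ (1 + nu).
  have [D [DE DP]] := CP (col_mx u v).
  exists (ulsubmx D), (ursubmx D); split => a h; rewrite -usubmx_mul_col.
    apply: le_trans (c1 _) _; have h1 := linb D DE a h; apply: le_trans h1.
    by rewrite ler_wpM2l// norm_usubmx_le.
  apply: le_trans (c1 _) _; have h1 := remb (col_mx u v) D DP a h; apply: le_trans h1.
  by rewrite ler_wpM2l// /gp -add_col_mx -!linearB norm_usubmx_le.
have hgml u v : exists (A : 'M[R]_(q, p)) (B : 'M[R]_q),
    (forall a h, snorm T (A *m a + B *m h) <= d0 * (snorm S a + snorm T h)) /\
    forall a h, snorm T (gm (u + a) (v + h) - gm u v - (A *m a + B *m h))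
      <= C1 * (snorm S a + snorm T h) `^ (1 + nu).
  have [D [DE DP]] := CP (col_mx u v).
  exists (dlsubmx D), (drsubmx D); split => a h; rewrite -dsubmx_mul_col.
    apply: le_trans (c3 _) _; have h1 := linb D DE a h; apply: le_trans h1.
    by rewrite ler_wpM2l// norm_dsubmx_le.
  apply: le_trans (c3 _) _; have h1 := remb (col_mx u v) D DP a h; apply: le_trans h1.
  by rewrite ler_wpM2l// /gm -add_col_mx -!linearB norm_dsubmx_le.
have hexpP := snorm_expansion gam0 HpP.
have hexpM v : snorm T (v + gam *: (Hm *m v)) <= (1 + gam * (lam / 16)) * snorm T v.
  have mu0 : 0 <= lam / 32 by rewrite divr_ge0// ltW.
  have hb : gam * bT ^+ 2 <= 2 * (lam / 32).
    have -> : gam * bT ^+ 2 = gam * (bT ^+ 2 * 16 / lam) * (lam / 16).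
      by field; rewrite gt_eqF.
    by rewrite (_ : 2 * (lam / 32) = lam / 16) ?ler_piMl ?divr_ge0 ?(ltW lam0)//; field.
  have := snorm_nonexpansion gam0 mu0 bTP hb HmP v.
  by rewrite (_ : 2 * (lam / 32) = lam / 16)//; field.
have e2 : c * c * (gam * (bS + lam)) <= 1 / 2.
  move: gM3; rewrite (_ : gam * _ = 2 * (c * c * (gam * (bS + lam)))); last by ring.
  by move: (c * c * _) => z; lra.
have [phi [lip lin hexp]] :=
  graph_step lam0 del0 del1 nu0 nu1 C10 e1 hgp hgm hgpl hgml gam0 gM1 hexpP hexpM
    c2 c0' c1 bSP bS0 e2 lip1 lin1.
exists phi; split => // y.
by rewrite step_block col_mxKu col_mxKd; exact: hexp.
Qed.
End Charts.

(** * From spectral hypotheses to norms *)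

Section Spectrum.
Variable R : realType.

(** Finitely many eigenvalues, listed as roots of the characteristic polynomial. Half the least real
    part keeps the inequality strict; the cap 1 covers an empty spectrum. *)
Lemma spectral_gap n (A : 'M[R]_n) : (forall z, complex_eigenvalue A z -> 0 < complex.Re z) ->
  exists2 lam, 0 < lam & forall z, complex_eigenvalue A z -> lam < complex.Re z.
Proof.
move=> Aeig; pose Ac := map_mx (real_complex R) A.
have [rs rsE] := closed_field_poly_normal (char_poly Ac).
rewrite (monicP (char_poly_monic _)) scale1r in rsE.
have rsP z : complex_eigenvalue A z = (z \in rs).
  by rewrite /complex_eigenvalue eigenvalue_root_char rsE root_prod_XsubC.
pose m := \big[Order.min/1]_(z <- rs) complex.Re z.
have m0 : 0 < m.
  rewrite /m; have : all (fun z => 0 < complex.Re z) rs.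
    by apply/allP => z; rewrite -rsP; exact: Aeig.
  elim: (rs) => [|z s ih]; rewrite ?big_nil ?big_cons//= => /andP[z0 /ih s0].
  by rewrite lt_min z0.
exists (m / 2) => [|z]; first by rewrite divr_gt0.
rewrite rsP => zrs; apply: (@lt_le_trans _ _ m).
  by rewrite ltr_pdivrMr// ltr_pMr// ltr1n.
rewrite /m; elim: (rs) zrs => // y s ih; rewrite inE big_cons ge_min.
by move=> /orP[/eqP->|/ih ->]; rewrite ?lexx ?orbT.
Qed.

Lemma expanding_norm n (A : 'M[R]_n) : (forall z, complex_eigenvalue A z -> 0 < complex.Re z) ->
  exists2 lam, 0 < lam & exists m (S : 'M[R]_(m, n)) (S' : 'M[R]_(n, m)),
    S' *m S = 1%:M /\ forall u : 'cV[R]_n,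
    lam * edot (S *m u) (S *m u) <= edot (S *m (A *m u)) (S *m u).
Proof.
by move=> /spectral_gap[lam lam0 /adapted_norm h]; exists lam.
Qed.

Lemma complex_eigenvalueN n (A : 'M[R]_n) z :
  complex_eigenvalue (- A) z -> complex_eigenvalue A (- z).
Proof.
move=> /eigenvalueP[v vA v0]; apply/eigenvalueP; exists v => //.
have -> : map_mx (real_complex R) A = - map_mx (real_complex R) (- A).
  by apply/matrixP => i j; rewrite !mxE rmorphN opprK.
by rewrite mulmxN vA scaleNr.
Qed.

(** [adapted_norm] applied to [- A]. A positive margin [e] is natural: on the imaginary axis a
    nontrivial Jordan block produces growth in every norm. *)
Lemma nonexpanding_norm n (A : 'M[R]_n) e : 0 < e ->
  (forall z, complex_eigenvalue A z -> complex.Re z <= 0) ->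
  exists m (T : 'M[R]_(m, n)) (T' : 'M[R]_(n, m)),
    T' *m T = 1%:M /\ forall v : 'cV[R]_n,
    edot (T *m (A *m v)) (T *m v) <= e * edot (T *m v) (T *m v).
Proof.
move=> e0 Aeig; have [z zA|m [T [T' [TT TP]]]] := @adapted_norm R n (- A) (- e).
  apply: (@lt_le_trans _ _ 0); first by rewrite oppr_lt0.
  by have := Aeig _ (complex_eigenvalueN zA); case: (z) => a b /=; rewrite oppr_le0.
exists m, T, T'; split => // v; have := TP v.
by rewrite mulNmx mulmxN edotNl mulNr lerN2.
Qed.

(** Otherwise [Hm] has a complex eigenvalue; its row eigenvector, padded with zeros and carried by
    [invmx Q], is one of the differential, with a nonpositive real part. *)
Lemma repulsive_flat p q (f : 'cV[R]_(p + q) -> 'cV[R]_(p + q)) xs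
  (Q : 'M[R]_(p + q)) (Hp : 'M[R]_p) (Hm : 'M[R]_q) : Q \in unitmx ->
  invmx Q *m Dmx f xs *m Q = block_mx Hp 0 0 Hm ->
  (forall z, complex_eigenvalue Hm z -> complex.Re z <= 0) ->
  repulsive f xs -> q = 0%N.
Proof.
move=> Qu QE Hm_eig [_ rep]; case: (posnP q) => // q0; exfalso.
pose rc := real_complex R.
have [z zE] := eigenvalue_closed (map_mx rc Hm) q0.
have := Hm_eig z zE; apply/negP; rewrite -ltNge; apply: rep.
have /eigenvalueP[w wE w0] := zE; apply/eigenvalueP.
have QQ : map_mx rc (invmx Q) *m map_mx rc Q = 1%:M.
  by rewrite -map_mxM mulVmx// map_mx1.
exists (row_mx 0 w *m map_mx rc (invmx Q)); last first.
  apply: contra_neq w0 => h.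
  have := congr1 (mulmx^~ (map_mx rc Q)) h; rewrite -mulmxA QQ mulmx1 mul0mx.
  by rewrite -row_mx0 => /eq_row_mx[].
have -> : Dmx f xs = Q *m block_mx Hp 0 0 Hm *m invmx Q.
  by rewrite -QE !mulmxA mulmxV// mul1mx mulmxK.
have -> : map_mx (real_complex R) (Q *m block_mx Hp 0 0 Hm *m invmx Q) =
    map_mx rc Q *m map_mx rc (block_mx Hp 0 0 Hm) *m map_mx rc (invmx Q).
  by rewrite -!map_mxM.
rewrite !mulmxA -(mulmxA _ _ (map_mx rc Q)) QQ mulmx1 map_block_mx !map_mx0.
by rewrite mul_row_block !mulmx0 !mul0mx !add0r wE scalemxAl scale_row_mx scaler0.
Qed.
End Spectrum.

(** * Integrals weighted by functions of a sub-sigma-algebra *)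

Section RealIntegral.
Variables (R : realType) (disp : measure_display) (Omega : measurableType disp).
Variables (P : probability Omega R) (A : set Omega) (mA : measurable A).
Implicit Types f g psi : Omega -> R.

Lemma intgD f g : P.-integrable A (EFin \o f) -> P.-integrable A (EFin \o g) ->
  P.-integrable A (EFin \o (fun w => f w + g w)).
Proof. by move=> hf hg; have := integrableD mA hf hg. Qed.

Lemma intgZ k f : P.-integrable A (EFin \o f) ->
  P.-integrable A (EFin \o (fun w => k * f w)).
Proof. by move=> hf; have := integrableZl mA k hf. Qed.

Lemma intgB f g : P.-integrable A (EFin \o f) -> P.-integrable A (EFin \o g) ->
  P.-integrable A (EFin \o (fun w => f w - g w)).
Proof. by move=> hf hg; have := integrableB mA hf hg. Qed.

Lemma intg_bounded f M : measurable_fun A f -> (forall w, A w -> `|f w| <= M) ->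
  P.-integrable A (EFin \o f).
Proof.
move=> mf hM; apply: measurable_bounded_integrable => //.
  by rewrite ltey_eq fin_num_measure.
exists M; split; first exact: num_real.
by move=> y My w Aw /=; apply: le_trans (hM w Aw) (ltW My).
Qed.

Lemma intg_cst k : P.-integrable A (EFin \o (fun=> k)).
Proof. by apply: (@intg_bounded _ `|k|). Qed.

Lemma intg_le f g : measurable_fun A f -> (forall w, A w -> `|f w| <= g w) ->
  P.-integrable A (EFin \o g) -> P.-integrable A (EFin \o f).
Proof.
move=> mf h hg; apply: le_integrable hg => //.
  exact/measurable_EFinP.
by move=> w /h fg /=; rewrite lee_fin (le_trans fg)// ler_norm.
Qed.

Lemma intg_measurable f : P.-integrable A (EFin \o f) -> measurable_fun A f.
Proof. by move=> /(measurable_int P)/measurable_EFinP. Qed.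

Lemma intg_norm f : P.-integrable A (EFin \o f) ->
  P.-integrable A (EFin \o (fun w => `|f w|)).
Proof. by move=> hf; have := integrable_abse hf. Qed.

Lemma intg_mulb psi f M : measurable_fun A psi -> (forall w, A w -> `|psi w| <= M) ->
  P.-integrable A (EFin \o f) -> P.-integrable A (EFin \o (fun w => psi w * f w)).
Proof.
move=> mpsi hM hf; apply: (@intg_le _ (fun w => M * `|f w|)).
- by apply: measurable_funM => //; exact: intg_measurable.
- by move=> w /hM h; rewrite normrM ler_wpM2r.
- exact/intgZ/intg_norm.
Qed.

Lemma intg_sum (I : Type) (s : seq I) (f : I -> Omega -> R) :
  (forall i, P.-integrable A (EFin \o f i)) ->
  P.-integrable A (EFin \o (fun w => \sum_(i <- s) f i w)).
Proof.
move=> h; elim: s => [|i s ih].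
  by rewrite (_ : (fun w => _) = fun=> 0); [exact: intg_cst|apply/funext => w; rewrite big_nil].
rewrite (_ : (fun w => _) = fun w => f i w + \sum_(j <- s) f j w); first exact: intgD.
by apply/funext => w; rewrite big_cons.
Qed.

Lemma Rintegral_sum (I : Type) (s : seq I) (f : I -> Omega -> R) :
  (forall i, P.-integrable A (EFin \o f i)) ->
  \int[P]_(w in A) (\sum_(i <- s) f i w) = \sum_(i <- s) \int[P]_(w in A) f i w.
Proof.
move=> h; elim: s => [|i s ih].
  rewrite big_nil; under eq_Rintegral do rewrite big_nil.
  by rewrite Rintegral_cst// mul0r.
under eq_Rintegral do rewrite big_cons.
by rewrite RintegralD// ?ih ?big_cons//; exact: intg_sum.
Qed.
End RealIntegral.

(** The number of levels [1, ..., n] below [x] is its integer part while [x < n + 1]: a staircase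
    becomes a finite sum of indicators. *)
Lemma count_levels (R : realType) (x : R) n : 0 <= x ->
  let S := \sum_(j < n) (if j.+1%:R <= x then 1 else 0 : R) in
  (n%:R <= x -> S = n%:R) /\ (x < n%:R + 1 -> S <= x < S + 1).
Proof.
move=> x0; elim: n => [|n [ih1 ih2]] /=.
  by rewrite big_ord0; split => // h; rewrite x0 add0r; rewrite add0r in h.
rewrite big_ord_recr/=; split => [h|h].
  rewrite h ih1; first by rewrite natr1.
  by apply: le_trans h; rewrite ler_nat.
have [hn|hn] := leP n.+1%:R x.
  rewrite ih1; last by apply: le_trans hn; rewrite ler_nat.
  by rewrite natr1 hn h.
by rewrite addr0; apply: ih2; rewrite natr1.
Qed.

Section SubSigma.
Variables (R : realType) (disp : measure_display) (Omega : measurableType disp).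
Variable P : probability Omega R.
Variables (G : set (set Omega)) (sG : sigma_algebra setT G) (GM : G `<=` measurable).

(** Measurability with respect to [G] becomes ordinary measurability on a second measurable space
    with the same points, where the usual closure properties apply. *)
Lemma measurable_wrtP d (T : measurableType d) (g : Omega -> T) :
  measurable_wrt G g <-> measurable_fun setT (g : g_sigma_algebraType G -> T).
Proof.
have e : <<s G>> = G by exact: sigma_algebra_id.
split => [h _ B mB|h B mB].
  by rewrite setTI /measurable/= e; exact: h.
by have := h measurableT B mB; rewrite setTI /measurable/= e.
Qed.

Lemma measurable_wrt_measurable d (T : measurableType d) (g : Omega -> T) :
  measurable_wrt G g -> measurable_fun setT g.
Proof. by move=> h _ B mB; rewrite setTI; apply: GM; exact: h. Qed.

Lemma sigma_setT : G setT.
Proof. by have [G0 GC _] := sG; have := GC _ G0; rewrite setD0. Qed.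

Lemma sigma_setC A : G A -> G (~` A).
Proof. by have [_ GC _] := sG => /GC; rewrite setTD. Qed.

Lemma sigma_bigcup (A : nat -> set Omega) : (forall k, G (A k)) -> G (\bigcup_k A k).
Proof. by have [_ _ h] := sG; exact: h. Qed.

Lemma sigma_bigcap (A : nat -> set Omega) : (forall k, G (A k)) -> G (\bigcap_k A k).
Proof.
move=> h; rewrite -[X in G X]setCK setC_bigcap; apply: sigma_setC.
by apply: sigma_bigcup => k; exact: sigma_setC.
Qed.

Lemma sigma_setU A B : G A -> G B -> G (A `|` B).
Proof. by move=> GA GB; rewrite -bigcup2E; apply: sigma_bigcup => -[|[|k]] //=; case: sG. Qed.

Lemma sigma_setI A B : G A -> G B -> G (A `&` B).
Proof.
move=> GA GB; rewrite -[X in G X]setCK setCI.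
by apply: sigma_setC; apply: sigma_setU; exact: sigma_setC.
Qed.

Lemma measurable_wrt_superlevel (psi : Omega -> R) x :
  measurable_wrt G psi -> G [set w | x <= psi w].
Proof.
move=> h; rewrite (_ : [set w | _] = psi @^-1` `[x, +oo[%classic); first exact: h.
by apply/seteqP; split => w /=; rewrite in_itv/= andbT.
Qed.

(* The weight is compared with the simple functions [M / N * floor (psi * N / M)],
   written as sums of indicators of superlevel sets. *)
Lemma weighted_Rintegral_ge0 (A : set Omega) (Y psi : Omega -> R) (M : R) : G A ->
  P.-integrable A (EFin \o Y) ->
  (forall B, G B -> B `<=` A -> 0 <= \int[P]_(w in B) Y w) ->
  measurable_wrt G psi -> (forall w, 0 <= psi w <= M) ->
  0 <= \int[P]_(w in A) (psi w * Y w).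
Proof.
move=> GA iY hY mpsi hpsi; have mA := GM GA.
have [M0|M0] := leP M 0.
  rewrite (_ : (fun w => psi w * Y w) = fun=> 0).
    by rewrite Rintegral_cst// mul0r.
  apply/funext => w; have /andP[a b] := hpsi w.
  by have -> : psi w = 0; [apply/eqP; rewrite eq_le a (le_trans b M0)|rewrite mul0r].
have mpsiA : measurable_fun A psi.
  by apply: measurable_funTS; exact: measurable_wrt_measurable.
have psiM w : A w -> `|psi w| <= M by move=> _; have /andP[a b] := hpsi w; rewrite ger0_norm.
have iY' := intg_norm iY.
set J := \int[P]_(w in A) `|Y w|.
have J0 : 0 <= J by apply: Rintegral_ge0.
(* Replacing [psi] by a staircase of height [M / N.+1] costs at most that times [J]; a negative
   integral would contradict this for large [N]. *)
suff key N : - (M / N.+1%:R * J) <= \int[P]_(w in A) (psi w * Y w).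
  rewrite leNgt; apply/negP => neg.
  set I := \int[P]_(w in A) (psi w * Y w) in neg key.
  have MJ : 0 <= M * J by rewrite mulr_ge0// ltW.
  have I0 : 0 < - I by rewrite oppr_gt0.
  have := archi_boundP (divr_ge0 MJ (ltW I0)).
  set k := Num.bound _ => hk; have := key k.
  apply/negP; rewrite -ltNge ltrNr mulrAC ltr_pdivrMr//.
  move: hk; rewrite ltr_pdivrMr// => /lt_le_trans; apply.
  by rewrite mulrC ler_wpM2l ?(ltW I0)// ler_nat.
pose n := N.+1; have n0 : 0 < n%:R :> R by rewrite ltr0n.
pose B (j : 'I_n) := [set w | j.+1%:R <= psi w * n%:R / M].
pose psiN w : R := M / n%:R * \sum_(j < n) (if w \in B j then 1 else 0).
have GB j : G (B j).
  rewrite (_ : B j = [set w | j.+1%:R * M / n%:R <= psi w]).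
    exact: measurable_wrt_superlevel.
  by apply/seteqP; split => w; rewrite /B/= ler_pdivlMr// ler_pdivrMr.
have approx w : psiN w <= psi w <= psiN w + M / n%:R.
  have /andP[p0 pM] := hpsi w.
  have x0 : 0 <= psi w * n%:R / M by rewrite divr_ge0 ?mulr_ge0// ltW.
  have [_] := @count_levels R _ n x0.
  have -> : \sum_(j < n) (if j.+1%:R <= psi w * n%:R / M then 1 else 0 : R) =
      \sum_(j < n) (if w \in B j then 1 else 0).
    apply: eq_bigr => j _; congr (if _ then _ else _).
    by apply/idP/idP => [h|]; rewrite ?inE.
  set S := \sum_(j < n) _ => /(_ _)/andP[].
    rewrite ltr_pdivrMr// (@le_lt_trans _ _ (M * n%:R))//; first by rewrite ler_wpM2r.
    by rewrite mulrC ltr_pM2r// ltrDl.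
  rewrite ltr_pdivrMr// ler_pdivlMr// => h1 h2.
  have e : M / n%:R * n%:R = M by rewrite divfK// gt_eqF.
  rewrite /psiN -/S; apply/andP; split; rewrite -(ler_pM2r n0).
    by rewrite mulrAC e mulrC.
  by rewrite mulrDl mulrAC e; apply/ltW; rewrite (mulrC M) -[X in _ + X]mul1r -mulrDl.
have psiNE w : psiN w = \sum_(j < n) M / n%:R * \1_(B j) w.
  by rewrite /psiN mulr_sumr; apply: eq_bigr => j _; rewrite indicE; case: (w \in B j).
have mB j : measurable (B j) := GM (GB j).
have mpsiN : measurable_fun A psiN.
  rewrite (_ : psiN = fun w => \sum_(j < n) M / n%:R * \1_(B j) w).
    by apply: measurable_sum => j; apply: measurable_funM.
  by apply/funext => w; rewrite psiNE.
have psiNM w : A w -> `|psiN w| <= M.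
  move=> _; have /andP[a _] := approx w; have /andP[_ b] := hpsi w.
  rewrite ger0_norm ?(le_trans a b)// mulr_ge0 ?divr_ge0 ?(ltW M0)//.
  by apply: sumr_ge0 => j _; case: ifP.
have iN := intg_mulb mA mpsiN psiNM iY.
have ip := intg_mulb mA mpsiA psiM iY.
have i1 j : P.-integrable A (EFin \o (fun w => \1_(B j) w * Y w)).
  apply: (@intg_mulb _ _ _ _ _ _ _ _ 1) => //.
  by move=> w _; rewrite indicE; case: (w \in B j); rewrite ?normr1 ?normr0.
have N0 : 0 <= \int[P]_(w in A) (psiN w * Y w).
  have e w : psiN w * Y w = \sum_(j < n) M / n%:R * (\1_(B j) w * Y w).
    by rewrite psiNE mulr_suml; apply: eq_bigr => j _; rewrite mulrA.
  under eq_Rintegral do rewrite e.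
  rewrite Rintegral_sum//; last by move=> j; exact: intgZ.
  apply: sumr_ge0 => j _; rewrite RintegralZl// mulr_ge0 ?divr_ge0 ?(ltW M0)//.
  rewrite (_ : (fun w => _) = Y \_ (B j)).
    rewrite -Rintegral_mkcondr; apply: hY; last by move=> w [].
    exact: sigma_setI.
  by apply/funext => w; rewrite patchE indicE; case: ifP; rewrite ?mul1r ?mul0r.
rewrite -subr_ge0 opprK addrC.
rewrite -RintegralZl// -RintegralD//; last exact: intgZ.
apply: le_trans N0 _; apply: le_Rintegral => //; first exact/intgD/ip/intgZ.
move=> w Aw; have /andP[h1 h2] := approx w.
have hy : 0 <= `|Y w| + Y w by have := ler_norm (- Y w); rewrite normrN; lra.
have e1 : 0 <= psi w - psiN w by rewrite subr_ge0.
have e2 : 0 <= psiN w + M / N.+1%:R - psi w by rewrite subr_ge0.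
have := mulr_ge0 e1 hy; have := mulr_ge0 e2 (normr_ge0 (Y w)).
by move: (psiN w) (psi w) (M / _) (`|Y w|) (Y w) => *; lra.
Qed.
End SubSigma.

Section ContinuousMeasurable.
Variables (R : realType) (d : measure_display) (T : measurableType d) (n : nat).

(* The superlevel sets of [phi] are countable unions of boxes centred at
   rational points. *)
Lemma continuous_coord_measurable (Y : T -> 'cV[R]_n) (phi : 'cV[R]_n -> R) :
  (forall i, measurable_fun setT (fun w => Y w i 0)) -> continuous phi ->
  measurable_fun setT (fun w => phi (Y w)).
Proof.
move=> mY cphi; apply: (measurability _ (RGenOInfty.measurableE R)) => //.
move=> _ [_ [x ->] <-]; rewrite setTI.
pose box (qk : {ffun 'I_n -> rat} * nat) : set 'cV[R]_n :=
  [set y | forall i, `|y i 0 - ratr (qk.1 i)| < qk.2.+1%:R^-1].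
pose good (qk : {ffun 'I_n -> rat} * nat) := box qk `<=` [set y | x < phi y].
pose Bx qk := if `[< good qk >] then Y @^-1` box qk else set0.
rewrite (_ : _ @^-1` _ = \bigcup_qk Bx qk).
  apply: countable_bigcupT_measurable => // qk; rewrite /Bx; case: ifP => // _.
  rewrite (_ : _ @^-1` _ = \bigcap_(i in [set: 'I_n])
      (fun w => `|Y w i 0 - ratr (qk.1 i)|) @^-1` `]-oo, qk.2.+1%:R^-1[%classic).
    apply: fin_bigcap_measurable => // i _; rewrite -[X in measurable X]setTI.
    apply: measurableT_comp => //; first exact: measurable_funB.
  apply/seteqP; split => w /= h i; first by move=> _; rewrite /= in_itv/= h.
  by have := h i I; rewrite /= in_itv.
apply/seteqP; split => w /=; rewrite in_itv/= andbT; last first.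
  by move=> [qk _]; rewrite /Bx; case: ifPn => [/asboolP h /h|].
move=> xw.
have : nbhs (Y w) [set y | x < phi y].
  have := cphi (Y w); move/cvgrPdist_lt => /(_ (phi (Y w) - x)).
  rewrite subr_gt0 => /(_ xw); apply: filterS => y /= h.
  by move: h; rewrite ltr_norml => /andP[_]; rewrite ltrBrDr addrC -ltrBrDr opprB addrC subrK.
move=> /nbhs_normP[e /= e0 eP].
have [k hk] : exists k : nat, k.+1%:R^-1 < e / 2.
  exists (Num.bound (e / 2)^-1).
  rewrite invf_plt ?posrE ?divr_gt0//.
  apply: lt_trans (archi_boundP _) _; first by rewrite invr_ge0 divr_ge0 ?ltW.
  by rewrite ltr_nat.
have [t tE] : exists t : R, t = k.+1%:R^-1 by exists k.+1%:R^-1.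
have t0 : 0 < t by rewrite tE invr_gt0.
rewrite -tE in hk.
have [q qP] : exists q : 'I_n -> rat, forall i, `|Y w i 0 - ratr (q i)| < t.
  suff : forall i, exists q : rat, `|Y w i 0 - ratr q| < t.
    by move=> /choice[q qP]; exists q.
  move=> i; have lt : Y w i 0 - t < Y w i 0 + t by lra.
  have [q] := rat_in_itvoo lt.
  rewrite in_itv/= => /andP[q1 q2]; exists q; rewrite ltr_norml; apply/andP; split; lra.
exists (finfun q, k) => //; rewrite /Bx.
have g : good (finfun q, k).
  move=> y /= hy; apply: eP; rewrite /ball_/=.
  apply: (@le_lt_trans _ _ (2 * t)); last by rewrite mulrC -ltr_pdivlMr.
  apply: norm_le_entries => [|i j]; first by rewrite mulr_ge0// ltW.
  rewrite (ord1 j) !mx_entry.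
  have := hy i; rewrite /= -tE; have := qP i; rewrite /= ffunE => h1 h2.
  rewrite (_ : Y w i 0 - y i 0 = (Y w i 0 - ratr (q i)) - (y i 0 - ratr (q i))); last by ring.
  apply: le_trans (ler_normB _ _) _; lra.
by case: ifPn => [_ i /=|/asboolP//]; rewrite ffunE -tE.
Qed.
End ContinuousMeasurable.

(** * Mean decrease of the potential *)

Lemma sqr_le_powR_add1 (R : realType) (x a : R) : 0 <= x -> 2 <= a -> x ^+ 2 <= 1 + x `^ a.
Proof.
move=> x0 a2; have [x1|/ltW x1] := leP x 1.
  by rewrite ler_wpDr ?powR_ge0// exprn_ile1.
by rewrite ler_wpDl// -powR_mulrn// ler_powR.
Qed.

(* With [x = |U|^2 / b], [k = |c eta|^2 / b] and [i = c <U, eta> / b], the left-hand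
   side is the potential of [U + c eta]; [k <= r \/ 2 <= r] truncates the
   quartic remainder, so that a moment of order [a > 2] is enough. *)
Lemma potential_ineq (R : realType) (x k i r : R) : 0 <= x -> 0 <= k -> i ^+ 2 <= x * k ->
  k <= r \/ 2 <= r ->
  (1 + (x + 2 * i + k))^-1 <= (1 + x)^-1 - 2 * (i * (1 + x)^-1 ^+ 2) - k
    + 10 * (k * (1 - (1 + x)^-1)) + 2 * (r * k).
Proof.
move=> x0 k0 ixk hr; set y := x + 2 * i + k.
have i4 : 4 * `|i| <= 4 * x + k.
  rewrite -(@ler_pXn2r _ 2)// ?nnegrE ?addr_ge0 ?mulr_ge0//.
  rewrite exprMn real_normK ?num_real//.
  have := sqr_ge0 (4 * x - k); nra.
have [i1 i2] : - `|i| <= i /\ i <= `|i| by rewrite ler_norm lerNl -normrN ler_norm.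
have y0 : 0 <= y.
  have i3 : 2 * `|i| <= x + k.
    rewrite -(@ler_pXn2r _ 2)// ?nnegrE ?addr_ge0 ?mulr_ge0//.
    rewrite exprMn real_normK ?num_real//.
    have := sqr_ge0 (x - k); nra.
  rewrite /y; lra.
have kxy : k <= 2 * (x + y) by rewrite /y; lra.
set w := (1 + x)^-1; set w' := (1 + y)^-1.
have w0 : 0 < w by rewrite invr_gt0 ltr_wpDr.
have w'0 : 0 < w' by rewrite invr_gt0 ltr_wpDr.
have w1 : w <= 1 by rewrite invf_le1 ?lerDl// ltr_wpDr.
have w'1 : w' <= 1 by rewrite invf_le1 ?lerDl// ltr_wpDr.
have ew : w * (1 + x) = 1 by rewrite mulVf// gt_eqF// ltr_wpDr.
have ew' : w' * (1 + y) = 1 by rewrite mulVf// gt_eqF// ltr_wpDr.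
have xw : x * w = 1 - w by rewrite mulrC; move: ew; rewrite mulrDr mulr1; lra.
(* [k <= 2 (x + y) <= 2 (1 + x) (1 + y)], so the two weights also hold [k] below 2. This is how
   either alternative on [r] becomes the single bound [kr]. *)
have kww : k * (w * w') <= Num.min k 2.
  have ww1 : w * w' <= 1 by rewrite mulr_ile1// ltW.
  rewrite le_min ler_piMr//=.
  have ww0 : 0 <= w * w' by rewrite mulr_ge0// ltW.
  apply: (@le_trans _ _ (2 * ((1 + x) * (1 + y)) * (w * w'))); last first.
    rewrite [leLHS](_ : _ = 2 * ((w * (1 + x)) * (w' * (1 + y)))); last by ring.
    by rewrite ew ew' !mulr1.
  rewrite ler_wpM2r//; apply: le_trans kxy _.
  have := mulr_ge0 x0 y0; lra.
have kr : k * (w * w') <= r.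
  apply: le_trans kww _; rewrite ge_min; case: hr => ->; by rewrite ?orbT.
clearbody w w'.
have D2 : (2 * i + k) ^+ 2 <= 8 * (x * k) + 2 * k ^+ 2.
  have := sqr_ge0 (2 * i - k); nra.
(* Exact second-order expansion of the inverse; keeping [w'] in the remainder provides the decay
   that controls the square of [k]. *)
have e : w' = w - (2 * i + k) * w ^+ 2 + (2 * i + k) ^+ 2 * (w ^+ 2 * w').
  have -> : 2 * i + k = (1 + y) - (1 + x) by rewrite /y; ring.
  have : w' * (1 + y) - 1 = 0 by rewrite ew' subrr.
  have : w * (1 + x) - 1 = 0 by rewrite ew subrr.
  move: (1 + y) (1 + x) => Y X h1 h2.
  apply/eqP; rewrite -subr_eq0; apply/eqP.
  have wX : w * X = 1 by lra.
  have wY : w' * Y = 1 by lra.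
  have -> : (Y - X) ^+ 2 * (w ^+ 2 * w') =
     (w' * Y) * Y * w ^+ 2 - 2 * (w' * Y) * (w * X) * w + (w * X) ^+ 2 * w' by ring.
  have -> : (Y - X) * w ^+ 2 = Y * w ^+ 2 - (w * X) * w by ring.
  rewrite wX wY; ring.
rewrite {1}e.
have h1 : (2 * i + k) ^+ 2 * (w ^+ 2 * w') <= (8 * (x * k) + 2 * k ^+ 2) * (w ^+ 2 * w').
  by rewrite ler_wpM2r// mulr_ge0 ?sqr_ge0// ltW.
have h2 : 8 * (x * k) * (w ^+ 2 * w') <= 8 * (k * (1 - w)).
  have -> : 8 * (x * k) * (w ^+ 2 * w') = 8 * (k * (1 - w)) * (w * w').
    by rewrite -xw; ring.
  rewrite ler_piMr// ?mulr_ge0 ?subr_ge0// mulr_ile1// ltW//.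
have h3 : 2 * k ^+ 2 * (w ^+ 2 * w') <= 2 * (r * k).
  have -> : 2 * k ^+ 2 * (w ^+ 2 * w') = 2 * (k * (k * (w * w') * w)) by ring.
  rewrite ler_wpM2l// mulrC ler_wpM2r//; apply: le_trans kr.
  by rewrite ler_piMr// mulr_ge0// mulr_ge0 ?ltW.
have h4 : k * (1 - w ^+ 2) <= k * (2 * (1 - w)).
  by rewrite ler_wpM2l//; have := sqr_ge0 (1 - w); nra.
lra.
Qed.

Section Potential.
Variables (R : realType) (p mp : nat) (S : 'M[R]_(mp, p)) (b : R).
Hypothesis b0 : 0 < b.

Lemma sqr_snorm_measurable d (T : measurableType d) (U : T -> 'cV[R]_p) :
  (forall i, measurable_fun setT (fun w => U w i 0)) ->
  measurable_fun setT (fun w => snorm S (U w) ^+ 2).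
Proof.
move=> mU; rewrite (_ : (fun w => _) = fun w => \sum_i (\sum_j S i j * U w j 0) ^+ 2).
  apply: measurable_sum => i; apply: measurable_funX.
  by apply: measurable_sum => j; apply: measurable_funM.
apply/funext => w; rewrite /snorm sqr_enorm /edot.
by apply: eq_bigr => i _; rewrite -expr2 !mxE.
Qed.

Definition potential (z : 'cV[R]_p) : R := (1 + snorm S z ^+ 2 / b)^-1.

Lemma potential_gt0 z : 0 < potential z.
Proof. by rewrite invr_gt0 ltr_wpDr// divr_ge0 ?sqr_ge0// ltW. Qed.

Lemma potential_le1 z : potential z <= 1.
Proof.
have h : 0 <= snorm S z ^+ 2 / b by rewrite divr_ge0 ?sqr_ge0// ltW.
by rewrite invf_le1 ?lerDl// ltr_wpDr.
Qed.

Lemma potential_mono y z : snorm S y <= snorm S z -> potential z <= potential y.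
Proof.
move=> h; have sq t : 0 <= snorm S t ^+ 2 / b by rewrite divr_ge0 ?sqr_ge0// ltW.
rewrite lef_pV2 ?posrE ?ltr_wpDr// lerD2l ler_wpM2r ?invr_ge0 ?(ltW b0)//.
by rewrite lerXn2r ?nnegrE ?snorm_ge0.
Qed.

Lemma potential_measurable d (T : measurableType d) (U : T -> 'cV[R]_p) :
  (forall i, measurable_fun setT (fun w => U w i 0)) ->
  measurable_fun setT (fun w => potential (U w)).
Proof.
move=> mU; rewrite (_ : (fun w => _) =
    (@powR R ^~ (-1)) \o (fun w => 1 + snorm S (U w) ^+ 2 / b)).
  apply: measurableT_comp; first exact: measurable_powR.
  apply: measurable_funD => //; apply: measurable_funM => //.
  exact: sqr_snorm_measurable.
apply/funext => w /=; rewrite powR_inv1//.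
by rewrite addr_ge0// divr_ge0 ?sqr_ge0// ltW.
Qed.
End Potential.

Lemma edot_mulmx (R : realType) m n (A : 'M[R]_(m, n)) (x : 'cV[R]_m) (y : 'cV[R]_n) :
  edot x (A *m y) = edot (A^T *m x) y.
Proof.
rewrite /edot; under eq_bigr do rewrite mxE mulr_sumr.
rewrite exchange_big/=; apply: eq_bigr => j _; rewrite mxE mulr_suml.
by apply: eq_bigr => i _; rewrite mxE mulrCA mulrA.
Qed.

Section OneStep.
Variables (R : realType) (disp : measure_display) (Omega : measurableType disp).
Variable P : probability Omega R.
Variables (G : set (set Omega)) (sG : sigma_algebra setT G) (GM : G `<=` measurable).

(** Both [Y] and [- Y] fall under [weighted_Rintegral_ge0] with the nonnegative weight [psi + M];
    the shift by [M] is harmless as [Y] integrates to 0 over [A]. *)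
Lemma weighted_Rintegral_eq0 (A : set Omega) (Y psi : Omega -> R) (M : R) : G A ->
  P.-integrable A (EFin \o Y) ->
  (forall B, G B -> B `<=` A -> \int[P]_(w in B) Y w = 0) ->
  measurable_wrt G psi -> (forall w, `|psi w| <= M) ->
  \int[P]_(w in A) (psi w * Y w) = 0.
Proof.
move=> GA iY hY mpsi psiM; have mA := GM GA.
have mpsi' : measurable_wrt G (fun w => psi w + M).
  apply/measurable_wrtP => //; apply: measurable_funD => //.
  exact/measurable_wrtP.
have b w : 0 <= psi w + M <= 2 * M.
  by have := psiM w; rewrite ler_norml => /andP[h1 h2]; apply/andP; split; lra.
have mpsiA : measurable_fun A psi.
  by apply: measurable_funTS; exact: (measurable_wrt_measurable GM mpsi).
have ipY := intg_mulb mA mpsiA (fun w _ => psiM w) iY.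
have e : \int[P]_(w in A) ((psi w + M) * Y w) = \int[P]_(w in A) (psi w * Y w).
  under eq_Rintegral do rewrite mulrDl.
  rewrite RintegralD//; last exact: intgZ.
  by rewrite RintegralZl// hY// mulr0 addr0.
have h1 : 0 <= \int[P]_(w in A) ((psi w + M) * Y w).
  apply: (weighted_Rintegral_ge0 sG GM GA iY _ mpsi' b) => B GB BA.
  by rewrite hY.
have h2 : 0 <= \int[P]_(w in A) ((psi w + M) * (-1 * Y w)).
  apply: (weighted_Rintegral_ge0 sG GM GA (intgZ mA (-1) iY) _ mpsi' b) => B GB BA.
  by rewrite RintegralZl ?hY ?mulr0//; [exact: GM|apply: integrableS iY => //; exact: GM].
have h3 : \int[P]_(w in A) ((psi w + M) * (-1 * Y w)) = - \int[P]_(w in A) ((psi w + M) * Y w).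
  under eq_Rintegral do rewrite mulrCA.
  rewrite RintegralZl ?mulN1r//.
  apply: (@intg_mulb _ _ _ _ _ mA _ _ (2 * M)) => //.
    by apply: measurable_funD => //.
  by move=> w _; have /andP[b1 b2] := b w; rewrite ger0_norm.
by apply/eqP; rewrite -e eq_le h1 andbT -oppr_ge0 -h3.
Qed.

Variables (p q mp mq : nat) (S : 'M[R]_(mp, p)) (T : 'M[R]_(mq, q)).
Variables (del C a : R) (C0 : 0 <= C) (del0 : 0 <= del) (del1 : del <= 1) (a2 : 2 < a).
Hypothesis SC : forall u : 'cV[R]_p, snorm S u <= C * `|u|.
Hypothesis TC : forall v : 'cV[R]_q, snorm T v <= C * `|v|.
Variables (A : set Omega) (GA : G A).
Variables (U : Omega -> 'cV[R]_p) (L : Omega -> 'M[R]_(p, q)) (eps : Omega -> 'cV[R]_(p + q)).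
Hypothesis mU : forall i, measurable_wrt G (fun w => U w i 0).
Hypothesis mL : forall i j, measurable_wrt G (fun w => L w i j).
Hypothesis Ldel : forall w (h : 'cV[R]_q), snorm S (L w *m h) <= del * snorm T h.
Hypothesis meps : forall i, measurable_fun setT (fun w => eps w i 0).
Variables (bl Ba : R).
Hypothesis ieps : P.-integrable A (EFin \o (fun w => `|eps w| `^ a)).
Hypothesis H1 : forall B, G B -> B `<=` A ->
  \int[P]_(w in B) (`|eps w| `^ a) <= Ba * fine (P B).
Hypothesis H2 : bl * fine (P A) <= \int[P]_(w in A) (snorm S (usubmx (eps w)) ^+ 2).
Hypothesis H3 : forall B, G B -> B `<=` A -> forall i, \int[P]_(w in B) eps w i 0 = 0.

Let mA : measurable A := GM GA.
Definition innov w := usubmx (eps w) - L w *m dsubmx (eps w).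
Let K1 := 4 * C ^+ 2.
Let B1 := 1 + Ba.

Let innov_mx_le w (y : 'cV[R]_(p + q)) :
  snorm S (usubmx y - L w *m dsubmx y) <= 2 * C * `|y|.
Proof.
apply: le_trans (snormB _ _ _) _; rewrite -mulrA mulr_natl mulr2n lerD//.
  by apply: le_trans (SC _) _; rewrite ler_wpM2l// norm_usubmx_le.
apply: le_trans (Ldel _ _) _; apply: (@le_trans _ _ (snorm T (dsubmx y))).
  by rewrite ler_piMl// snorm_ge0.
by apply: le_trans (TC _) _; rewrite ler_wpM2l// norm_dsubmx_le.
Qed.

(** From [(x + z)^2 <= 2 x^2 + 2 z^2]: a graph of slope [del] keeps half of the excitation, up to a
    term in [del ^ 2]. *)
Let innov_ge w : snorm S (usubmx (eps w)) ^+ 2 / 2 - (del * C) ^+ 2 * `|eps w| ^+ 2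
  <= snorm S (innov w) ^+ 2.
Proof.
have h1 : snorm S (usubmx (eps w)) <= snorm S (innov w) + del * C * `|eps w|.
  rewrite -{1}(subrK (L w *m dsubmx (eps w)) (usubmx (eps w))).
  apply: le_trans (snormD _ _ _) _; rewrite lerD2l.
  apply: le_trans (Ldel _ _) _; rewrite -mulrA ler_wpM2l//.
  by apply: le_trans (TC _) _; rewrite ler_wpM2l// norm_dsubmx_le.
have s0 := snorm_ge0 S (usubmx (eps w)); have i0 := snorm_ge0 S (innov w).
have d0 : 0 <= del * C * `|eps w| by rewrite !mulr_ge0.
have : snorm S (usubmx (eps w)) ^+ 2 <= (snorm S (innov w) + del * C * `|eps w|) ^+ 2.
  by rewrite lerXn2r ?nnegrE ?addr_ge0.
rewrite -[(del * C) ^+ 2 * _]exprMn; move: (snorm S (innov w)) (snorm S _) (del * C * _) => x y z.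
have := sqr_ge0 (x - z); nra.
Qed.

Let mnorm : measurable_fun setT (fun w => `|eps w|).
Proof. by apply: continuous_coord_measurable => //; exact: norm_continuous. Qed.

Let mU' i : measurable_fun setT (fun w => U w i 0).
Proof. exact: (measurable_wrt_measurable GM (mU i)). Qed.

Let sq_le_pow w : `|eps w| ^+ 2 <= 1 + `|eps w| `^ a.
Proof. exact: (sqr_le_powR_add1 (normr_ge0 _) (ltW a2)). Qed.

Let isq : P.-integrable A (EFin \o (fun w => `|eps w| ^+ 2)).
Proof.
apply: (@intg_le _ _ _ _ _ mA _ (fun w => 1 + `|eps w| `^ a)).
- by apply: measurable_funTS; exact: measurable_funX.
- by move=> w _; rewrite ger0_norm ?sqr_ge0.
- by apply: intgD => //; exact: intg_cst.
Qed.

Let H1sq B : G B -> B `<=` A -> \int[P]_(w in B) (`|eps w| ^+ 2) <= B1 * fine (P B).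
Proof.
move=> GB BA; have mB := GM GB.
have i1 : P.-integrable B (EFin \o (fun w => `|eps w| `^ a)) by exact: integrableS ieps.
have i2 : P.-integrable B (EFin \o (fun w => `|eps w| ^+ 2)) by exact: integrableS isq.
apply: (@le_trans _ _ (\int[P]_(w in B) (1 + `|eps w| `^ a))).
  by apply: le_Rintegral => //; apply: intgD => //; exact: intg_cst.
rewrite RintegralD//; last exact: intg_cst.
by rewrite Rintegral_cst// /B1 mulrDl lerD// H1.
Qed.

Let ieps_i i : P.-integrable A (EFin \o (fun w => eps w i 0)).
Proof.
apply: (@intg_le _ _ _ _ _ mA _ (fun w => 1 + `|eps w| ^+ 2)).
- exact: measurable_funTS.
- move=> w _; apply: le_trans (entry_le_norm _ _ _) _.
  by have := sqr_ge0 (`|eps w| - 1); nra.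
- by apply: intgD => //; exact: intg_cst.
Qed.

Variables (b c M : R) (b0 : 0 < b) (M0 : 0 < M).
Let s := c ^+ 2 / b.
Hypothesis hdel : (del * C) ^+ 2 * B1 <= bl / 8.
Hypothesis hM : 4 * K1 * M `^ (2 - a) * Ba <= bl / 16.
Hypothesis hs : 2 * s * K1 ^+ 2 * M ^+ 2 * B1 <= bl / 16.
Let W w := potential S b (U w).
Let s0 : 0 <= s. Proof. by rewrite divr_ge0 ?sqr_ge0// ltW. Qed.
Let K10 : 0 <= K1. Proof. by rewrite mulr_ge0// sqr_ge0. Qed.

Let mW : measurable_wrt G W.
Proof.
apply/measurable_wrtP => //; apply: potential_measurable => // i.
exact/measurable_wrtP.
Qed.
Let mW' : measurable_fun setT W.
Proof. exact: (measurable_wrt_measurable GM mW). Qed.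
Let W01 w : 0 <= W w <= 1.
Proof. by rewrite potential_le1// ltW ?potential_gt0. Qed.

Let pair_vec w : 'cV[R]_(p + q) := (S *m row_mx 1%:M (- L w))^T *m (S *m U w).

Let pairE w (y : 'cV[R]_(p + q)) :
  edot (S *m U w) (S *m (usubmx y - L w *m dsubmx y)) = edot (pair_vec w) y.
Proof.
rewrite /pair_vec -edot_mulmx -mulmxA -{3}[y]vsubmxK mul_row_col mul1mx mulNmx.
by [].
Qed.

Let psi j w := W w ^+ 2 * pair_vec w j 0.

Let mpsi j : measurable_wrt G (psi j).
Proof.
have mWg := (measurable_wrtP sG _).1 mW.
have mUg i := (measurable_wrtP sG _).1 (mU i).
have mLg i k := (measurable_wrtP sG _).1 (mL i k).
apply/measurable_wrtP => //; apply: measurable_funM; first exact: measurable_funX.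
rewrite (_ : (fun w => pair_vec w j 0) = fun w => \sum_k
   (\sum_l S k l * row_mx 1%:M (- L w) l j) * (\sum_l S k l * U w l 0)); last first.
  by apply/funext => w; rewrite /pair_vec !mxE; apply: eq_bigr => k _; rewrite !mxE.
apply: measurable_sum => k; apply: measurable_funM; apply: measurable_sum => l;
  apply: measurable_funM => //.
have [i ->|i ->] := split_ordP j.
  rewrite (_ : (fun w => _) = fun=> (1%:M : 'M[R]_p) l i)//.
  by apply/funext => w; rewrite row_mxEl.
rewrite (_ : (fun w => _) = fun w => - L w l i).
  by apply: measurableT_comp => //; exact: mLg.
by apply/funext => w; rewrite row_mxEr mxE.
Qed.

(** [U] is unbounded, but the potential decays like [|U|^-2], so [W |U| <= 1 + b]. A bounded weight
    is what lets the first-order term be integrated, with integral 0. *)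
Let psi_bound j w : `|psi j w| <= 2 * C * (1 + b).
Proof.
have e : pair_vec w j 0 = edot (S *m U w)
   (S *m (usubmx (delta_mx j 0) - L w *m dsubmx (delta_mx j 0))).
  rewrite pairE /edot (bigD1 j)//= big1 => [|i ij].
    by rewrite [delta_mx j 0 j 0]mxE !eqxx mulr1 addr0.
  by rewrite [delta_mx j 0 i 0]mxE (negbTE ij) mulr0.
have hd : `|delta_mx j 0 : 'cV[R]_(p + q)| <= 1.
  apply: norm_le_entries => // i k; rewrite mxE; case: (_ && _); by rewrite ?normr1 ?normr0.
have h1 : `|pair_vec w j 0| <= snorm S (U w) * (2 * C).
  rewrite e; apply: le_trans (edot_norm_le _ _) _; rewrite ler_wpM2l ?enorm_ge0//.
  apply: le_trans (innov_mx_le _ _) _; rewrite ler_piMr// mulr_ge0//.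
have /andP[w0 w1] := W01 w.
have h2 : W w * snorm S (U w) <= 1 + b.
  rewrite /W /potential mulrC ler_pdivrMr ?ltr_wpDr ?divr_ge0 ?sqr_ge0 ?(ltW b0)//.
  have -> : (1 + b) * (1 + snorm S (U w) ^+ 2 / b) =
     1 + b + snorm S (U w) ^+ 2 + snorm S (U w) ^+ 2 / b by field; rewrite gt_eqF.
  have h3 : 0 <= snorm S (U w) ^+ 2 / b by rewrite divr_ge0 ?sqr_ge0 ?(ltW b0).
  have := sqr_ge0 (snorm S (U w) - 1); have := b0; move: h3; move: (_ / b) => z; nra.
rewrite /psi normrM ger0_norm ?exprn_ge0//.
apply: le_trans (ler_wpM2l (exprn_ge0 2 w0) h1) _.
have -> : W w ^+ 2 * (snorm S (U w) * (2 * C)) = 2 * C * (W w * (W w * snorm S (U w))) by ring.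
rewrite ler_wpM2l ?mulr_ge0//; apply: le_trans h2.
by rewrite ler_piMl// mulr_ge0// snorm_ge0.
Qed.

Let f1 w := W w ^+ 2 * edot (S *m U w) (S *m innov w).
Let f2 w := snorm S (usubmx (eps w)) ^+ 2.
Let f3 w := `|eps w| ^+ 2.
Let f4 w := (1 - W w) * `|eps w| ^+ 2.
Let f5 w := `|eps w| `^ a.

Let f1E w : f1 w = \sum_j psi j w * eps w j 0.
Proof.
rewrite /f1 /innov pairE /edot mulr_sumr; apply: eq_bigr => j _.
by rewrite /psi mulrA.
Qed.

Let ipsi j : P.-integrable A (EFin \o (fun w => psi j w * eps w j 0)).
Proof.
apply: (@intg_mulb _ _ _ _ _ mA _ _ (2 * C * (1 + b))) => //.
by apply: measurable_funTS; exact: (measurable_wrt_measurable GM (mpsi j)).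
Qed.

Let if1 : P.-integrable A (EFin \o f1).
Proof.
rewrite (_ : f1 = fun w => \sum_j psi j w * eps w j 0); first exact: intg_sum.
by apply/funext => w; rewrite f1E.
Qed.

Let f1_0 : \int[P]_(w in A) f1 w = 0.
Proof.
under eq_Rintegral do rewrite f1E.
rewrite Rintegral_sum// big1// => j _.
exact: (weighted_Rintegral_eq0 GA (ieps_i j) (fun B GB BA => H3 GB BA j) (mpsi j)
  (psi_bound j)).
Qed.

Let if2 : P.-integrable A (EFin \o f2).
Proof.
apply: (@intg_le _ _ _ _ _ mA _ (fun w => C ^+ 2 * `|eps w| ^+ 2)).
- apply: measurable_funTS; apply: sqr_snorm_measurable => i.
  rewrite (_ : (fun w => _) = fun w => eps w (lshift q i) 0)//.
  by apply/funext => w; rewrite mxE.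
- move=> w _; rewrite ger0_norm ?sqr_ge0// -exprMn lerXn2r ?nnegrE ?mulr_ge0 ?snorm_ge0//.
  by apply: le_trans (SC _) _; rewrite ler_wpM2l// norm_usubmx_le.
- exact: intgZ.
Qed.

Let if4 : P.-integrable A (EFin \o f4).
Proof.
apply: (@intg_mulb _ _ _ _ _ mA _ _ 1) => //.
  by apply: measurable_funTS; exact: measurable_funB.
by move=> w _; have /andP[h1 h2] := W01 w; rewrite ger0_norm; lra.
Qed.

Let iW : P.-integrable A (EFin \o W).
Proof.
apply: (@intg_bounded _ _ _ _ _ mA _ 1); first exact: measurable_funTS.
by move=> w _; have /andP[h1 h2] := W01 w; rewrite ger0_norm.
Qed.

(** Over every event of [G] inside [A], [B1 - |eps|^2] has a nonnegative integral; it is weighted by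
    [1 - W], which is known to [G]. *)
Let f4_le : \int[P]_(w in A) f4 w <= B1 * (fine (P A) - \int[P]_(w in A) W w).
Proof.
have i1 : P.-integrable A (EFin \o (fun w => 1 - W w)) by apply: intgB => //; exact: intg_cst.
have h : 0 <= \int[P]_(w in A) ((1 - W w) * (B1 - `|eps w| ^+ 2)).
  apply: (@weighted_Rintegral_ge0 _ _ _ _ _ sG GM A _ _ 1) => //.
  - by apply: intgB => //; exact: intg_cst.
  - move=> B GB BA; have mB := GM GB.
    rewrite RintegralB//; [|exact: intg_cst|exact: integrableS isq].
    by rewrite subr_ge0 Rintegral_cst// H1sq.
  - apply/measurable_wrtP => //; apply: measurable_funB => //.
    exact/measurable_wrtP.
  - by move=> w; have /andP[h1 h2] := W01 w; apply/andP; split; lra.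
move: h; under eq_Rintegral do rewrite mulrBr (mulrC _ B1).
rewrite RintegralB//; last exact: intgZ.
rewrite subr_ge0 => h; apply: le_trans h _.
rewrite RintegralZl// RintegralB//; last exact: intg_cst.
by rewrite Rintegral_cst// mul1r.
Qed.

Let pointwise w : potential S b (U w + c *: innov w) <=
  W w + (- (2 * c / b) * f1 w + (- (s / 2) * f2 w
   + ((s * (del * C) ^+ 2 + 2 * s ^+ 2 * K1 ^+ 2 * M ^+ 2) * f3 w
   + (10 * s * K1 * f4 w + 4 * s * K1 * M `^ (2 - a) * f5 w)))).
Proof.
pose x := snorm S (U w) ^+ 2 / b.
pose k := s * snorm S (innov w) ^+ 2.
pose i := c / b * edot (S *m U w) (S *m innov w).
have x0 : 0 <= x by rewrite divr_ge0 ?sqr_ge0// ltW.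
have k0 : 0 <= k by rewrite mulr_ge0 ?sqr_ge0.
have ixk : i ^+ 2 <= x * k.
  have -> : x * k = (c / b) ^+ 2 * (snorm S (U w) * snorm S (innov w)) ^+ 2.
    by rewrite /x /k /s; field; rewrite gt_eqF.
  rewrite /i exprMn ler_wpM2l ?sqr_ge0// -real_normK ?num_real//.
  by rewrite lerXn2r ?nnegrE ?mulr_ge0 ?snorm_ge0// edot_norm_le.
have wE : potential S b (U w + c *: innov w) = (1 + (x + 2 * i + k))^-1.
  rewrite /potential; congr (1 + _)^-1.
  rewrite /snorm mulmxDr -scalemxAr sqr_enorm edotDl !edotDr !(edotZl, edotZr).
  rewrite (edotC (S *m innov w)) -!sqr_enorm -!/(snorm _ _) /x /i /k /s.
  by field; rewrite gt_eqF.
have k1 : k <= s * K1 * f3 w.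
  rewrite /k -mulrA ler_wpM2l// /K1 /f3.
  have -> : 4 * C ^+ 2 * `|eps w| ^+ 2 = (2 * C * `|eps w|) ^+ 2 by ring.
  by rewrite lerXn2r ?nnegrE ?mulr_ge0 ?snorm_ge0//; exact: innov_mx_le.
have f30 : 0 <= f3 w by rewrite sqr_ge0.
have f50 : 0 <= f5 w by rewrite powR_ge0.
have k2 : s / 2 * f2 w - s * (del * C) ^+ 2 * f3 w <= k.
  have := ler_wpM2l s0 (innov_ge w); rewrite /k -/(f2 w) -/(f3 w); lra.
have k3 : exists2 r, (k <= r \/ 2 <= r) & r * k <= s ^+ 2 * K1 ^+ 2 * M ^+ 2 * f3 w
    + 2 * s * K1 * M `^ (2 - a) * f5 w.
  have t1 : 0 <= s ^+ 2 * K1 ^+ 2 * M ^+ 2 * f3 w.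
    exact: mulr_ge0 (mulr_ge0 (mulr_ge0 (sqr_ge0 s) (sqr_ge0 K1)) (sqr_ge0 M)) f30.
  have t2 : 0 <= 2 * s * K1 * M `^ (2 - a) * f5 w.
    exact: mulr_ge0 (mulr_ge0 (mulr_ge0 (mulr_ge0 (ler0n R 2) s0) K10) (powR_ge0 _ _)) f50.
  (* Small noise takes [r] of order [s M^2] and pays with the second moment. Large noise takes
     [r = 2] and pays with the moment of order [a], since [|eps|^2 <= M^(2 - a) |eps|^a] there. *)
  have [hM'|hM'] := leP `|eps w| M.
    exists (s * K1 * M ^+ 2).
      left; apply: le_trans k1 _; apply: (ler_wpM2l (mulr_ge0 s0 K10)).
      by rewrite lerXn2r ?nnegrE// ltW.
    rewrite -[leLHS]addr0 lerD//.
    apply: le_trans (ler_wpM2l (mulr_ge0 (mulr_ge0 s0 K10) (sqr_ge0 M)) k1) _.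
    by rewrite le_eqVlt; apply/orP; left; apply/eqP; ring.
  exists 2; first by right.
  have q0 : f3 w <= M `^ (2 - a) * f5 w.
    rewrite /f3 /f5; have e0 : 0 < `|eps w| := lt_trans M0 hM'.
    have -> : `|eps w| ^+ 2 = `|eps w| `^ (2 - a) * `|eps w| `^ a.
      rewrite -powR_mulrn ?(ltW e0)// -powRD; first by rewrite subrK.
      by rewrite (gt_eqF e0) implybT.
    rewrite ler_wpM2r ?powR_ge0// -(opprB a 2) !powRN lef_pV2 ?posrE ?powR_gt0//.
    by apply: ge0_ler_powR; rewrite ?nnegrE ?subr_ge0 ?(ltW a2) ?(ltW M0) ?(ltW hM').
  have q1 := ler_wpM2l (mulr_ge0 s0 K10) q0.
  have t3 : 2 * k <= 2 * s * K1 * M `^ (2 - a) * f5 w.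
    apply: le_trans (ler_wpM2l (ler0n R 2) (le_trans k1 q1)) _.
    by rewrite le_eqVlt; apply/orP; left; apply/eqP; ring.
  by rewrite -[leLHS]add0r; exact: lerD t1 t3.
have [r hr rk] := k3.
have := potential_ineq x0 k0 ixk hr.
rewrite -wE -/x -[(1 + x)^-1]/(W w) => h; apply: le_trans h _.
have k4 : k * (1 - W w) <= s * K1 * f4 w.
  have /andP[W0 W1] := W01 w.
  have -> : s * K1 * f4 w = s * K1 * f3 w * (1 - W w) by rewrite /f4 /f3; ring.
  by rewrite ler_wpM2r// subr_ge0.
have -> : i * W w ^+ 2 = c / b * f1 w by rewrite /i /f1; ring.
have -> : 2 * c / b = 2 * (c / b) by rewrite mulrA.
move: (c / b) => d; lra.
Qed.

(** In units of [s], the noise gains [bl / 2], of which the slope of the graph takes [bl / 8]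
    ([hdel]), the large noise [bl / 16] ([hM]) and the quartic term [bl / 16] ([hs]): [bl / 4]
    remains. The adverse term [10 * K1 * B1] multiplies [P A] minus the integral of [W], so it
    counts only where the potential has already left 1. *)
Lemma one_step : \int[P]_(w in A) potential S b (U w + c *: innov w) <=
  (1 - 10 * s * K1 * B1) * \int[P]_(w in A) W w + (10 * K1 * B1 - bl / 4) * s * fine (P A).
Proof.
have mUc : forall i, measurable_fun setT (fun w => (U w + c *: innov w) i 0).
  move=> i; rewrite (_ : (fun w => _) = fun w => U w i 0 +
      c * (eps w (lshift q i) 0 - \sum_j L w i j * eps w (rshift p j) 0)).
    apply: measurable_funD => //; apply: measurable_funM => //; apply: measurable_funB => //.
    apply: measurable_sum => j; apply: measurable_funM => //.
    exact: (measurable_wrt_measurable GM (mL i j)).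
  apply/funext => w; rewrite /innov !mxE; congr (_ + _ * (_ - _)).
  by apply: eq_bigr => j _; rewrite mxE.
have iL : P.-integrable A (EFin \o (fun w => potential S b (U w + c *: innov w))).
  apply: (@intg_bounded _ _ _ _ _ mA _ 1).
    by apply: measurable_funTS; exact: potential_measurable.
  by move=> w _; rewrite ger0_norm ?potential_le1// ltW ?potential_gt0.
have i5 : P.-integrable A (EFin \o f5) by [].
have iR5 := intgZ mA (4 * s * K1 * M `^ (2 - a)) i5.
have iR4 := intgD mA (intgZ mA (10 * s * K1) if4) iR5.
have iR3 := intgD mA (intgZ mA (s * (del * C) ^+ 2 + 2 * s ^+ 2 * K1 ^+ 2 * M ^+ 2) isq) iR4.
have iR2 := intgD mA (intgZ mA (- (s / 2)) if2) iR3.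
have iR1 := intgD mA (intgZ mA (- (2 * c / b)) if1) iR2.
have := le_Rintegral mA iL (intgD mA iW iR1) (fun w _ => pointwise w).
rewrite (RintegralD mA iW iR1) (RintegralD mA (intgZ mA _ if1) iR2).
rewrite (RintegralD mA (intgZ mA _ if2) iR3) (RintegralD mA (intgZ mA _ isq) iR4).
rewrite (RintegralD mA (intgZ mA _ if4) iR5).
rewrite (RintegralZl _ mA if1) (RintegralZl _ mA if2) (RintegralZl _ mA isq).
rewrite (RintegralZl _ mA if4) (RintegralZl _ mA i5) f1_0 mulr0 add0r.
move=> h; apply: le_trans h _.
have p0 : 0 <= fine (P A) by exact: fine_ge0.
have h3 := H1sq GA (@subset_refl _ A).
have h5 := H1 GA (@subset_refl _ A).
have h4 := f4_le.
set p1 := fine (P A) in p0 h3 h5 h4 *.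
have e2 : - (s / 2) * \int[P]_(w in A) f2 w <= - (s / 2) * (bl * p1).
  by rewrite !mulNr lerN2 ler_wpM2l// divr_ge0.
have e3 : (s * (del * C) ^+ 2 + 2 * s ^+ 2 * K1 ^+ 2 * M ^+ 2) * \int[P]_(w in A) f3 w
    <= s * (bl / 8) * p1 + s * (bl / 16) * p1.
  apply: (@le_trans _ _ ((s * (del * C) ^+ 2 + 2 * s ^+ 2 * K1 ^+ 2 * M ^+ 2) * (B1 * p1))).
    rewrite ler_wpM2l//; apply: addr_ge0 (mulr_ge0 s0 (sqr_ge0 _)) _.
    exact: mulr_ge0 (mulr_ge0 (mulr_ge0 (ler0n R 2) (sqr_ge0 s)) (sqr_ge0 K1)) (sqr_ge0 M).
  have -> : (s * (del * C) ^+ 2 + 2 * s ^+ 2 * K1 ^+ 2 * M ^+ 2) * (B1 * p1) =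
      s * ((del * C) ^+ 2 * B1) * p1 + s * (2 * s * K1 ^+ 2 * M ^+ 2 * B1) * p1 by ring.
  exact: lerD (ler_wpM2r p0 (ler_wpM2l s0 hdel)) (ler_wpM2r p0 (ler_wpM2l s0 hs)).
have e4 : 10 * s * K1 * \int[P]_(w in A) f4 w <=
    10 * s * K1 * (B1 * (p1 - \int[P]_(w in A) W w)).
  exact: (ler_wpM2l (mulr_ge0 (mulr_ge0 (ler0n R 10) s0) K10) h4).
have e5 : 4 * s * K1 * M `^ (2 - a) * \int[P]_(w in A) f5 w <= s * (bl / 16) * p1.
  apply: (@le_trans _ _ (4 * s * K1 * M `^ (2 - a) * (Ba * p1))).
    exact: (ler_wpM2l (mulr_ge0 (mulr_ge0 (mulr_ge0 (ler0n R 4) s0) K10) (powR_ge0 _ _)) h5).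
  rewrite mulrA ler_wpM2r//.
  have -> : 4 * s * K1 * M `^ (2 - a) * Ba = s * (4 * K1 * M `^ (2 - a) * Ba) by ring.
  by rewrite ler_wpM2l.
have := lerD (lerD e2 e3) (lerD e4 e5).
move: (\int[P]_(w in A) W w) (\int[P]_(w in A) f2 w) => z2 z3.
move: (_ * \int[P]_(w in A) f3 w) (_ * \int[P]_(w in A) f4 w) (_ * \int[P]_(w in A) f5 w).
move=> z4 z5 z6; lra.
Qed.
End OneStep.

(** * Lipschitz functions, slopes of graphs and their measurability *)

Section LipschitzMeasurable.
Variable R : realType.

Lemma lip_continuous n (phi : 'cV[R]_n -> R) k :
  (forall y y', `|phi y - phi y'| <= k * `|y - y'|) -> continuous phi.
Proof.
move=> h y; have F : Filter (nbhs (y : 'cV[R]_n)) by exact: nbhs_filter.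
apply/(@cvgrPdist_le _ _ _ _ F phi (phi y)) => e e0.
have d0 : 0 < e / (`|k| + 1) by rewrite divr_gt0.
have := nbhsx_ballx y _ d0; apply: filterS => z; rewrite -ball_normE /=.
move=> /ltW; rewrite ler_pdivlMr// => hz; apply: le_trans hz; apply: le_trans (h _ _) _.
by rewrite mulrC ler_wpM2l// (le_trans (ler_norm _))// lerDl.
Qed.

Lemma lip_measurable d (T : measurableType d) n (Y : T -> 'cV[R]_n) (phi : 'cV[R]_n -> R) k :
  (forall i, measurable_fun setT (fun w => Y w i 0)) ->
  (forall y y', `|phi y - phi y'| <= k * `|y - y'|) ->
  measurable_fun setT (fun w => phi (Y w)).
Proof. by move=> mY /lip_continuous; exact: continuous_coord_measurable. Qed.

Lemma snorm_dist m n (S : 'M[R]_(m, n)) u v : `|snorm S u - snorm S v| <= snorm S (u - v).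
Proof.
have key (x z : 'cV[R]_n) : snorm S x - snorm S z <= snorm S (x - z).
  by have := snorm_lbD S x (- z); rewrite snormN.
by rewrite ler_norml lerNl opprB key snormBC key.
Qed.

(** The profile [1 / (1 + u^2)] is 1-Lipschitz, so at the scale [B] an error [z] raises the
    potential by at most [|z| / B]. *)
Lemma potential_lip p mp (S : 'M[R]_(mp, p)) (B : R) y z : 0 < B ->
  potential S (B ^+ 2) (y + z) <= potential S (B ^+ 2) y + snorm S z / B.
Proof.
move=> B0; rewrite /potential -!expr_div_n.
set u := snorm S y / B; set v := snorm S (y + z) / B; set r := snorm S z / B.
have v0 : 0 <= v by rewrite divr_ge0 ?snorm_ge0// ltW.
have u0 : 0 <= u by rewrite divr_ge0 ?snorm_ge0// ltW.
have r0 : 0 <= r by rewrite divr_ge0 ?snorm_ge0// ltW.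
have uvr : u - v <= r.
  rewrite -mulrBl ler_wpM2r ?invr_ge0 ?(ltW B0)//.
  have := snorm_dist S y (y + z); rewrite opprD addNKr snormN ler_norml => /andP[_].
  by [].
have [vu|uv] := leP u v.
  rewrite (@le_trans _ _ (1 + u ^+ 2)^-1) ?lerDl//.
  by rewrite lef_pV2 ?posrE ?ltr_wpDr ?sqr_ge0// lerD2l lerXn2r.
have a0 : 0 < 1 + u ^+ 2 by rewrite ltr_wpDr ?sqr_ge0.
have c0 : 0 < 1 + v ^+ 2 by rewrite ltr_wpDr ?sqr_ge0.
rewrite -lerBlDl; apply: le_trans uvr.
have -> : (1 + v ^+ 2)^-1 - (1 + u ^+ 2)^-1 =
    (u - v) * ((u + v) / ((1 + u ^+ 2) * (1 + v ^+ 2))).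
  by field; rewrite !gt_eqF.
rewrite ler_piMr ?subr_ge0 ?(ltW uv)// ler_pdivrMr ?mulr_gt0// mul1r.
have := sqr_ge0 (u - 1); have := sqr_ge0 (v - 1); have := sqr_ge0 (u * v); nra.
Qed.

Variables (p q mp mq : nat) (S : 'M[R]_(mp, p)) (T : 'M[R]_(mq, q)).
Variables (del nu K C : R) (nu0 : 0 < nu) (K0 : 0 <= K).
Hypothesis SC : forall u : 'cV[R]_p, `|u| <= C * snorm S u.
Hypothesis C0 : 0 <= C.
Hypothesis TC : forall v : 'cV[R]_q, snorm T v <= C * `|v|.
Hypothesis del0 : 0 <= del.

Lemma graph_lip_norm (phi : 'cV[R]_q -> 'cV[R]_p) : graph_lip S T del phi ->
  forall v v', `|phi v - phi v'| <= C * (del * C) * `|v - v'|.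
Proof.
move=> h v v'; apply: le_trans (SC _) _; rewrite -mulrA ler_wpM2l//.
by apply: le_trans (h _ _) _; rewrite -mulrA ler_wpM2l.
Qed.

(** [L] will come from an arbitrary choice of slopes; the expansion identifies it as a limit of
    difference quotients, which are measurable. *)
Lemma graph_lin_measurable d (Om : measurableType d) (phi : 'cV[R]_q -> 'cV[R]_p)
    (V : Om -> 'cV[R]_q) (L : Om -> 'M[R]_(p, q)) :
  graph_lip S T del phi ->
  (forall i, measurable_fun setT (fun w => V w i 0)) ->
  (forall w h, snorm S (phi (V w + h) - phi (V w) - L w *m h) <= K * snorm T h `^ (1 + nu)) ->
  forall i j, measurable_fun setT (fun w => L w i j).
Proof.
move=> lip mV hL i j; pose ej : 'cV[R]_q := delta_mx j 0.
(* The quotient with increment [h] has an error of order [h ^ nu]; this choice makes it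
   [1 / (k + 1)]. *)
pose hk (k : nat) : R := k.+1%:R^-1 `^ nu^-1.
have hk0 k : 0 < hk k by rewrite powR_gt0// invr_gt0.
have hknu k : hk k `^ nu = k.+1%:R^-1.
  by rewrite /hk -powRrM mulVf ?gt_eqF// powRr1// invr_ge0.
pose u k w := (hk k)^-1 * ((phi (V w + hk k *: ej)) i 0 - (phi (V w)) i 0).
have entry (v v' : 'cV[R]_p) : `|v i 0 - v' i 0| <= `|v - v'|.
  by have := entry_le_norm (v - v') i 0; rewrite !mx_entry.
have mu k : measurable_fun setT (u k).
  apply: measurable_funM => //; apply: measurable_funB.
    apply: (@lip_measurable _ _ _ V (fun v => phi (v + hk k *: ej) i 0) (C * (del * C))) => //.
    move=> y y'; apply: le_trans (entry _ _) _; apply: le_trans (graph_lip_norm lip _ _) _.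
    by rewrite opprD addrACA subrr addr0.
  apply: (@lip_measurable _ _ _ V (fun v => phi v i 0) (C * (del * C))) => //.
  by move=> y y'; apply: le_trans (entry _ _) _; exact: graph_lip_norm.
apply: (measurable_fun_cvg (h := u)) => // w _.
have err k : `|L w i j - u k w| <= C * (K * snorm T ej `^ (1 + nu)) * k.+1%:R^-1.
  have e : L w i j - u k w =
     - ((hk k)^-1 * (phi (V w + hk k *: ej) - phi (V w) - L w *m (hk k *: ej)) i 0).
    rewrite !mx_entry -scalemxAr -colE !mxE /u.
    by field; rewrite gt_eqF.
  rewrite e normrN normrM gtr0_norm ?invr_gt0//.
  rewrite mulrC ler_pdivrMr//; apply: le_trans (entry_le_norm _ _ _) _.
  apply: le_trans (SC _) _; rewrite -!mulrA ler_wpM2l//.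
  apply: le_trans (hL w _) _; rewrite ler_wpM2l// snormZ gtr0_norm//.
  rewrite powRM ?snorm_ge0 ?(ltW (hk0 k))// mulrC ler_wpM2l ?powR_ge0//.
  rewrite powRD; last by rewrite (gt_eqF (hk0 k)) implybT.
  by rewrite powRr1 ?(ltW (hk0 k))// hknu mulrC.
apply/cvgrPdist_le => e e0.
set B := C * _ in err.
have B0 : 0 <= B by rewrite !mulr_ge0// powR_ge0.
exists (Num.bound (B / e)) => // k /= hk'.
apply: le_trans (err k) _; rewrite ler_pdivrMr// mulrC -ler_pdivrMr//.
apply: ltW; apply: lt_le_trans (archi_boundP _) _; first by rewrite divr_ge0// ltW.
by rewrite ler_nat ltnW.
Qed.
End LipschitzMeasurable.

Lemma Rintegral_subset (R : realType) disp (Omega : measurableType disp)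
    (P : probability Omega R) (A B : set Omega) (f : Omega -> R) :
  measurable A -> measurable B -> A `<=` B -> P.-integrable B (EFin \o f) ->
  (forall w, B w -> 0 <= f w) -> \int[P]_(w in A) f w <= \int[P]_(w in B) f w.
Proof.
move=> mA mB AB iB f0; have iA : P.-integrable A (EFin \o f) by exact: integrableS iB.
rewrite /Rintegral fine_le ?integrable_fin_num//.
by apply: ge0_subset_integral => //; exact: measurable_int iB.
Qed.

Lemma ae_eq_Rintegral (R : realType) disp (Omega : measurableType disp)
    (P : probability Omega R) (A : set Omega) (f g : Omega -> R) : measurable A ->
  measurable_fun setT f -> measurable_fun setT g ->
  {ae P, forall w, A w -> f w = g w} -> \int[P]_(w in A) f w = \int[P]_(w in A) g w.
Proof.
move=> mA mf mg fg; congr fine; apply: ae_eq_integral => //.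
- by apply/measurable_EFinP; exact: measurable_funTS.
- by apply/measurable_EFinP; exact: measurable_funTS.
- by apply: filterS fg => w h Aw /=; rewrite h.
Qed.

Lemma fine_prob_le (R : realType) disp (Omega : measurableType disp)
    (P : probability Omega R) (A B : set Omega) :
  measurable A -> measurable B -> A `<=` B -> fine (P A) <= fine (P B).
Proof.
move=> mA mB AB; rewrite fine_le ?fin_num_measure//.
by apply: le_measure => //; rewrite inE.
Qed.

Lemma step_arith (R : realType) (q th k x x' J I I' : R) :
  0 <= q -> q <= 1 -> 0 <= 1 - th -> I <= I' -> x <= x' -> J <= k * x' ->
  (1 - q) * I + q * (1 - th) * x + J <= (1 - q) * (I' + J) + q * ((1 - th) + k) * x'.
Proof.
move=> q0 q1 t1 h1 h2 h3.
have f1 := ler_wpM2l (_ : 0 <= 1 - q) h1.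
have f2 := ler_wpM2l (mulr_ge0 q0 t1) h2.
have f3 := ler_wpM2l q0 h3.
by move: f1; rewrite subr_ge0 => /(_ q1) f1; lra.
Qed.

(** The excess over [p * (1 - th + k)] is multiplied by [1 - q n] at each step, and the product of
    these factors is at most the inverse of one plus the sum of the [q n], because
    [(1 - x) (1 + s + x) <= 1 + s]. *)
Lemma recursion_bound (R : realType) (g q : nat -> R) (th k p : R) (t m : nat) :
  0 <= th -> 0 <= p -> (forall n, 0 <= q n) -> g t <= p * (1 + k) ->
  (forall n, (t <= n < m)%N -> q n <= 1 /\ g n.+1 <= (1 - q n) * g n + q n * ((1 - th) + k) * p) ->
  forall n, (t <= n <= m)%N ->
  g n <= p * ((1 - th + k) + th / (1 + \sum_(t <= i < n) q i)).
Proof.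
move=> th0 p0 q0 gt gS; elim=> [|n IH] /andP[tn nm].
  have t0 : t = 0%N by move: tn; rewrite leqn0 => /eqP.
  rewrite t0 big_geq// addr0 divr1 -t0; apply: le_trans gt _.
  by rewrite le_eqVlt; apply/orP; left; apply/eqP; ring.
move: tn; rewrite leq_eqVlt => /orP[/eqP <-|].
  rewrite big_geq// addr0 divr1; apply: le_trans gt _.
  by rewrite le_eqVlt; apply/orP; left; apply/eqP; ring.
rewrite ltnS => tn; have [q1 h] := gS n (introT andP (conj tn nm)).
have := IH (introT andP (conj tn (ltnW nm))) => hn.
rewrite big_nat_recr//=; apply: le_trans h _.
have s0 : 0 <= \sum_(t <= i < n) q i by exact: sumr_ge0.
move: (q0 n) q1 hn; move: (q n) (g n) (\sum_(t <= i < n) q i) s0 => x y s s0 x0 x1 hn.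
have s1 : 0 < 1 + s by lra.
have key : (1 - x) * (th / (1 + s)) <= th / (1 + (s + x)).
  rewrite mulrCA ler_wpM2l// ler_pdivrMr// mulrC ler_pdivlMr//; nra.
have := ler_wpM2l (_ : 0 <= 1 - x) hn; rewrite subr_ge0 => /(_ x1).
have := ler_wpM2l p0 key; move: (th / (1 + s)) (th / (1 + (s + x))) => *; nra.
Qed.

(** * Iteration of the one-step estimate along a trajectory *)

Section Recursion.
Variables (R : realType) (disp : measure_display) (Omega : measurableType disp).
Variable P : probability Omega R.
Variables (F : nat -> set (set Omega)) (fF : filtration F).
Variables (p q mp mq : nat) (S : 'M[R]_(mp, p)) (T : 'M[R]_(mq, q)).
Variables (del nu K C a : R).
Hypotheses (C0 : 0 < C) (del0 : 0 <= del) (del1 : del <= 1) (a2 : 2 < a).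
Hypotheses (nu0 : 0 < nu) (K0 : 0 <= K).
Hypothesis SC : forall u : 'cV[R]_p, snorm S u <= C * `|u|.
Hypothesis SC' : forall u : 'cV[R]_p, `|u| <= C * snorm S u.
Hypothesis TC : forall v : 'cV[R]_q, snorm T v <= C * `|v|.
Variables (y e rr : nat -> Omega -> 'cV[R]_(p + q)).
Hypotheses (my : adapted F y) (me : adapted F e) (mrr : adapted F rr).
Variables (Ft : 'cV[R]_(p + q) -> 'cV[R]_(p + q)) (kF : R).
Hypothesis FtL : forall z z', `|Ft z - Ft z'| <= kF * `|z - z'|.
Variables (c gamma : nat -> R) (c_ge0 : forall n, 0 <= c n).
Variables (D : nat -> set Omega) (FD : forall n, F n (D n)).
Hypothesis rec : forall n, {ae P, forall w, D n w ->
  y n.+1 w = y n w + gamma n.+1 *: Ft (y n w) + c n.+1 *: (e n.+1 w + rr n.+1 w)}.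
Variables (bl Ba M : R).
Hypotheses (bl0 : 0 <= bl) (Ba0 : 0 <= Ba) (M0 : 0 < M).
Hypothesis ie : forall n, P.-integrable (D n) (EFin \o (fun w => `|e n.+1 w| `^ a)).
Hypothesis H1 : forall n B, F n B -> B `<=` D n ->
  \int[P]_(w in B) (`|e n.+1 w| `^ a) <= Ba * fine (P B).
Hypothesis H2 : forall n B, F n B -> B `<=` D n ->
  bl * fine (P B) <= \int[P]_(w in B) (snorm S (usubmx (e n.+1 w)) ^+ 2).
Hypothesis H3 : forall n B, F n B -> B `<=` D n ->
  forall i, \int[P]_(w in B) e n.+1 w i 0 = 0.
Let K1 := 4 * C ^+ 2.
Let B1 := 1 + Ba.
Hypothesis hdel : (del * C) ^+ 2 * B1 <= bl / 8.
Hypothesis hM : 4 * K1 * M `^ (2 - a) * Ba <= bl / 16.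
Hypothesis hbl : bl <= 40 * K1 * B1.

(** What a step adds to the linear action of the noise: the remainder [rr] acts once directly and
    once through the graph, whence the factor 2, and the graph departs from its linear part along
    the [v] component of the noise. *)
Definition err k w := 2 * C * c k * `|rr k w| +
  K * (c k * snorm T (dsubmx (e k w))) `^ (1 + nu).

Lemma err_ge0 k w : 0 <= err k w.
Proof. by rewrite addr_ge0// mulr_ge0 ?powR_ge0// mulr_ge0// ?mulr_ge0// ltW. Qed.

Let sF n : sigma_algebra setT (F n). Proof. by case: fF. Qed.
Let FM n : F n `<=` measurable. Proof. by case: fF. Qed.
Let Fle m n : (m <= n)%N -> F m `<=` F n. Proof. by case: fF => _ _; exact. Qed.

Lemma measurable_wrt_le d' (T' : measurableType d') m n (g : Omega -> T') : (m <= n)%N ->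
  measurable_wrt (F m) g -> measurable_wrt (F n) g.
Proof. by move=> mn h B mB; apply: (Fle mn); exact: h. Qed.

Lemma err_measurable k n : (k <= n)%N -> measurable_wrt (F n) (err k).
Proof.
move=> kn; apply: (measurable_wrt_le kn); apply/measurable_wrtP => //.
apply: measurable_funD; apply: measurable_funM => //.
  apply: continuous_coord_measurable; last exact: norm_continuous.
  by move=> i; apply/measurable_wrtP => //; exact: mrr.
apply: (@measurableT_comp _ _ _ _ _ _ (@powR R ^~ (1 + nu))).
  exact: measurable_powR.
apply: measurable_funM => //.
apply: (@lip_measurable _ _ (g_sigma_algebraType (F k)) _ (e k) (fun z => snorm T (dsubmx z)) C).
  by move=> i; apply/measurable_wrtP => //; exact: me.
move=> z z'; apply: le_trans (snorm_dist _ _ _) _; rewrite -linearB.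
by apply: le_trans (TC _) _; rewrite ler_wpM2l ?(ltW C0)// norm_dsubmx_le.
Qed.

Variables (t m : nat) (A : set Omega) (FA : F t A).
Variable phi : nat -> 'cV[R]_q -> 'cV[R]_p.
Hypothesis phi_good : forall n, graph_lip S T del (phi n) /\ graph_lin S T del nu K (phi n).
Hypothesis phi_step : forall n, (t <= n < m)%N -> forall z,
  snorm S (usubmx z - phi n (dsubmx z)) <=
  snorm S (usubmx (z + gamma n.+1 *: Ft z) - phi n.+1 (dsubmx (z + gamma n.+1 *: Ft z))).
Variables (B0 kap : R) (B00 : 0 < B0) (kap0 : 0 <= kap).
Let s n := c n.+1 ^+ 2 / B0 ^+ 2.
Hypothesis hs : forall n, (t <= n < m)%N -> 2 * s n * K1 ^+ 2 * M ^+ 2 * B1 <= bl / 16.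
Hypothesis hs1 : forall n, (t <= n < m)%N -> 10 * s n * K1 * B1 <= 1.

Definition err_sum n w := \sum_(t.+1 <= k < n.+1) err k w.
(** Takes the place of a stopping time: rather than stopping the process, integrals are taken over
    these decreasing events, [alive n] being known at time [n]. *)
Definition alive n := A `&` [set w | (forall k, (t <= k <= n)%N -> D k w) /\ err_sum n w <= kap].
Definition chart_coord n w := usubmx (y n w) - phi n (dsubmx (y n w)).
(* The unspent part of the error budget [kap] pays for the errors, so that
   the score only has to be compared with the noise. *)
Definition score n w := potential S (B0 ^+ 2) (chart_coord n w) + (kap - err_sum n w) / B0.

Lemma err_sum_measurable n : measurable_wrt (F n) (err_sum n).
Proof.
apply/measurable_wrtP => //.
rewrite (_ : err_sum n = fun w => \sum_(k <- index_iota t.+1 n.+1)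
    (if (k <= n)%N then err k w else 0)).
  apply: measurable_sum => k; have [kn|//] := boolP (k <= n)%N.
  by apply/measurable_wrtP => //; exact: err_measurable.
by apply/funext => w; apply: eq_big_nat => k /andP[_]; rewrite ltnS => ->.
Qed.

Lemma alive_F n : (t <= n)%N -> F n (alive n).
Proof.
move=> tn; apply: (sigma_setI (sF n)); first exact: Fle FA.
apply: (sigma_setI (sF n)); last first.
  rewrite (_ : (fun _ => _) = err_sum n @^-1` `]-oo, kap]%classic).
    by apply: err_sum_measurable.
  by apply/seteqP; split => w /=; rewrite in_itv.
rewrite (_ : (fun _ => _) = \bigcap_k (if (t <= k <= n)%N then D k else setT)).
  apply: (sigma_bigcap (sF n)) => k; case: ifP => [/andP[_ kn]|_].
    exact: Fle (FD k).
  exact: sigma_setT.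
apply/seteqP; split => w /= h k; first by move=> _; case: ifP => // /h.
by move=> tk; have := h k I; rewrite tk.
Qed.

Lemma alive_decr n : (t <= n)%N -> alive n.+1 `<=` alive n.
Proof.
move=> tn w [Aw [h1 h2]]; split=> //; split.
  by move=> k /andP[k1 k2]; apply: h1; rewrite k1 leqW.
by apply: le_trans h2; rewrite /err_sum [leRHS]big_nat_recr//= lerDl err_ge0.
Qed.

Let coord_measurable k n (z : Omega -> 'cV[R]_(p + q)) :
  (forall i, measurable_wrt (F k) (fun w => z w i 0)) ->
  forall i, measurable_wrt (F k) (fun w => (usubmx (z w) - phi n (dsubmx (z w))) i 0).
Proof.
move=> mz i; have [lip _] := phi_good n.
apply/measurable_wrtP => //.
apply: (@lip_measurable _ _ (g_sigma_algebraType (F k)) _ z (fun x => (usubmx x - phi n (dsubmx x)) i 0)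
  (1 + C * (del * C))).
  by move=> j; apply/measurable_wrtP => //; exact: mz.
move=> x x'; rewrite -oppmx_entry -addmx_entry.
apply: le_trans (entry_le_norm _ _ _) _.
have -> : usubmx x - phi n (dsubmx x) - (usubmx x' - phi n (dsubmx x')) =
    usubmx (x - x') - (phi n (dsubmx x) - phi n (dsubmx x')).
  rewrite [usubmx (x - x')]linearB.
  by apply/matrixP => ? ?; rewrite !mx_entry; ring.
apply: le_trans (ler_normB _ _) _; rewrite mulrDl mul1r lerD ?norm_usubmx_le//.
apply: le_trans (graph_lip_norm SC' (ltW C0) TC del0 lip _ _) _.
by rewrite ler_wpM2l ?mulr_ge0 ?(ltW C0)// -linearB norm_dsubmx_le.
Qed.

Let drift n w := y n w + gamma n.+1 *: Ft (y n w).

Let mdrift n i : measurable_wrt (F n) (fun w => drift n w i 0).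
Proof.
apply/measurable_wrtP => //.
apply: (@lip_measurable _ _ (g_sigma_algebraType (F n)) _ (y n) (fun x => (x + gamma n.+1 *: Ft x) i 0)
  (1 + `|gamma n.+1| * kF)).
  by move=> j; apply/measurable_wrtP => //; exact: my.
move=> x x'; rewrite -oppmx_entry -addmx_entry.
apply: le_trans (entry_le_norm _ _ _) _.
have -> : x + gamma n.+1 *: Ft x - (x' + gamma n.+1 *: Ft x') =
    (x - x') + gamma n.+1 *: (Ft x - Ft x').
  by apply/matrixP => ? ?; rewrite !mx_entry; ring.
apply: le_trans (ler_normD _ _) _; rewrite mulrDl mul1r lerD2l normrZ -mulrA.
by rewrite ler_wpM2l.
Qed.

Let qn n := 10 * s n * K1 * B1.

Let slack n w := (kap - err_sum n w) / B0.

Let slack_bound n w : (t <= n)%N -> alive n w -> 0 <= slack n w <= kap / B0.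
Proof.
move=> tn [_ [_ h]]; rewrite /slack divr_ge0 ?subr_ge0 ?(ltW B00)//=.
rewrite ler_wpM2r ?invr_ge0 ?(ltW B00)// gerBl.
by apply: sumr_ge0 => k _; exact: err_ge0.
Qed.

Let mslack k n : (n <= k)%N -> measurable_fun setT (slack n).
Proof.
move=> nk; apply: measurable_funM => //; apply: measurable_funB => //.
exact: (measurable_wrt_measurable (@FM n) (err_sum_measurable n)).
Qed.

(** The nonlinear errors are paid by the drop of the slack, and shrinking [alive n] to [alive n.+1]
    costs nothing as the integrand is nonnegative. [one_step] handles the linearized noise, and the
    drift can only lower the potential. *)
Lemma score_step n : (t <= n < m)%N ->
  \int[P]_(w in alive n.+1) score n.+1 w <= (1 - qn n) * \int[P]_(w in alive n) score n w
    + qn n * ((1 - bl / (40 * K1 * B1)) + kap / B0) * fine (P A).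
Proof.
move=> tnm; have /andP[tn nm] := tnm.
have [lip lin] := phi_good n.+1.
(* A slope is chosen at each [v], with no care for measurability: [graph_lin_measurable] recovers
   it. *)
have [L0 L0P] : exists L0 : 'cV[R]_q -> 'M[R]_(p, q), forall v,
    (forall h, snorm S (L0 v *m h) <= del * snorm T h) /\
    forall h, snorm S (phi n.+1 (v + h) - phi n.+1 v - L0 v *m h)
      <= K * snorm T h `^ (1 + nu).
  by move: lin => /choice[L0 L0P]; exists L0.
pose V w := dsubmx (drift n w).
pose U w := usubmx (drift n w) - phi n.+1 (V w).
pose L w := L0 (V w).
pose z w := drift n w + c n.+1 *: (e n.+1 w + rr n.+1 w).
pose Zn w := usubmx (z w) - phi n.+1 (dsubmx (z w)).
have mU i : measurable_wrt (F n) (fun w => U w i 0) by exact: coord_measurable (mdrift n) i.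
have mV i : measurable_wrt (F n) (fun w => V w i 0).
  rewrite (_ : (fun w => _) = fun w => drift n w (rshift p i) 0); first exact: mdrift.
  by apply/funext => w; rewrite mxE.
have mL i j : measurable_wrt (F n) (fun w => L w i j).
  apply/measurable_wrtP => //.
  apply: (@graph_lin_measurable _ _ _ _ _ S T del nu K C nu0 K0 SC' (ltW C0) TC del0
    _ (g_sigma_algebraType (F n)) (phi n.+1) V L lip).
    by move=> k; apply/measurable_wrtP.
  by move=> w h; have [_] := L0P (V w); exact.
have mz i : measurable_wrt (F n.+1) (fun w => z w i 0).
  have md := (measurable_wrtP (sF n.+1) _).1 (measurable_wrt_le (leqnSn n) (mdrift n i)).
  have me1 := (measurable_wrtP (sF n.+1) _).1 (me n.+1 i).
  have mr1 := (measurable_wrtP (sF n.+1) _).1 (mrr n.+1 i).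
  apply/measurable_wrtP => //.
  rewrite (_ : (fun w => _) = fun w => drift n w i 0 + c n.+1 * (e n.+1 w i 0 + rr n.+1 w i 0)).
    by apply: measurable_funD => //; apply: measurable_funM => //; exact: measurable_funD.
  by apply/funext => w; rewrite /z !mx_entry.
have FA1 := alive_F (leqW tn); have FA0 := alive_F tn.
have mA1 := FM FA1; have mA0 := FM FA0.
have AD : alive n `<=` D n by move=> w [_ [h _]]; apply: h; rewrite tn leqnn.
have AA := alive_decr tn.
have mpot1 (x : Omega -> 'cV[R]_p) : (forall i, measurable_fun setT (fun w => x w i 0)) ->
    measurable_fun setT (fun w => potential S (B0 ^+ 2) (x w)).
  by apply: potential_measurable; exact: exprn_gt0.
have B2 : 0 < B0 ^+ 2 by exact: exprn_gt0.
have mZn i : measurable_fun setT (fun w => Zn w i 0).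
  exact: (measurable_wrt_measurable (@FM n.+1) (coord_measurable n.+1 mz i)).
have mchart k i : measurable_fun setT (fun w => chart_coord k w i 0).
  exact: (measurable_wrt_measurable (@FM k) (coord_measurable k (my k) i)).
have msl k := @mslack k k (leqnn k).
have mUL i : measurable_fun setT (fun w => (U w + c n.+1 *: innov L (e n.+1) w) i 0).
  have mU1 := measurable_wrt_measurable (@FM n) (mU i).
  have mL1 k := measurable_wrt_measurable (@FM n) (mL i k).
  have me1 k := measurable_wrt_measurable (@FM n.+1) (me n.+1 k).
  rewrite (_ : (fun w => _) = fun w => U w i 0 + c n.+1 *
      (e n.+1 w (lshift q i) 0 - \sum_j L w i j * e n.+1 w (rshift p j) 0)).
    apply: measurable_funD => //; apply: measurable_funM => //; apply: measurable_funB => //.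
    by apply: measurable_sum => j; apply: measurable_funM.
  apply/funext => w; rewrite /innov !mx_entry; congr (_ + _ * (_ - _)); rewrite mxE//.
  by apply: eq_bigr => j _; rewrite mxE.
(* [g1] is almost surely the new score on the surviving event; [g2] has the graph replaced by its
   linear part at the drifted point, and the old slack. *)
pose g1 w := potential S (B0 ^+ 2) (Zn w) + slack n.+1 w.
pose g2 w := potential S (B0 ^+ 2) (U w + c n.+1 *: innov L (e n.+1) w) + slack n w.
have stepE : \int[P]_(w in alive n.+1) score n.+1 w = \int[P]_(w in alive n.+1) g1 w.
  apply: ae_eq_Rintegral => //.
  - by apply: measurable_funD; [apply: mpot1; exact: mchart|exact: msl].
  - by apply: measurable_funD; [exact: mpot1|exact: msl].
  apply: filterS (rec n) => w h Aw; rewrite /score /g1 /chart_coord /Zn /z /drift.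
  by rewrite (h (AD _ (AA _ Aw))).
have pot_norm x w : `|potential S (B0 ^+ 2) (x w : 'cV[R]_p)| <= 1.
  by rewrite ger0_norm; [exact: (potential_le1 S B2) | exact: (ltW (potential_gt0 S B2 _))].
have ipot k (x : Omega -> 'cV[R]_p) : (t <= k)%N ->
    (forall i, measurable_fun setT (fun w => x w i 0)) ->
    P.-integrable (alive k) (EFin \o (fun w => potential S (B0 ^+ 2) (x w))).
  move=> tk mx; apply: (@intg_bounded _ _ _ _ _ (FM (alive_F tk)) _ 1).
    by apply: measurable_funTS; exact: mpot1.
  by move=> w _; exact: pot_norm.
have isl k : (t <= k)%N -> P.-integrable (alive k) (EFin \o slack k).
  move=> tk; apply: (@intg_bounded _ _ _ _ _ (FM (alive_F tk)) _ (kap / B0)).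
    by apply: measurable_funTS; exact: msl.
  by move=> w /(slack_bound tk)/andP[h1 h2]; rewrite ger0_norm.
have tn1 := leqW tn.
have ig1 : P.-integrable (alive n.+1) (EFin \o g1).
  exact: (intgD mA1 (ipot _ _ tn1 mZn) (isl _ tn1)).
have ig2 : P.-integrable (alive n) (EFin \o g2).
  exact: (intgD mA0 (ipot _ _ tn mUL) (isl _ tn)).
have key w : g1 w <= g2 w.
  pose v1 := V w; pose ce := c n.+1 *: dsubmx (e n.+1 w).
  pose cr := c n.+1 *: dsubmx (rr n.+1 w).
  pose d1 := phi n.+1 (v1 + (ce + cr)) - phi n.+1 (v1 + ce).
  pose d2 := phi n.+1 (v1 + ce) - phi n.+1 v1 - L w *m ce.
  pose zeta := c n.+1 *: usubmx (rr n.+1 w) - (d1 + d2).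
  have ZE : Zn w = (U w + c n.+1 *: innov L (e n.+1) w) + zeta.
    have uz : usubmx (z w) = usubmx (drift n w) +
        (c n.+1 *: usubmx (e n.+1 w) + c n.+1 *: usubmx (rr n.+1 w)).
      by apply/matrixP => i j; rewrite /z !(mxE, mulrDr).
    have dz : dsubmx (z w) = v1 + (ce + cr).
      by apply/matrixP => i j; rewrite /z /v1 /V /ce /cr !(mxE, mulrDr).
    rewrite /Zn uz dz.
    rewrite /zeta /d1 /d2 /U /innov -/v1 /ce -scalemxAr.
    by apply/matrixP => i j; rewrite !mx_entry; ring.
  have b1 : snorm S (c n.+1 *: usubmx (rr n.+1 w)) <= C * c n.+1 * `|rr n.+1 w|.
    rewrite snormZ (ger0_norm (c_ge0 n.+1)) (mulrC C) -mulrA; apply: (ler_wpM2l (c_ge0 _)).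
    exact: le_trans (SC _) (ler_wpM2l (ltW C0) (norm_usubmx_le _)).
  have b2 : snorm S d1 <= C * c n.+1 * `|rr n.+1 w|.
    apply: le_trans (lip _ _) _.
    have -> : v1 + (ce + cr) - (v1 + ce) = cr by rewrite opprD addrACA subrr add0r addrAC subrr add0r.
    apply: (le_trans (ler_piMl (snorm_ge0 T cr) del1)).
    rewrite /cr snormZ (ger0_norm (c_ge0 n.+1)) (mulrC C) -mulrA; apply: (ler_wpM2l (c_ge0 _)).
    exact: le_trans (TC _) (ler_wpM2l (ltW C0) (norm_dsubmx_le _)).
  have b3 : snorm S d2 <= K * (c n.+1 * snorm T (dsubmx (e n.+1 w))) `^ (1 + nu).
    have [_ h] := L0P v1; apply: le_trans (h ce) _.
    by rewrite /ce snormZ (ger0_norm (c_ge0 n.+1)) lexx.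
  have bz : snorm S zeta <= err n.+1 w.
    apply: le_trans (snormB _ _ _) _; apply: le_trans (lerD b1 (snormD _ _ _)) _.
    apply: le_trans (lerD (lexx _) (lerD b2 b3)) _.
    rewrite addrA /err lerD2r le_eqVlt; apply/orP; left; apply/eqP; ring.
  have sE : slack n.+1 w = slack n w - err n.+1 w / B0.
    have eE : err_sum n.+1 w = err_sum n w + err n.+1 w.
      rewrite /err_sum; exact: (@big_nat_recr _ _ _ n.+1 t.+1 (fun k => err k w) tn).
    by rewrite /slack eE opprD addrA mulrBl.
  have pl := potential_lip S (U w + c n.+1 *: innov L (e n.+1) w) zeta B00.
  have iB0 : 0 <= B0^-1 by rewrite invr_ge0 (ltW B00).
  have bz' := ler_wpM2r iB0 bz.
  rewrite /g1 /g2 ZE sE; have := le_trans pl (lerD (lexx _) bz').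
  move: (slack n w) (err n.+1 w / B0) (potential S _ (_ + zeta)) => s1 s2 s3.
  by move: (potential S _ _) => s4 h; rewrite addrCA [leRHS]addrC lerD2l lerBlDr.
rewrite stepE.
have h1 : \int[P]_(w in alive n.+1) g1 w <= \int[P]_(w in alive n.+1) g2 w.
  exact: (le_Rintegral mA1 ig1 (integrableS mA0 mA1 AA ig2) (fun w _ => key w)).
apply: le_trans h1 _.
have h2 : \int[P]_(w in alive n.+1) g2 w <= \int[P]_(w in alive n) g2 w.
  apply: (Rintegral_subset mA1 mA0 AA ig2) => w /(slack_bound tn)/andP[h _].
  exact: (addr_ge0 (ltW (potential_gt0 S B2 _)) h).
apply: le_trans h2 _.
rewrite (RintegralD mA0 (ipot _ _ tn mUL) (isl _ tn)).
have Ldel w h : snorm S (L w *m h) <= del * snorm T h by have [h' _] := L0P (V w); exact: h'.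
have me1 i : measurable_fun setT (fun w => e n.+1 w i 0).
  exact: (measurable_wrt_measurable (@FM n.+1) (me n.+1 i)).
have ie1 : P.-integrable (alive n) (EFin \o (fun w => `|e n.+1 w| `^ a)).
  exact: (integrableS (FM (FD n)) mA0 AD (ie n)).
have one := @one_step R disp Omega P (F n) (sF n) (@FM n) p q mp mq S T del C a (ltW C0)
  del0 del1 a2 SC TC (alive n) FA0 U L (e n.+1) mU mL Ldel me1 bl Ba ie1
  (fun B FB BA => H1 FB (subset_trans BA AD)) (H2 FA0 AD)
  (fun B FB BA => H3 FB (subset_trans BA AD)) (B0 ^+ 2) (c n.+1) M B2 M0 hdel hM (hs tnm).
apply: le_trans (lerD one (lexx _)) _.
have mU' i := measurable_wrt_measurable (@FM n) (mU i).
have h3 : \int[P]_(w in alive n) potential S (B0 ^+ 2) (U w) <=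
    \int[P]_(w in alive n) potential S (B0 ^+ 2) (chart_coord n w).
  apply: (le_Rintegral mA0 (ipot _ _ tn mU') (ipot _ _ tn (mchart n))).
  move=> w Aw; have := phi_step tnm (y n w); rewrite -/(drift n w) => hw.
  exact: (potential_mono B2 hw).
have h4 : \int[P]_(w in alive n) score n w =
    \int[P]_(w in alive n) potential S (B0 ^+ 2) (chart_coord n w) +
    \int[P]_(w in alive n) slack n w.
  exact: (RintegralD mA0 (ipot _ _ tn (mchart n)) (isl _ tn)).
have K1B1 : 0 < K1 * B1.
  exact: mulr_gt0 (mulr_gt0 (ltr0Sn R 3) (exprn_gt0 2 C0)) (ltr_pwDl ltr01 Ba0).
have q0 : 0 <= qn n.
  rewrite /qn -mulrA; apply: mulr_ge0 (ltW K1B1).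
  exact: mulr_ge0 (ler0n R 10) (divr_ge0 (sqr_ge0 _) (sqr_ge0 _)).
have q1 : qn n <= 1 by exact: hs1.
have pA0 : fine (P (alive n)) <= fine (P A).
  by apply: (fine_prob_le P mA0 (FM FA)) => w [].
have sl1 : \int[P]_(w in alive n) slack n w <= kap / B0 * fine (P A).
  apply: (@le_trans _ _ (\int[P]_(w in alive n) (kap / B0))).
    apply: (le_Rintegral mA0 (isl _ tn) (intg_cst P mA0 (kap / B0))) => w.
    by move=> /(slack_bound tn)/andP[_ h].
  by rewrite (Rintegral_cst _ mA0); exact: (ler_wpM2l (divr_ge0 kap0 (ltW B00)) pA0).
(* [th] is the share of the rate [qn] represented by the surviving gain:
   [10 K1 B1 - bl / 4 = 10 K1 B1 (1 - th)]. *)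
pose th := bl / (40 * K1 * B1).
have th1 : 0 <= 1 - th.
  have K40 : 0 < 40 * K1 * B1 by rewrite -mulrA; exact: mulr_gt0 (ltr0Sn R 39) K1B1.
  by rewrite subr_ge0 /th (ler_pdivrMr _ _ K40) mul1r.
have thE : (10 * K1 * B1 - bl / 4) * s n = qn n * (1 - th).
  rewrite /qn /th; move: (s n) => sn; field.
  by have := lt0r_neq0 K1B1; rewrite mulf_eq0 negb_or andbC.
rewrite h4 -/(s n) -/K1 -/B1 thE -/th -/(qn n).
exact: (step_arith q0 q1 th1 h3 pA0 sl1).
Qed.
Let th := bl / (40 * K1 * B1).

(** A Markov inequality: on [G] the final score is at least [1 / (1 + eta)], while on [A] the
    initial one is at most [1 + kap / B0]. *)
Lemma stay_bound G eta : (t <= m)%N -> measurable G -> G `<=` alive m -> 0 <= eta ->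
  (forall w, G w -> snorm S (chart_coord m w) ^+ 2 <= eta * B0 ^+ 2) ->
  fine (P G) / (1 + eta) <=
  fine (P A) * ((1 - th + kap / B0) + th / (1 + \sum_(t <= k < m) qn k)).
Proof.
move=> tm mG GA eta0 hG.
have K1B1 : 0 < K1 * B1.
  exact: mulr_gt0 (mulr_gt0 (ltr0Sn R 3) (exprn_gt0 2 C0)) (ltr_pwDl ltr01 Ba0).
have th0 : 0 <= th.
  by apply: divr_ge0 bl0 _; rewrite -mulrA; exact: mulr_ge0 (ler0n R 40) (ltW K1B1).
have q0 k : 0 <= qn k.
  rewrite /qn -mulrA; apply: mulr_ge0 (ltW K1B1).
  exact: mulr_ge0 (ler0n R 10) (divr_ge0 (sqr_ge0 _) (sqr_ge0 _)).
have pA0 : 0 <= fine (P A) by exact: fine_ge0.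
have B2 : 0 < B0 ^+ 2 by exact: exprn_gt0.
have mA n : (t <= n)%N -> measurable (alive n) by move=> tn; exact: (FM (alive_F tn)).
have kB0 : 0 <= kap / B0 by exact: (divr_ge0 kap0 (ltW B00)).
have mscore n : measurable_fun setT (score n).
  apply: measurable_funD; last exact: (@mslack n n (leqnn n)).
  apply: potential_measurable => // i.
  exact: (measurable_wrt_measurable (@FM n) (coord_measurable n (my n) i)).
have score_ge n w : (t <= n)%N -> alive n w -> potential S (B0 ^+ 2) (chart_coord n w) <= score n w.
  by move=> tn /(slack_bound tn)/andP[h _]; rewrite lerDl.
have score_le n w : (t <= n)%N -> alive n w -> score n w <= 1 + kap / B0.
  by move=> tn /(slack_bound tn)/andP[_ h]; exact: (lerD (potential_le1 S B2 _) h).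
have score0 n w : (t <= n)%N -> alive n w -> 0 <= score n w.
  by move=> tn Aw; exact: (le_trans (ltW (potential_gt0 S B2 _)) (score_ge _ _ tn Aw)).
have iscore n : (t <= n)%N -> P.-integrable (alive n) (EFin \o score n).
  move=> tn; apply: (@intg_bounded _ _ _ _ _ (mA n tn) _ (1 + kap / B0)).
    exact: measurable_funTS (mscore n).
  by move=> w Aw; rewrite ger0_norm; [exact: score_le|exact: score0].
have start : \int[P]_(w in alive t) score t w <= fine (P A) * (1 + kap / B0).
  have mt := mA t (leqnn t).
  apply: (@le_trans _ _ (\int[P]_(w in alive t) (1 + kap / B0))).
    apply: (le_Rintegral mt (iscore _ (leqnn t)) (intg_cst P mt _)) => w Aw.
    exact: (score_le _ _ (leqnn t) Aw).
  rewrite (Rintegral_cst _ mt) mulrC; apply: ler_wpM2r; first exact: (addr_ge0 ler01 kB0).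
  by apply: (fine_prob_le P mt (FM FA)) => w [].
have step n : (t <= n < m)%N -> qn n <= 1 /\ \int[P]_(w in alive n.+1) score n.+1 w <=
    (1 - qn n) * \int[P]_(w in alive n) score n w + qn n * ((1 - th) + kap / B0) * fine (P A).
  by move=> tnm; split; [exact: hs1|exact: (score_step tnm)].
have tmm : (t <= m <= m)%N by rewrite tm leqnn.
apply: le_trans (recursion_bound th0 pA0 q0 start step tmm).
apply: (@le_trans _ _ (\int[P]_(w in G) score m w)); last first.
  exact: (Rintegral_subset mG (mA m tm) GA (iscore m tm) (fun w => @score0 m w tm)).
have -> : fine (P G) / (1 + eta) = \int[P]_(w in G) (1 + eta)^-1.
  by rewrite (Rintegral_cst _ mG) mulrC.
apply: (le_Rintegral mG (intg_cst P mG _) (integrableS (mA m tm) mG GA (iscore m tm))) => w Gw.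
apply: le_trans (score_ge _ _ tm (GA _ Gw)).
have x0 : 0 <= snorm S (chart_coord m w) ^+ 2 / B0 ^+ 2 by exact: (divr_ge0 (sqr_ge0 _) (ltW B2)).
have xe : snorm S (chart_coord m w) ^+ 2 / B0 ^+ 2 <= eta by rewrite (ler_pdivrMr _ _ B2); exact: hG.
rewrite /potential; move: (_ / _) x0 xe => x x0 xe.
by rewrite lef_pV2 ?posrE ?ltr_wpDr// lerD2l.
Qed.
End Recursion.

(** * Trapping events *)

Section Approximation.
Variables (R : realType) (disp : measure_display) (Omega : measurableType disp).
Variable P : probability Omega R.
Implicit Types A B E : set Omega.

Lemma fine_prob_setU A B : measurable A -> measurable B ->
  fine (P (A `|` B)) <= fine (P A) + fine (P B).
Proof.
move=> mA mB; rewrite -fineD ?fin_num_measure// fine_le ?fin_num_measure//.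
- exact: measurableU.
- by rewrite fin_numD !fin_num_measure.
- exact: measureU2.
Qed.

Lemma fine_prob_ge0 A : 0 <= fine (P A). Proof. exact: fine_ge0. Qed.

Definition mismatch A B := (A `\` B) `|` (B `\` A).

Lemma measurable_mismatch A B : measurable A -> measurable B -> measurable (mismatch A B).
Proof. by move=> mA mB; apply: measurableU; exact: measurableD. Qed.

Variables (F : nat -> set (set Omega)) (fF : filtration F).

Let sF n : sigma_algebra setT (F n). Proof. by case: fF. Qed.
Let FM n : F n `<=` measurable. Proof. by case: fF. Qed.
Let Fle m n : (m <= n)%N -> F m `<=` F n. Proof. by case: fF => _ _; exact. Qed.

(** These events form a sigma-algebra containing every [F n]: an elementary substitute for Lévy's
    zero-one law. *)
Definition approximable E := measurable E /\
  forall d, 0 < d -> exists n, exists2 A, F n A & fine (P (mismatch E A)) < d.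

Lemma approximable_setU E1 E2 : approximable E1 -> approximable E2 -> approximable (E1 `|` E2).
Proof.
move=> [m1 h1] [m2 h2]; split=> [|d d0]; first exact: measurableU.
have d2 : 0 < d / 2 by rewrite divr_gt0.
have [n1 [A1 FA1 l1]] := h1 _ d2; have [n2 [A2 FA2 l2]] := h2 _ d2.
exists (maxn n1 n2), (A1 `|` A2).
  by apply: (sigma_setU (sF _)); [apply: Fle FA1|apply: Fle FA2]; rewrite ?leq_maxl ?leq_maxr.
have mA1 := FM FA1; have mA2 := FM FA2.
rewrite (splitr d); apply: le_lt_trans (ltrD l1 l2).
have mm1 := measurable_mismatch m1 mA1; have mm2 := measurable_mismatch m2 mA2.
apply: le_trans (fine_prob_setU mm1 mm2); apply: fine_prob_le.
- by apply: measurable_mismatch; exact: measurableU.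
- exact: measurableU.
- move=> w; rewrite /mismatch /=; tauto.
Qed.

(** The union is cut to a finite one, at a cost [d / 2] by continuity from below, and the finite
    union is approximated within [d / 2]. *)
Lemma approximable_bigcup (E : nat -> set Omega) : (forall i, approximable (E i)) ->
  approximable (\bigcup_i E i).
Proof.
move=> h; pose U n := \big[setU/set0]_(i < n.+1) E i.
have aU n : approximable (U n).
  rewrite /U; elim: n => [|n IH]; first by rewrite big_ord1.
  by rewrite big_ord_recr/=; exact: approximable_setU.
have mE : measurable (\bigcup_i E i) by apply: bigcup_measurable => i _; case: (h i).
split=> // d d0; have d2 : 0 < d / 2 by rewrite divr_gt0.
have UE : \bigcup_n U n = \bigcup_i E i.
  exact: bigcup_bigsetU_bigcup.
have mU n : measurable (U n) by case: (aU n).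
have cU : (P \o U) n @[n --> \oo] --> P (\bigcup_i E i).
  rewrite -UE; apply: nondecreasing_cvg_mu => //; first by rewrite UE.
  apply/nondecreasing_seqP => n; apply/subsetPset => w.
  by rewrite /U [X in _ -> X w]big_ord_recr; left.
have [n hn] : exists n, fine (P (\bigcup_i E i)) - d / 2 < fine (P (U n)).
  have /fine_cvgP[_ /cvgrPdist_lt /(_ _ d2)] : (P \o U) n @[n --> \oo] --> (fine (P (\bigcup_i E i)))%:E.
    by rewrite fineK ?fin_num_measure.
  move=> [n _ hn]; exists n; have := hn n (leqnn n); rewrite ltr_norml /= => /andP[_].
  by rewrite ltrBlDr addrC -ltrBlDr.
have [k [A FA lA]] := (aU n).2 _ d2; exists k, A => //.
have mA := FM FA.
have sub : U n `<=` \bigcup_i E i by rewrite -UE; exact: bigcup_sup.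
have mD : measurable ((\bigcup_i E i) `\` U n) by exact: measurableD.
have mm := measurable_mismatch (mU n) mA.
apply: (@le_lt_trans _ _ (fine (P ((\bigcup_i E i) `\` U n)) + fine (P (mismatch (U n) A)))).
  apply: le_trans (fine_prob_setU mD mm); apply: fine_prob_le.
  - exact: measurable_mismatch.
  - exact: measurableU.
  - move=> w; rewrite /mismatch /= => -[[Ew nA]|[Aw nE]]; last by right; right; split=> // /sub.
    by case: (pselect (U n w)) => ?; [right; left|left].
have -> : fine (P ((\bigcup_i E i) `\` U n)) = fine (P (\bigcup_i E i)) - fine (P (U n)).
  rewrite measureD//; last by rewrite ltey_eq fin_num_measure.
  by rewrite setIidr// fineB ?fin_num_measure.
by move: hn lA; move: (fine _) (fine _) (fine _) => *; lra.
Qed.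

Lemma approximable_sigma E : <<s \bigcup_n F n >> E -> approximable E.
Proof.
apply: smallest_sub; last first.
  move=> A [n _ FA]; split; first exact: FM FA.
  by move=> d d0; exists n, A => //; rewrite /mismatch setDv setU0 measure0.
split=> [|A [mA h]|]; last exact: approximable_bigcup.
  split=> // d d0; exists 0%N, set0; first by case: (sF 0).
  by rewrite /mismatch setDv setU0 measure0.
split=> [|d d0]; first by rewrite setTD; exact: measurableC.
have [n [B FB lB]] := h _ d0; exists n, (~` B); first exact: (sigma_setC (sF n) FB).
suff -> : mismatch (setT `\` A) (~` B) = mismatch A B by [].
apply/seteqP; split => w; rewrite /mismatch /=; case: (pselect (A w)); case: (pselect (B w)); tauto.
Qed.

(* Otherwise [E] would be well approximated by events [A] of some [F t] on which
   [P (A `&` E)] is nearly [P A], contradicting the uniform gap. *)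
Lemma no_density_gap E p0 t0 : <<s \bigcup_n F n >> E -> 0 < p0 ->
  (forall t A, (t0 <= t)%N -> F t A -> fine (P (A `&` E)) <= (1 - p0) * fine (P A)) ->
  P E = 0%E.
Proof.
move=> /approximable_sigma[mE aE] p00 gap.
suff : fine (P E) <= 0.
  by move=> h; rewrite -[P E]fineK ?fin_num_measure//; congr _%:E; apply/eqP; rewrite eq_le h fine_prob_ge0.
rewrite leNgt; apply/negP => pE.
have [p1|p1] := ltP 1 p0.
  have := gap t0 setT (leqnn _); rewrite setTI probability_setT/= mulr1 => h.
  have := h (sigma_setT (sF t0)); lra.
(* The mismatch enters twice, in passing from [P E] to [P (A & E)] and from [P A] to [P E]; two
   thirds of the gap are lost and one third contradicts. *)
have d0 : 0 < p0 * fine (P E) / 3 by rewrite divr_gt0// mulr_gt0.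
have [n [A FA lA]] := aE _ d0; have mA := FM FA.
have g := gap (maxn t0 n) A (leq_maxl _ _) (Fle (leq_maxr _ _) FA).
have mm := measurable_mismatch mE mA; have mAE := measurableI _ _ mA mE.
have h1 : fine (P E) <= fine (P (A `&` E)) + fine (P (mismatch E A)).
  apply: le_trans (fine_prob_setU mAE mm); apply: fine_prob_le => //; first exact: measurableU.
  by move=> w Ew; rewrite /mismatch /=; case: (pselect (A w)); tauto.
have h2 : fine (P A) <= fine (P E) + fine (P (mismatch E A)).
  apply: le_trans (fine_prob_setU mE mm); apply: fine_prob_le => //; first exact: measurableU.
  by move=> w Ew; rewrite /mismatch /=; case: (pselect (E w)); tauto.
have p2 : 0 <= 1 - p0 by rewrite subr_ge0.
have := ler_wpM2l p2 h2; move: g h1 lA.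
move: (fine (P E)) (fine (P A)) (fine (P (A `&` E))) (fine (P (mismatch E A))) pE => x y z e x0.
nra.
Qed.

End Approximation.

(** * Tails of convergent series and the scale [alpha] *)

Section Tails.
Variables (R : realType) (u : nat -> R) (u0 : forall n, 0 <= u n) (fu : finite_sum u).

Lemma tail_sum_fin t : (\sum_(t.+1 <= n <oo) (u n)%:E)%E \is a fin_num.
Proof.
have h0 (k : nat) : (0 <= k)%N -> (0 <= (u k)%:E)%E by rewrite lee_fin.
have ge : (0 <= \sum_(t.+1 <= n <oo) (u n)%:E)%E.
  by apply: nneseries_ge0 => n _ _; rewrite lee_fin.
rewrite ge0_fin_numE//; move: fu; rewrite /finite_sum (nneseries_split 0 t.+1 h0) add0n.
apply: le_lt_trans; apply: leeDr.
by rewrite sumEFin lee_fin sumr_ge0.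
Qed.

Lemma partial_cvg_tail t : \sum_(t.+1 <= k < m) u k @[m --> \oo] --> tail_sum u t.
Proof.
have h0 (k : nat) : (t.+1 <= k)%N -> xpredT k -> (0 <= (u k)%:E)%E by rewrite lee_fin.
have := @is_cvg_nneseries _ (fun k => (u k)%:E) xpredT t.+1 h0.
move=> /cvg_ex[l hl].
have e : l = (\sum_(t.+1 <= n <oo) (u n)%:E)%E by apply/esym/cvg_lim.
rewrite e -(fineK (tail_sum_fin t)) in hl; move: hl => /fine_cvgP[_].
apply: cvg_trans; apply: near_eq_cvg; near=> m.
by rewrite /= sumEFin.
Unshelve. all: by end_near.
Qed.

Lemma partial_le_tail t m : \sum_(t.+1 <= k < m) u k <= tail_sum u t.
Proof.
have h0 (k : nat) : (t.+1 <= k)%N -> xpredT k -> (0 <= (u k)%:E)%E by rewrite lee_fin.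
have := @nneseries_lim_ge _ _ _ _ m h0; rewrite sumEFin -(fineK (tail_sum_fin t)).
by rewrite lee_fin.
Qed.

Lemma le_tail_sum t k : (t < k)%N -> u k <= tail_sum u t.
Proof.
move=> tk; apply: le_trans (partial_le_tail t k.+1).
by rewrite big_nat_recr//= lerDr sumr_ge0.
Qed.

Lemma tail_sum_cvg0 : tail_sum u t @[t --> \oo] --> 0.
Proof.
have h0 (k : nat) : xpredT k -> (0 <= (u k)%:E)%E by rewrite lee_fin.
have h := @nneseries_tail_cvg R (fun k => (u k)%:E) xpredT fu h0.
have /fine_cvgP[_ h'] := h.
by move: h'; rewrite -cvg_shiftS.
Qed.

Lemma cvg_finite_sum : u n @[n --> \oo] --> 0.
Proof.
rewrite -cvg_shiftS; apply: (squeeze_cvgr _ (cvg_cst 0) tail_sum_cvg0).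
by near=> n; rewrite u0 le_tail_sum.
Unshelve. all: by end_near.
Qed.

End Tails.

Section Alpha.
Variables (R : realType) (c : nat -> R).
Variables (c_neq0 : forall m, exists2 n, (m <= n)%N & c n != 0).
Variables (c_sum : finite_sum (fun n => c n ^+ 2)).

Lemma tail_sum_sqr_gt0 t : 0 < tail_sum (fun n => c n ^+ 2) t.
Proof.
have [n tn cn] := c_neq0 t.+1.
by apply: lt_le_trans (le_tail_sum (fun k => sqr_ge0 (c k)) c_sum tn); rewrite exprn_even_gt0.
Qed.

Lemma alpha_gt0 t : 0 < alpha c t. Proof. by rewrite sqrtr_gt0 tail_sum_sqr_gt0. Qed.

Lemma sqr_alpha t : alpha c t ^+ 2 = tail_sum (fun n => c n ^+ 2) t.
Proof. by rewrite sqr_sqrtr// ltW// tail_sum_sqr_gt0. Qed.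

Lemma sqr_le_alpha t k : (t < k)%N -> c k ^+ 2 <= alpha c t ^+ 2.
Proof. by move=> tk; rewrite sqr_alpha; exact: (le_tail_sum (fun k => sqr_ge0 (c k))). Qed.

(** Some finite horizon collects half of the remaining squares. This amount of noise, in units of
    [alpha(t)^2], makes the gap independent of [t]. *)
Lemma alpha_half t : exists m1, forall m, (m1 <= m)%N ->
  alpha c t ^+ 2 / 2 <= \sum_(t.+1 <= k < m) c k ^+ 2.
Proof.
have h := @partial_cvg_tail R _ (fun k => sqr_ge0 (c k)) c_sum t.
have p := tail_sum_sqr_gt0 t; rewrite sqr_alpha.
have p2 : 0 < tail_sum (fun n => c n ^+ 2) t / 2 by rewrite divr_gt0.
have [m1 _ hm] := (cvgrPdist_lt _ _).1 h _ p2.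
exists m1 => m /hm /=; rewrite ltr_norml => /andP[_]; lra.
Qed.

End Alpha.

(** [th / (1 + s0) = th - p1], so the bracket is at most [1 - 3/4 p1], and its product with
    [1 + p1 / 4] stays below [1 - p1 / 2]. The two quarters of [p1] are the prices of the error
    budget and of stopping close to 0 rather than at 0. *)
Lemma gap_arith (R : realType) (th s0 s x pA : R) : 0 < th -> th <= 1 -> 0 < s0 -> s0 <= s ->
  0 <= pA -> let p1 := th * s0 / (1 + s0) in
  x / (1 + p1 / 4) <= pA * ((1 - th + p1 / 4) + th / (1 + s)) -> x <= (1 - p1 / 2) * pA.
Proof.
move=> th0 th1 s00 ss pA0 p1 h.
have s1 : 0 < 1 + s0 by rewrite addr_gt0.
have p10 : 0 < p1 by rewrite divr_gt0// mulr_gt0.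
have p1E : th / (1 + s0) = th - p1 by rewrite /p1; field; rewrite gt_eqF.
have le : th / (1 + s) <= th - p1.
  rewrite -p1E ler_wpM2l//; first exact: ltW.
  by rewrite lef_pV2 ?posrE ?lerD2l//; apply: lt_le_trans s1 _; rewrite lerD2l.
have q0 : 0 < 1 + p1 / 4 by rewrite addr_gt0// divr_gt0.
move: h; rewrite ler_pdivrMr// => h; apply: le_trans h _.
have h2 : pA * ((1 - th + p1 / 4) + th / (1 + s)) <= pA * (1 - 3 / 4 * p1).
  by rewrite ler_wpM2l//; lra.
apply: le_trans (ler_wpM2r (ltW q0) h2) _.
have : 0 <= pA * p1 ^+ 2 by rewrite mulr_ge0// sqr_ge0.
by rewrite expr2; move: p1 {h2 le p1E p10 q0} => p1; nra.
Qed.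

(** * Trapping is impossible under uniform conditional bounds *)

Section Core.
Variables (R : realType) (disp : measure_display) (Omega : measurableType disp).
Variable P : probability Omega R.
Variables (F : nat -> set (set Omega)) (fF : filtration F).
Variables (p q mp mq : nat) (S : 'M[R]_(mp, p)) (T : 'M[R]_(mq, q)).
Variables (del nu K C a : R).
Hypotheses (C0 : 0 < C) (del0 : 0 <= del) (del1 : del <= 1) (a2 : 2 < a).
Hypotheses (nu0 : 0 < nu) (K0 : 0 <= K).
Hypothesis SC : forall u : 'cV[R]_p, snorm S u <= C * `|u|.
Hypothesis SC' : forall u : 'cV[R]_p, `|u| <= C * snorm S u.
Hypothesis TC : forall v : 'cV[R]_q, snorm T v <= C * `|v|.
Variables (y e rr : nat -> Omega -> 'cV[R]_(p + q)).
Hypotheses (my : adapted F y) (me : adapted F e) (mrr : adapted F rr).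
Variables (Ft : 'cV[R]_(p + q) -> 'cV[R]_(p + q)) (kF : R).
Hypothesis FtL : forall z z', `|Ft z - Ft z'| <= kF * `|z - z'|.
Variables (c gamma : nat -> R) (c_ge0 : forall n, 0 <= c n).
Hypothesis c_neq0 : forall m, exists2 n, (m <= n)%N & c n != 0.
Hypothesis c_sum : finite_sum (fun n => c n ^+ 2).
Variable n0 : nat.
Hypothesis charts : chart_family S T del nu K Ft gamma n0.
Variables (D : nat -> set Omega) (FD : forall n, F n (D n)).
Hypothesis rec : forall n, {ae P, forall w, D n w ->
  y n.+1 w = y n w + gamma n.+1 *: Ft (y n w) + c n.+1 *: (e n.+1 w + rr n.+1 w)}.
Variables (bl Ba : R).
Hypotheses (bl0 : 0 < bl) (Ba0 : 0 <= Ba).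
Hypothesis ie : forall n, P.-integrable (D n) (EFin \o (fun w => `|e n.+1 w| `^ a)).
Hypothesis H1 : forall n B, F n B -> B `<=` D n ->
  \int[P]_(w in B) (`|e n.+1 w| `^ a) <= Ba * fine (P B).
Hypothesis H2 : forall n B, F n B -> B `<=` D n ->
  bl * fine (P B) <= \int[P]_(w in B) (snorm S (usubmx (e n.+1 w)) ^+ 2).
Hypothesis H3 : forall n B, F n B -> B `<=` D n ->
  forall i, \int[P]_(w in B) e n.+1 w i 0 = 0.
Let K1 := 4 * C ^+ 2.
Let B1 := 1 + Ba.
Hypothesis hdel : (del * C) ^+ 2 * B1 <= bl / 8.
Hypothesis hbl : bl <= 40 * K1 * B1.

Let FM n : F n `<=` measurable. Proof. by case: fF. Qed.
Let sF n : sigma_algebra setT (F n). Proof. by case: fF. Qed.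

Let K1B1 : 0 < K1 * B1.
Proof. exact: mulr_gt0 (mulr_gt0 (ltr0Sn R 3) (exprn_gt0 2 C0)) (ltr_pwDl ltr01 Ba0). Qed.

(** [2 - a] is negative, so [M ^ (2 - a)] can be made small; the witness makes it [x^-1]. *)
Let exists_M : exists2 M, 0 < M & 4 * K1 * M `^ (2 - a) * Ba <= bl / 16.
Proof.
pose x := 64 * K1 * Ba / bl + 1.
have x1 : 1 <= x by rewrite lerDr divr_ge0 ?(ltW bl0)// !mulr_ge0// ltW.
have x0 : 0 < x by apply: lt_le_trans x1.
exists (x `^ ((a - 2)^-1)); first by rewrite powR_gt0.
rewrite -powRrM (_ : (a - 2)^-1 * (2 - a) = -1); last first.
  by field; rewrite subr_eq0; apply/eqP => h; move: a2; rewrite h ltxx.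
rewrite powR_inv1; last exact: ltW.
have : 64 * K1 * Ba / bl <= x by rewrite lerDl.
rewrite ler_pdivrMr// => h.
rewrite mulrAC ler_pdivrMr//; lra.
Qed.

Let th := bl / (40 * K1 * B1).

(* [kappa] may depend on everything but the trapping event [E] and its start [t0]. *)
Lemma trapped_null : exists2 kappa : R, 0 < kappa & forall (E : set Omega) (t0 : nat),
  <<s \bigcup_n F n >> E ->
  (forall w, E w -> [/\ forall n, (t0 <= n)%N -> D n w,
     forall t n, (t0 <= t)%N -> \sum_(t.+1 <= k < n.+1) err T nu K C e rr c k w <= kappa * alpha c t
   & y n w @[n --> \oo] --> (0 : 'cV[R]_(p + q))]) -> P E = 0%E.
Proof.
have [M M0 hM] := exists_M.
have M2 : 0 < K1 ^+ 2 * M ^+ 2 * B1.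
  apply: mulr_gt0; last exact: (ltr_pwDl ltr01 Ba0).
  by apply: mulr_gt0 (exprn_gt0 _ _) (exprn_gt0 _ M0); exact: mulr_gt0 (ltr0Sn R 3) (exprn_gt0 2 C0).
(* The potential will have the scale [B0 ^+ 2 = Kc * alpha c t ^+ 2]. As
   [c n ^+ 2 <= alpha c t ^+ 2] for [n > t], every [s n] is at most [Kc^-1]; the first summand then
   gives the smallness [hs], the second [hs1]. *)
pose Kc := 32 * (K1 ^+ 2 * M ^+ 2 * B1) / bl + 10 * (K1 * B1).
have Kc1 : 0 < 32 * (K1 ^+ 2 * M ^+ 2 * B1) / bl by exact: (divr_gt0 (mulr_gt0 (ltr0Sn R 31) M2) bl0).
have Kc2 : 0 < 10 * (K1 * B1) by exact: (mulr_gt0 (ltr0Sn R 9) K1B1).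
have Kc0 : 0 < Kc by exact: addr_gt0.
have sKc : 0 < Num.sqrt Kc by rewrite sqrtr_gt0.
have K40 : 0 < 40 * K1 * B1 by rewrite -mulrA; exact: mulr_gt0 (ltr0Sn R 39) K1B1.
have th0 : 0 < th by exact: (divr_gt0 bl0 K40).
have th1 : th <= 1 by rewrite /th (ler_pdivrMr _ _ K40) mul1r.
(* Lower bound on the sum of the rates [10 * s n * K1 * B1] up to a far horizon: half of
   [10 * (K1 * B1) / Kc], by [alpha_half]. *)
pose s0 := 5 * (K1 * B1) / Kc.
have s00 : 0 < s0 by exact: (divr_gt0 (mulr_gt0 (ltr0Sn R 4) K1B1) Kc0).
pose p1 := th * s0 / (1 + s0).
have p10 : 0 < p1 by exact: (divr_gt0 (mulr_gt0 th0 s00) (addr_gt0 ltr01 s00)).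
exists (p1 / 4 * Num.sqrt Kc); first by exact: (mulr_gt0 (divr_gt0 p10 (ltr0Sn R 3)) sKc).
move=> E t0 sE hE.
have mE : measurable E.
  suff : <<s \bigcup_n F n >> `<=` measurable by exact.
  apply: smallest_sub; first exact: sigma_algebra_measurable.
  by move=> B [n _]; exact: FM.
apply: (@no_density_gap _ _ _ P _ fF E (p1 / 2) (maxn t0 n0) sE); first exact: (divr_gt0 p10).
move=> t A; rewrite geq_max => /andP[tt0 tn0] FA.
have al0 : 0 < alpha c t by exact: alpha_gt0.
pose B0 := Num.sqrt Kc * alpha c t.
have B00 : 0 < B0 by exact: mulr_gt0.
have B2E : B0 ^+ 2 = Kc * alpha c t ^+ 2 by rewrite /B0 exprMn sqr_sqrtr// ltW.
have al2 : 0 < alpha c t ^+ 2 by exact: exprn_gt0.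
have s_le n : (t <= n)%N -> c n.+1 ^+ 2 / B0 ^+ 2 <= Kc^-1.
  move=> tn; rewrite B2E invfM mulrCA -[leRHS]mulr1; apply: ler_wpM2l.
    by rewrite invr_ge0 ltW.
  by rewrite (ler_pdivrMr _ _ al2) mul1r; exact: sqr_le_alpha.
have [m1 hm1] := alpha_half c_neq0 c_sum t.
(* All times from [m] on, not [m] alone: these events increase with [m], so the bound at each
   horizon passes to their union by continuity from below. *)
pose near0 m := [set w | forall n, (m <= n)%N -> snorm S (usubmx (y n w)) ^+ 2 <= p1 / 4 * B0 ^+ 2].
have mnear0 m : measurable (near0 m).
  rewrite (_ : near0 m = \bigcap_n [set w | (m <= n)%N ->
      snorm S (usubmx (y n w)) ^+ 2 <= p1 / 4 * B0 ^+ 2]); last first.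
    apply/seteqP; split => w h n; [by move=> _; exact: h|exact: h].
  apply: bigcapT_measurable => n; have [mn|mn] := leqP m n; last first.
    by rewrite (_ : [set _ | _] = setT)//; apply/seteqP; split => w //= h.
  have ms : measurable_fun setT (fun w => snorm S (usubmx (y n w)) ^+ 2).
    apply: (sqr_snorm_measurable S) => i.
    rewrite (_ : (fun w => _) = fun w => y n w (lshift q i) 0); last by apply/funext => w; rewrite mxE.
    exact: (measurable_wrt_measurable (@FM n) (my n _)).
  have := ms measurableT `]-oo, (p1 / 4 * B0 ^+ 2)]%classic (measurable_itv _); rewrite setTI.
  congr (measurable _); apply/seteqP; split => w /=; rewrite in_itv/=; [by move=> ? _|exact].
pose Gm m := A `&` E `&` near0 m.
have mAE : measurable (A `&` E) by exact: measurableI (FM FA) mE.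
have mG m : measurable (Gm m) by exact: measurableI.
have gapm m : (maxn t.+1 m1 <= m)%N -> fine (P (Gm m)) <= (1 - p1 / 2) * fine (P A).
  rewrite geq_max => /andP[tm1 mm1].
  have tm : (t <= m)%N by exact: ltnW.
  have [phi [phim phi_good phi_step]] := charts m.
  have phi_step' n : (t <= n < m)%N -> forall z,
      snorm S (usubmx z - phi n (dsubmx z)) <=
      snorm S (usubmx (z + gamma n.+1 *: Ft z) - phi n.+1 (dsubmx (z + gamma n.+1 *: Ft z))).
    by move=> /andP[tn nm]; apply: phi_step; rewrite (leq_trans tn0 tn).
  have pA0 := fine_prob_ge0 P A.
  apply: (@gap_arith _ th s0 (\sum_(t <= k < m) 10 * (c k.+1 ^+ 2 / B0 ^+ 2) * K1 * B1)) => //.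
    rewrite (eq_bigr (fun k => 10 * (K1 * B1) / B0 ^+ 2 * c k.+1 ^+ 2)); last first.
      by move=> k _; ring.
    rewrite -mulr_sumr.
    have -> : \sum_(t <= k < m) c k.+1 ^+ 2 = \sum_(t.+1 <= k < m.+1) c k ^+ 2.
      by rewrite big_add1.
    have h := hm1 _ (leqW mm1).
    have -> : s0 = 10 * (K1 * B1) / B0 ^+ 2 * (alpha c t ^+ 2 / 2).
      by rewrite /s0 B2E; field; rewrite (gt_eqF al0) (gt_eqF Kc0).
    by apply: ler_wpM2l h; exact: (divr_ge0 (ltW Kc2) (sqr_ge0 _)).
  have kapE : p1 / 4 * Num.sqrt Kc * alpha c t / B0 = p1 / 4.
    by rewrite /B0; field; rewrite (gt_eqF al0) (gt_eqF sKc).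
  have kap0 : 0 <= p1 / 4 * Num.sqrt Kc * alpha c t.
    exact: (mulr_ge0 (mulr_ge0 (divr_ge0 (ltW p10) (ler0n R 4)) (ltW sKc)) (ltW al0)).
  have -> : 1 - th + th * s0 / (1 + s0) / 4 =
    1 - th + p1 / 4 * Num.sqrt Kc * alpha c t / B0 by rewrite kapE.
  apply: (@stay_bound R disp Omega P F fF p q mp mq S T del nu K C a C0 del0 del1 a2 nu0 K0
    SC SC' TC y e rr my me mrr Ft kF FtL c gamma c_ge0 D FD rec bl Ba M (ltW bl0) Ba0 M0
    ie H1 H2 H3 hdel hM hbl t m A FA phi phi_good phi_step' B0 _ B00 kap0) => //.
  - move=> n /andP[tn nm]; have := s_le n tn; move: (_ / B0 ^+ 2) => sn hs.
    have h : 2 * (K1 ^+ 2 * M ^+ 2 * B1) * sn <= 2 * (K1 ^+ 2 * M ^+ 2 * B1) / Kc.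
      by apply: ler_wpM2l hs; exact: (mulr_ge0 (ler0n R 2) (ltW M2)).
    apply: (@le_trans _ _ (2 * (K1 ^+ 2 * M ^+ 2 * B1) / Kc)).
      by apply: le_trans h; rewrite le_eqVlt; apply/orP; left; apply/eqP; rewrite /K1 /B1; ring.
    rewrite (ler_pdivrMr _ _ Kc0).
    have -> : 2 * (K1 ^+ 2 * M ^+ 2 * B1) = bl / 16 * (32 * (K1 ^+ 2 * M ^+ 2 * B1) / bl).
      by field; rewrite (gt_eqF bl0).
    by apply: ler_wpM2l; [exact: (divr_ge0 (ltW bl0))|rewrite /Kc lerDl ltW].
  - move=> n /andP[tn nm]; have := s_le n tn; move: (_ / B0 ^+ 2) => sn hs.
    have h := ler_wpM2l (ltW Kc2) hs.
    apply: (@le_trans _ _ (10 * (K1 * B1) / Kc)).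
      by apply: le_trans h; rewrite le_eqVlt; apply/orP; left; apply/eqP; rewrite /K1 /B1; ring.
    by rewrite (ler_pdivrMr _ _ Kc0) mul1r /Kc lerDr ltW.
  - move=> w [[Aw Ew] _]; have [h1 h2 _] := hE w Ew; split=> //; split.
      by move=> k /andP[tk _]; apply: h1; exact: leq_trans tk.
    exact: h2.
  - exact: (divr_ge0 (ltW p10)).
  - move=> w [_ hw]; rewrite /chart_coord phim subr0; exact: hw.
have UG : \bigcup_m Gm m = A `&` E.
  apply/seteqP; split => w; first by case=> m _ [].
  move=> [Aw Ew]; have [_ _ cvy] := hE w Ew.
  have d0 : 0 < Num.sqrt (p1 / 4) * B0 / C.
    by apply: divr_gt0 C0; apply: mulr_gt0 B00; rewrite sqrtr_gt0 divr_gt0.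
  have [m _ hm] := (cvgrPdist_lt _ _).1 cvy _ d0.
  exists m => //; split=> // n mn; have := hm n mn; rewrite /= sub0r normrN => hy.
  have : snorm S (usubmx (y n w)) <= Num.sqrt (p1 / 4) * B0.
    apply: le_trans (SC _) _; rewrite mulrC -ler_pdivlMr//.
    exact: le_trans (norm_usubmx_le _) (ltW hy).
  have -> : p1 / 4 * B0 ^+ 2 = (Num.sqrt (p1 / 4) * B0) ^+ 2.
    by rewrite [in RHS]exprMn sqr_sqrtr//; exact: (divr_ge0 (ltW p10)).
  move=> h.
  by rewrite lerXn2r ?nnegrE ?snorm_ge0// mulr_ge0 ?sqrtr_ge0// ltW.
have cG : (P \o Gm) m @[m --> \oo] --> P (A `&` E).
  rewrite -UG; apply: nondecreasing_cvg_mu => //; first by rewrite UG.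
  apply/nondecreasing_seqP => n; apply/subsetPset => w [AEw h]; split=> // k nk.
  by apply: h; exact: ltnW.
have /fine_cvgP[_ cG'] : (P \o Gm) m @[m --> \oo] --> (fine (P (A `&` E)))%:E.
  by rewrite fineK ?fin_num_measure.
rewrite -(cvg_lim _ cG')//; apply: limr_le; first by apply/cvg_ex; eexists; exact: cG'.
by near=> m; apply: gapm; near: m; exact: nbhs_infty_ge.
Unshelve. all: by end_near.
Qed.
End Core.

(** * Moments of the noise *)

(** The bound is an integer, so that countably many windows suffice. *)
Lemma limn_esup_bound (R : realType) (u : (\bar R)^nat) : (limn_esup u < +oo)%E ->
  exists k N : nat, forall n, (N <= n)%N -> (u n <= k.+1%:R%:E)%E.
Proof.
rewrite /limn_esup /limf_esup => /ereal_inf_lt[_ [V [N _ NV] <-]] lV.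
have [x hx] : exists x : R, (ereal_sup (u @` V) <= x%:E)%E.
  move: lV; case: (ereal_sup _) => [x _||_]//; first by exists x.
  by exists 0; rewrite leNye.
exists (Num.truncn `|x|), N => n Nn; apply: (@le_trans _ _ x%:E).
  by apply: le_trans hx; apply: ereal_sup_ubound; exists n => //; exact: NV.
rewrite lee_fin; apply: le_trans (ler_norm x) _; apply: ltW.
by have /andP[_] := truncn_itv (normr_ge0 x).
Qed.

Lemma limn_einf_bound (R : realType) (u : (\bar R)^nat) : (0 < limn_einf u)%E ->
  exists k N : nat, forall n, (N <= n)%N -> (k.+1%:R^-1%:E <= u n)%E.
Proof.
rewrite /limn_einf oppe_gt0 /limn_esup /limf_esup => /ereal_inf_lt[_ [V [N _ NV] <-]] lV.
have [x x0 hx] : exists2 x : R, 0 < x & (ereal_sup ((\- u)%E @` V) <= (- x)%:E)%E.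
  move: lV; case: (ereal_sup _) => [x||_]//; last by exists 1; rewrite ?leNye.
  by rewrite lte_fin => x0; exists (- x); rewrite ?oppr_gt0// opprK.
exists (Num.truncn x^-1), N => n Nn; apply: (@le_trans _ _ x%:E).
  rewrite lee_fin invf_ple ?posrE//; apply: ltW.
  have xi : 0 <= x^-1 by rewrite invr_ge0 ltW.
  by have /andP[_] := truncn_itv xi.
rewrite -leeN2; apply: le_trans hx; apply: ereal_sup_ubound; exists n => //; exact: NV.
Qed.

Section ConditionalExpectation.
Variables (R : realType) (disp : measure_display) (Omega : measurableType disp).
Variable P : probability Omega R.
Variables (G : set (set Omega)) (GM : G `<=` measurable).

Lemma cond_exp_le (Y Z : Omega -> \bar R) (M : R) B : is_cond_exp_nneg P G Y Z -> G B ->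
  (forall w, B w -> (Z w <= M%:E)%E) -> (\int[P]_(w in B) Y w <= M%:E * P B)%E.
Proof.
move=> [Z0 mZ ZY] GB hM; have mB := GM GB; rewrite -(ZY _ GB) -integral_cst//.
have mZ' : measurable_fun setT Z by move=> _ U mU; rewrite setTI; exact: GM (mZ _ mU).
by apply: ge0_le_integral => //; exact: measurable_funTS.
Qed.

Lemma cond_exp_ge (Y Z : Omega -> \bar R) (M : R) B : 0 <= M -> is_cond_exp_nneg P G Y Z -> G B ->
  (forall w, B w -> (M%:E <= Z w)%E) -> (M%:E * P B <= \int[P]_(w in B) Y w)%E.
Proof.
move=> M0 [Z0 mZ ZY] GB hM; have mB := GM GB; rewrite -(ZY _ GB) -integral_cst//.
have mZ' : measurable_fun setT Z by move=> _ U mU; rewrite setTI; exact: GM (mZ _ mU).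
by apply: ge0_le_integral => //; exact: measurable_funTS.
Qed.

(** A null conditional mean says that [Zp] and [Zm] agree almost surely, so [Y^+] and [Y^-] have the
    same integral over [B]. Integrability on [B] makes it finite and allows the subtraction. *)
Lemma cond_exp_centered (Y : Omega -> R) B : is_cond_exp P G Y (fun=> 0) -> G B ->
  P.-integrable B (EFin \o Y) -> \int[P]_(w in B) Y w = 0.
Proof.
move=> [Zp [Zm [[p0 mp hp] [m0 mm hm] ae0]]] GB iY; have mB := GM GB.
have mp' : measurable_fun setT Zp by move=> _ U mU; rewrite setTI; exact: GM (mp _ mU).
have mm' : measurable_fun setT Zm by move=> _ U mU; rewrite setTI; exact: GM (mm _ mU).
rewrite /Rintegral integralE.
have -> : (\int[P]_(x in B) ((EFin \o Y)^\+ x) = \int[P]_(x in B) Zm x)%E.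
  rewrite funerpos -(hp B GB); apply: ae_eq_integral => //; try exact: measurable_funTS.
  apply: filterS ae0 => w [fp fm] h _.
  have fp' : Zp w \is a fin_num by rewrite ge0_fin_numE.
  have fm' : Zm w \is a fin_num by rewrite ge0_fin_numE.
  move: h; rewrite -(fineK fp') -(fineK fm') -EFinB => -[/esym/eqP].
  by rewrite subr_eq0 => /eqP ->.
have -> : (\int[P]_(x in B) ((EFin \o Y)^\- x) = \int[P]_(x in B) Zm x)%E.
  by rewrite funerneg -(hm B GB).
by rewrite subee// (hm B GB) -funerneg integrable_neg_fin_num.
Qed.

End ConditionalExpectation.

Section ErrorTail.
Variables (R : realType) (c x u E : nat -> R) (A B : R).
Hypothesis c_neq0 : forall m, exists2 n, (m <= n)%N & c n != 0.
Hypothesis c_sum : finite_sum (fun n => c n ^+ 2).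
Hypothesis x_sum : finite_sum (fun n => x n ^+ 2).
Hypotheses (u0 : forall n, 0 <= u n) (u_sum : finite_sum u).
Hypothesis u_small : tail_sum u =o_\oo alpha c.
Hypotheses (A0 : 0 <= A) (B0 : 0 <= B).
Hypothesis hE : forall k, E k <= A * (c k * x k) + B * u k.

(** By Cauchy-Schwarz the sum of [c x] beyond [t] is at most [alpha c t] times the root of a
    vanishing tail; half of [kappa] goes to this term and half to [u]. *)
Lemma error_tail kappa : 0 < kappa -> exists t0 : nat, forall t n, (t0 <= t)%N ->
  \sum_(t.+1 <= k < n.+1) E k <= kappa * alpha c t.
Proof.
move=> k0; pose b := kappa / (2 * (A + 1)).
have A1 : 0 < A + 1 by rewrite ltr_wpDl.
have b0 : 0 < b by rewrite divr_gt0// mulr_gt0.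
have B1 : 0 < B + 1 by rewrite ltr_wpDl.
have kB : 0 < kappa / (2 * (B + 1)) by rewrite divr_gt0// mulr_gt0.
have /eqoP/(_ _ kB)[t1 _ h1] := u_small.
have x20 n : 0 <= x n ^+ 2 by exact: sqr_ge0.
have b2 : 0 < b ^+ 2 by exact: exprn_gt0.
have [t2 _ h2] := (cvgrPdist_lt _ _).1 (tail_sum_cvg0 x20 x_sum) _ b2.
exists (maxn t1 t2) => t n; rewrite geq_max => /andP[/h1 /= {}h1 /h2 /= {}h2].
have al0 := alpha_gt0 c_neq0 c_sum t.
have hu : \sum_(t.+1 <= k < n.+1) u k <= kappa / (2 * (B + 1)) * alpha c t.
  apply: le_trans (partial_le_tail u0 u_sum t n.+1) _; apply: le_trans (ler_norm _) _.
  by apply: le_trans h1 _; rewrite ger0_norm// ltW.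
have hx : \sum_(t.+1 <= k < n.+1) x k ^+ 2 <= b ^+ 2.
  apply: le_trans (partial_le_tail x20 x_sum t n.+1) _; apply: le_trans (ler_norm _) _.
  by move: h2; rewrite sub0r normrN => /ltW.
have hc : \sum_(t.+1 <= k < n.+1) c k ^+ 2 <= alpha c t ^+ 2.
  by rewrite (sqr_alpha c_neq0 c_sum); exact: (partial_le_tail (fun k => sqr_ge0 (c k)) c_sum t n.+1).
(* AM-GM: [c x <= b c^2 / (2 alpha) + alpha x^2 / (2 b)] *)
have hcx : \sum_(t.+1 <= k < n.+1) (c k * x k) <= b * alpha c t.
  apply: (@le_trans _ _ (\sum_(t.+1 <= k < n.+1)
      (b / (2 * alpha c t) * c k ^+ 2 + alpha c t / (2 * b) * x k ^+ 2))).
    apply: ler_sum => k _; rewrite -subr_ge0.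
    have -> : b / (2 * alpha c t) * c k ^+ 2 + alpha c t / (2 * b) * x k ^+ 2 - c k * x k =
        (b * c k - alpha c t * x k) ^+ 2 / (2 * b * alpha c t).
      by field; rewrite !gt_eqF.
    exact: (divr_ge0 (sqr_ge0 _) (mulr_ge0 (mulr_ge0 (ler0n R 2) (ltW b0)) (ltW al0))).
  rewrite big_split/= -!mulr_sumr.
  have p1 : 0 <= b / (2 * alpha c t) by exact: (divr_ge0 (ltW b0) (mulr_ge0 (ler0n R 2) (ltW al0))).
  have p2 : 0 <= alpha c t / (2 * b) by exact: (divr_ge0 (ltW al0) (mulr_ge0 (ler0n R 2) (ltW b0))).
  apply: le_trans (lerD (ler_wpM2l p1 hc) (ler_wpM2l p2 hx)) _.
  rewrite le_eqVlt; apply/orP; left; apply/eqP.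
  by field; rewrite !gt_eqF.
apply: (@le_trans _ _ (\sum_(t.+1 <= k < n.+1) (A * (c k * x k) + B * u k))).
  by apply: ler_sum => k _.
rewrite big_split/= -!mulr_sumr.
apply: le_trans (lerD (ler_wpM2l A0 hcx) (ler_wpM2l B0 hu)) _.
rewrite (mulrA A) (mulrA B) -mulrDl; apply: (ler_wpM2r (ltW al0)).
rewrite [leRHS]splitr; apply: lerD.
  have -> : A * b = kappa / 2 * (A / (A + 1)) by rewrite /b; field; rewrite gt_eqF.
  rewrite ler_piMr ?divr_ge0 ?(ltW k0)//.
  by rewrite ler_pdivrMr// mul1r lerDl.
have -> : B * (kappa / (2 * (B + 1))) = kappa / 2 * (B / (B + 1)) by field; rewrite gt_eqF.
rewrite ler_piMr ?divr_ge0 ?(ltW k0)//.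
by rewrite ler_pdivrMr// mul1r lerDl.
Qed.
End ErrorTail.

Section ConvergenceEvent.
Variables (R : realType) (disp : measure_display) (Omega : measurableType disp) (n : nat).
Variables (F : nat -> set (set Omega)) (Y : nat -> Omega -> 'cV[R]_n).
Hypotheses (fF : filtration F) (aY : adapted F Y).

Let sF k : sigma_algebra setT (F k). Proof. by case: fF. Qed.

Lemma norm_le_event k x : F k [set w | `|Y k w| <= x].
Proof.
have m : measurable_wrt (F k) (fun w => `|Y k w|).
  apply/measurable_wrtP => //.
  apply: (@lip_measurable _ _ (g_sigma_algebraType (F k)) _ (Y k) (fun z => `|z|) 1).
    by move=> i; apply/measurable_wrtP => //; exact: aY.
  by move=> z z'; rewrite mul1r; exact: ler_dist_dist.
rewrite (_ : [set _ | _] = (fun w => `|Y k w|) @^-1` `]-oo, x]%classic); first exact: m.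
by apply/seteqP; split => w /=; rewrite in_itv.
Qed.

(** Mere measurability would not do for [no_density_gap]: the event has to be generated by the
    filtration. *)
Lemma cvg0_event : <<s \bigcup_n F n >> [set w | Y k w @[k --> \oo] --> (0 : 'cV[R]_n)].
Proof.
have sG : sigma_algebra setT (<<s \bigcup_n F n >>) by exact: smallest_sigma_algebra.
rewrite (_ : [set _ | _] = \bigcap_j \bigcup_N \bigcap_i
    (if (N <= i)%N then [set w | `|Y i w| <= j.+1%:R^-1] else setT)).
  apply: (sigma_bigcap sG) => j; apply: (sigma_bigcup sG) => N; apply: (sigma_bigcap sG) => i.
  case: ifP => _; last exact: (sigma_setT sG).
  by apply: sub_gen_smallest; exists i => //; exact: norm_le_event.
apply/seteqP; split => w /=.
  move=> h j _; have j0 : 0 < j.+1%:R^-1 :> R by rewrite invr_gt0.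
  have [N _ hN] := (cvgrPdist_le _ _).1 h _ j0.
  exists N => // i _; case: ifP => // /hN /=; by rewrite sub0r normrN.
move=> h; apply/cvgrPdist_le => x x0.
have [N _ hN] := h (Num.truncn x^-1) I.
exists N => // i Ni; have := hN i I; rewrite Ni /= sub0r normrN => /le_trans; apply.
rewrite invf_ple ?posrE//; apply: ltW.
have xi : 0 <= x^-1 by rewrite invr_ge0 ltW.
by have /andP[_] := truncn_itv xi.
Qed.

End ConvergenceEvent.

Lemma ip_norm_measurable (R : realType) d (T : measurableType d) n
    (ip : {dot 'cV[R]_n for idfun}) (Y : T -> 'cV[R]_n) :
  (forall i, measurable_fun setT (fun w => Y w i 0)) ->
  measurable_fun setT (fun w => ip_norm ip (Y w)).
Proof.
move=> mY; rewrite (_ : (fun w => _) = fun w =>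
    (\sum_i Y w i 0 * (\sum_j Y w j 0 * ip (delta_mx j 0) (delta_mx i 0))) `^ 2^-1).
  apply: (@measurableT_comp _ _ _ _ _ _ ((@powR R)^~ 2^-1)); first exact: measurable_powR.
  apply: measurable_sum => i; apply: measurable_funM => //.
  by apply: measurable_sum => j; exact: measurable_funM.
apply/funext => w; rewrite powR12_sqrt; last first.
  apply: le_trans (dot_ge0 ip (Y w)) _; rewrite dot_expand le_eqVlt; apply/orP; left; apply/eqP.
  by apply: eq_bigr => i _; rewrite dot_sym dot_expand.
rewrite /ip_norm dot_expand; congr Num.sqrt.
by apply: eq_bigr => i _; rewrite dot_sym dot_expand.
Qed.

Lemma mulmx_adapted (R : realType) disp (Omega : measurableType disp) n
    (F : nat -> set (set Omega)) (Z : nat -> Omega -> 'cV[R]_n) (M : 'M[R]_n) (z : 'cV[R]_n) :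
  filtration F -> adapted F Z -> adapted F (fun k w => M *m (Z k w - z)).
Proof.
move=> [sF _ _] aZ k i; apply/measurable_wrtP => //.
rewrite (_ : (fun w => _) = fun w => \sum_j M i j * (Z k w j 0 - z j 0)).
  apply: measurable_sum => j; apply: measurable_funM => //; apply: measurable_funB => //.
  by apply/measurable_wrtP => //; exact: aZ.
by apply/funext => w; rewrite mxE; apply: eq_bigr => j _; rewrite !mxE.
Qed.

(** The norms and [C] precede [del], since the slope will be fixed from moment bounds involving [C].
    The disjunction unites condition (i), where there is no [v], with (ii), where the steps become
    small. *)
Lemma charts_exist (R : realType) (p q : nat) (f : 'cV[R]_(p + q) -> 'cV[R]_(p + q))
    (N : set 'cV[R]_(p + q)) (xs : 'cV[R]_(p + q)) (Q iQ : 'M[R]_(p + q))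
    (Hp : 'M[R]_p) (Hm : 'M[R]_q) (gamma : nat -> R) (nu : R) :
  nbhs xs N -> C1_on N f -> f xs = 0 -> block_mx Hp 0 0 Hm = iQ *m Dmx f xs *m Q ->
  (forall z, complex_eigenvalue Hp z -> 0 < complex.Re z) ->
  (forall z, complex_eigenvalue Hm z -> complex.Re z <= 0) ->
  (forall n, 0 <= gamma n) -> 0 < nu ->
  q = 0%N \/ [/\ nu <= 1, C1_holder_on nu N f & finite_sum (fun n => gamma n ^+ 2)] ->
  exists mp mq (S : 'M[R]_(mp, p)) (T : 'M[R]_(mq, q)) (C : R),
    [/\ 0 < C, forall u, snorm S u <= C * `|u|, forall u, `|u| <= C * snorm S u,
      forall v, snorm T v <= C * `|v|
    & forall del, 0 < del <= 1 -> exists rho K Ft kF n0,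
      [/\ 0 < rho, 0 <= K, forall z z', `|Ft z - Ft z'| <= kF * `|z - z'|,
        forall z, `|z| <= rho -> Ft z = conj_field f xs Q iQ z
      & chart_family S T del nu K Ft gamma n0]].
Proof.
move=> nN C1 fxs HE Hp_eig Hm_eig g0 nu0 hq.
have [lam lam0 [mp [S [S' [S'S HpP]]]]] := expanding_norm Hp_eig.
have l0 : 0 < lam / 32 by rewrite divr_gt0.
have [mq [T [T' [T'T HmP]]]] := nonexpanding_norm l0 Hm_eig.
have [C C0 [c1 c2 c3 c4]] := norm_const S'S T'T.
exists mp, mq, S, T, C; split=> // del /andP[d0 d1].
case: hq => [q0|[nu1 hf gsum]].
  have flat (v : 'cV[R]_q) : v = 0.
    by apply/matrixP => i; move: (ltn_ord i); rewrite {2}q0.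
  have [rho rho0 [Ft [[kF FtL] FtE h]]] := chart_repulsive nN C1 fxs HE S'S T'T lam0 HpP flat.
  exists rho, 0, Ft, kF, 0%N; split=> //.
  exact: (chart_family_repulsive T nu (ltW d0) (lexx 0) h g0).
have nu01 : 0 < nu <= 1 by rewrite nu0.
have d01 : 0 < del <= 1 by rewrite d0.
have [rho rho0 [K K0 [Ft [[kF FtL] FtE [g1 g10 h]]]]] :=
  chart_holder nN C1 HE S'S T'T lam0 HpP HmP nu01 hf d01.
have g12 : 0 < g1 ^+ 2 by exact: exprn_gt0.
(* Charts are available for steps up to [g1], and [gamma] tends to 0 because its squares are
   summable. *)
have [n0 _ hn0] := (cvgrPdist_lt _ _).1 (cvg_finite_sum (fun n => sqr_ge0 (gamma n)) gsum) _ g12.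
exists rho, K, Ft, kF, n0; split=> //.
apply: (chart_family_holder (ltW d0) K0) => n n0n; apply: h; rewrite g0/=.
have := hn0 n (ltnW n0n); rewrite /= sub0r normrN (ger0_norm (sqr_ge0 _)) => /ltW.
by rewrite ler_sqr ?nnegrE ?g0 ?(ltW g10).
Qed.

Lemma le_powR_add1 (R : realType) (x a : R) : 0 <= x -> 1 <= a -> x <= 1 + x `^ a.
Proof.
move=> x0 a1; have [x1|/ltW x1] := leP x 1; first by rewrite ler_wpDr ?powR_ge0.
by rewrite ler_wpDl// -{1}[x]powRr1// ler_powR.
Qed.

Section Moments.
Variables (R : realType) (disp : measure_display) (Omega : measurableType disp).
Variable P : probability Omega R.

Lemma nneg_Rintegral_bound (B : set Omega) (g : Omega -> R) (M : R) : measurable B ->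
  measurable_fun setT g -> (forall w, 0 <= g w) ->
  (\int[P]_(w in B) (g w)%:E <= M%:E * P B)%E ->
  P.-integrable B (EFin \o g) /\ \int[P]_(w in B) g w <= M * fine (P B).
Proof.
move=> mB mg g0 h.
have fP : P B \is a fin_num by rewrite fin_num_measure.
have fin : (\int[P]_(w in B) (g w)%:E \is a fin_num)%E.
  rewrite ge0_fin_numE; last by apply: integral_ge0 => w _; rewrite lee_fin.
  by apply: le_lt_trans h _; rewrite -(fineK fP) -EFinM ltry.
split; last by rewrite /Rintegral -lee_fin EFinM !fineK.
apply/integrableP; split; first by apply/measurable_EFinP; exact: measurable_funTS.
have -> : (\int[P]_(w in B) `|(EFin \o g) w| = \int[P]_(w in B) (g w)%:E)%E.
  by apply: eq_integral => w _; rewrite /= ger0_norm.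
by rewrite ltey_eq fin.
Qed.

Variables (G : set (set Omega)) (GM : G `<=` measurable).
Variables (n p q : nat) (ip : {dot 'cV[R]_n for idfun}) (x : Omega -> 'cV[R]_n).
Hypothesis mx : forall i, measurable_fun setT (fun w => x w i 0).
Variables (a : R) (a2 : 2 < a) (Va : Omega -> \bar R) (k : R) (D : set Omega).
Hypothesis Va_cond : is_cond_exp_nneg P G (fun w => (ip_norm ip (x w) `^ a)%:E) Va.
Hypothesis Va_le : forall w, D w -> (Va w <= k%:E)%E.

Let ip0 w : 0 <= ip_norm ip (x w). Proof. exact: ip_norm_ge0. Qed.

Lemma ip_moment B : G B -> B `<=` D ->
  P.-integrable B (EFin \o (fun w => ip_norm ip (x w) `^ a)) /\
  \int[P]_(w in B) (ip_norm ip (x w) `^ a) <= k * fine (P B).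
Proof.
move=> GB BD; apply: nneg_Rintegral_bound; first exact: GM.
- apply: (@measurableT_comp _ _ _ _ _ _ ((@powR R)^~ a)); first exact: measurable_powR.
  exact: ip_norm_measurable.
- by move=> w; exact: powR_ge0.
- by apply: (cond_exp_le GM Va_cond GB) => w /BD /Va_le.
Qed.

Lemma dominated_integrable B (g : Omega -> R) (M : R) : G B -> B `<=` D -> measurable_fun setT g ->
  (forall w, `|g w| <= M * (1 + ip_norm ip (x w) `^ a)) -> P.-integrable B (EFin \o g).
Proof.
move=> GB BD mg h; have mB := GM GB.
apply: (@intg_le _ _ _ _ _ mB _ _ (measurable_funTS mg) (fun w _ => h w)).
apply: (intgZ mB); apply: (intgD mB); first exact: intg_cst.
by have [] := ip_moment GB BD.
Qed.

Lemma coord_integrable B i : G B -> B `<=` D -> P.-integrable B (EFin \o (fun w => x w i 0)).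
Proof.
move=> GB BD; have [C C0 hC] := norm_le_ip_norm ip.
apply: (@dominated_integrable _ _ C GB BD (mx i)) => w.
apply: le_trans (entry_le_norm _ _ _) (le_trans (hC _) _); rewrite (ler_wpM2l (ltW C0))//.
by apply: (le_powR_add1 (ip0 w)); apply: ltW; apply: lt_trans a2; rewrite ltr1n.
Qed.

Variables (y : Omega -> 'cV[R]_(p + q)) (Ce : R).
Hypothesis my : forall i, measurable_fun setT (fun w => y w i 0).
Hypotheses (Ce0 : 0 <= Ce) (yx : forall w, `|y w| <= Ce * ip_norm ip (x w)).

Lemma norm_moment B : G B -> B `<=` D ->
  P.-integrable B (EFin \o (fun w => `|y w| `^ a)) /\
  \int[P]_(w in B) (`|y w| `^ a) <= Ce `^ a * k * fine (P B).
Proof.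
move=> GB BD; have mB := GM GB; have [i1 h1] := ip_moment GB BD.
have a0 : 0 <= a by apply: ltW; apply: lt_trans a2.
have le w : `|y w| `^ a <= Ce `^ a * ip_norm ip (x w) `^ a.
  by rewrite -powRM// ge0_ler_powR ?nnegrE ?mulr_ge0.
have mn : measurable_fun setT (fun w => `|y w| `^ a).
  apply: (@measurableT_comp _ _ _ _ _ _ ((@powR R)^~ a)); first exact: measurable_powR.
  apply: (@lip_measurable _ _ _ _ y (fun z => `|z|) 1 my) => z z'.
  by rewrite mul1r; exact: ler_dist_dist.
have iy : P.-integrable B (EFin \o (fun w => `|y w| `^ a)).
  apply: (@intg_le _ _ _ _ _ mB _ (fun w => Ce `^ a * ip_norm ip (x w) `^ a) (measurable_funTS mn)).
    by move=> w _; rewrite ger0_norm ?powR_ge0.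
  exact: (intgZ mB).
split=> //; apply: le_trans (le_Rintegral mB iy (intgZ mB _ i1) (fun w _ => le w)) _.
by rewrite (RintegralZl _ mB i1) -mulrA; apply: ler_wpM2l h1; exact: powR_ge0.
Qed.

Variables (m : nat) (S : 'M[R]_(m, p)) (C Cs bl : R) (ipp : {dot 'cV[R]_p for idfun}).
Hypotheses (C0 : 0 <= C) (SC : forall u : 'cV[R]_p, snorm S u <= C * `|u|).
Hypothesis ppS : forall u : 'cV[R]_p, ip_norm ipp u ^+ 2 <= Cs * snorm S u ^+ 2.
Hypotheses (Cs0 : 0 < Cs) (bl0 : 0 <= bl).
Variable Vp : Omega -> \bar R.
Hypothesis Vp_cond : is_cond_exp_nneg P G (fun w => (ip_norm ipp (usubmx (y w)) ^+ 2)%:E) Vp.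
Hypothesis Vp_ge : forall w, D w -> (bl%:E <= Vp w)%E.

(** The lower bound is given in the norm of [ipp]; as this norm is dominated by [snorm S], it
    survives up to the factor [Cs]. *)
Lemma excitation B : G B -> B `<=` D ->
  bl / Cs * fine (P B) <= \int[P]_(w in B) (snorm S (usubmx (y w)) ^+ 2).
Proof.
move=> GB BD; have mB := GM GB.
have mu i : measurable_fun setT (fun w => usubmx (y w) i 0).
  by rewrite (_ : (fun w => _) = fun w => y w (lshift q i) 0)//; apply/funext => w; rewrite mxE.
have mS := sqr_snorm_measurable S mu.
have leS w : snorm S (usubmx (y w)) ^+ 2 <= (C * Ce) ^+ 2 * (1 + ip_norm ip (x w) `^ a).
  apply: (@le_trans _ _ ((C * Ce * ip_norm ip (x w)) ^+ 2)).
    rewrite lerXn2r ?nnegrE ?snorm_ge0 ?mulr_ge0// -mulrA.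
    apply: le_trans (SC _) (ler_wpM2l C0 _).
    exact: le_trans (norm_usubmx_le _) (yx w).
  by rewrite exprMn; apply: (ler_wpM2l (sqr_ge0 _)); exact: (sqr_le_powR_add1 (ip0 w) (ltW a2)).
have iS : P.-integrable B (EFin \o (fun w => snorm S (usubmx (y w)) ^+ 2)).
  apply: (@dominated_integrable _ _ ((C * Ce) ^+ 2) GB BD mS) => w.
  by rewrite (ger0_norm (sqr_ge0 _)).
have mp : measurable_fun setT (fun w => ip_norm ipp (usubmx (y w)) ^+ 2).
  by apply: measurable_funX; exact: ip_norm_measurable.
have ipi : P.-integrable B (EFin \o (fun w => ip_norm ipp (usubmx (y w)) ^+ 2)).
  apply: (@intg_le _ _ _ _ _ mB _ _ (measurable_funTS mp) _ (intgZ mB Cs iS)) => w _.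
  by rewrite (ger0_norm (sqr_ge0 _)).
have h := cond_exp_ge GM bl0 Vp_cond GB (fun w Bw => Vp_ge (BD w Bw)).
have h' : bl * fine (P B) <= \int[P]_(w in B) (ip_norm ipp (usubmx (y w)) ^+ 2).
  rewrite /Rintegral -lee_fin EFinM !fineK ?fin_num_measure//.
  exact: (integrable_fin_num mB ipi).
rewrite mulrAC ler_pdivrMr// [leRHS]mulrC -(RintegralZl _ mB iS).
by apply: le_trans h' _; exact: (le_Rintegral mB ipi (intgZ mB Cs iS) (fun w _ => ppS _)).
Qed.

End Moments.

(** * From random bounds to deterministic ones *)

Section Escape.
Variables (R : realType) (disp : measure_display) (Omega : measurableType disp).
Variable P : probability Omega R.
Variables (p q : nat) (ip : {dot 'cV[R]_(p + q) for idfun}).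
Variables (ipp : {dot 'cV[R]_p for idfun}) (ipm : {dot 'cV[R]_q for idfun}).
Variables (xs : 'cV[R]_(p + q)) (f : 'cV[R]_(p + q) -> 'cV[R]_(p + q)).
Variables (Q : 'M[R]_(p + q)) (Q_unit : Q \in unitmx).
Variables (gamma c : nat -> R) (c_ge0 : forall n, 0 <= c n).
Hypothesis c_neq0 : forall m, exists2 n, (m <= n)%N & c n != 0.
Hypothesis c_sum : finite_sum (fun n => c n ^+ 2).
Variables (F : nat -> set (set Omega)) (fF : filtration F).
Variables (X eps r : nat -> Omega -> 'cV[R]_(p + q)).
Hypotheses (aX : adapted F X) (aeps : adapted F eps) (ar : adapted F r).
Hypothesis X_rec : forall n, {ae P, forall w,
  X n.+1 w - X n w = gamma n.+1 *: f (X n w) + c n.+1 *: (eps n.+1 w + r n.+1 w)}.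
Variables (a : R) (a2 : 2 < a) (Va Vp : nat -> Omega -> \bar R).
Hypothesis Va_cond : forall n, is_cond_exp_nneg P (F n)
  (fun w => (ip_norm ip (eps n.+1 w) `^ a)%:E) (Va n).
Hypothesis Vp_cond : forall n, is_cond_exp_nneg P (F n)
  (fun w => (ip_norm ipp (usubmx (invmx Q *m eps n.+1 w)) ^+ 2)%:E) (Vp n).
Hypothesis eps_centered : forall n i,
  is_cond_exp P (F n) (fun w => eps n.+1 w i 0) (fun=> 0).
Variables (nu : R) (nu0 : 0 < nu) (mp mq : nat).
Variables (S : 'M[R]_(mp, p)) (T : 'M[R]_(mq, q)) (C : R) (C0 : 0 < C).
Hypothesis SC : forall u : 'cV[R]_p, snorm S u <= C * `|u|.
Hypothesis SC' : forall u : 'cV[R]_p, `|u| <= C * snorm S u.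
Hypothesis TC : forall v : 'cV[R]_q, snorm T v <= C * `|v|.
Hypothesis charts : forall del, 0 < del <= 1 -> exists rho K Ft kF n0,
  [/\ 0 < rho, 0 <= K, forall z z', `|Ft z - Ft z'| <= kF * `|z - z'|,
    forall z, `|z| <= rho -> Ft z = conj_field f xs Q (invmx Q) z
  & chart_family S T del nu K Ft gamma n0].

Let sF n : sigma_algebra setT (F n). Proof. by case: fF. Qed.
Let FM n : F n `<=` measurable. Proof. by case: fF. Qed.

Let y n w := invmx Q *m (X n w - xs).
Let e n w := invmx Q *m eps n w.
Let rr n w := invmx Q *m r n w.

Definition minus_noise n w :=
  c n `^ (1 + nu) * ip_norm ipm (dsubmx (invmx Q *m eps n w)) `^ (1 + nu).

Let ay : adapted F y. Proof. exact: mulmx_adapted. Qed.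

Let adapted_lin Z : adapted F Z -> adapted F (fun n w => invmx Q *m Z n w).
Proof.
move=> aZ; have := mulmx_adapted (invmx Q) 0 fF aZ.
by rewrite (_ : (fun n w => _) = fun n w => invmx Q *m Z n w)//; apply/funext => n; apply/funext => w; rewrite subr0.
Qed.

Let aen : adapted F e. Proof. exact: adapted_lin. Qed.
Let arr : adapted F rr. Proof. exact: adapted_lin. Qed.

Let lin_norm : exists2 C1, 0 < C1 & forall v : 'cV[R]_(p + q), `|invmx Q *m v| <= C1 * `|v|.
Proof.
exists ((p + q)%:R * `|invmx Q| + 1) => [|v]; first by rewrite ltr_wpDl// mulr_ge0.
by apply: le_trans (norm_mulmx_le _ _) _; rewrite mulrA ler_wpM2r// lerDl.
Qed.

Let y_rec rho Ft n w : (forall z, `|z| <= rho -> Ft z = conj_field f xs Q (invmx Q) z) ->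
  X n.+1 w - X n w = gamma n.+1 *: f (X n w) + c n.+1 *: (eps n.+1 w + r n.+1 w) ->
  `|y n w| <= rho ->
  y n.+1 w = y n w + gamma n.+1 *: Ft (y n w) + c n.+1 *: (e n.+1 w + rr n.+1 w).
Proof.
move=> FtE h /FtE ->; rewrite /conj_field /y mulmxA mulmxV// mul1mx addrCA subrr addr0.
rewrite -(subrK (X n w) (X n.+1 w)) h /e /rr -mulmxDr !scalemxAr -!mulmxDr; congr (_ *m _).
by rewrite -[LHS]addrA addrC !addrA.
Qed.

(** The window lies in the countable union of the trapping events [E t0], where [t0] is a time from
    which the path stays in the chart and its errors stay within the budget. *)
Lemma window_negligible k t1 : P.-negligible [set w |
  [/\ X n w @[n --> \oo] --> xs, finite_sum (fun n => ip_norm ip (r n w) ^+ 2),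
    finite_sum (minus_noise^~ w), tail_sum (minus_noise^~ w) =o_\oo alpha c
  & forall n, (t1 <= n)%N -> (k.+1%:R^-1%:E <= Vp n w)%E /\ (Va n w <= k.+1%:R%:E)%E]].
Proof.
have [C1 C10 hC1] := lin_norm.
have [C2 C20 hC2] := norm_le_ip_norm ip.
pose Ce := C1 * C2.
have Ce0 : 0 < Ce by exact: mulr_gt0.
have linip (v : 'cV[R]_(p + q)) : `|invmx Q *m v| <= Ce * ip_norm ip v.
  by apply: le_trans (hC1 v) _; rewrite -mulrA; apply: (ler_wpM2l (ltW C10)).
have [C3 C30 hC3] := ip_norm_le_norm ipp.
pose Cs := (C3 * C) ^+ 2.
have Cs0 : 0 < Cs by exact: exprn_gt0 (mulr_gt0 C30 C0).
have ppS (u : 'cV[R]_p) : ip_norm ipp u ^+ 2 <= Cs * snorm S u ^+ 2.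
  rewrite -exprMn lerXn2r ?nnegrE ?ip_norm_ge0//; first exact: mulr_ge0 (ltW (mulr_gt0 C30 C0)) (snorm_ge0 _ _).
  by apply: le_trans (hC3 u) _; rewrite -mulrA; exact: (ler_wpM2l (ltW C30)).
have [C4 C40 hC4] := norm_le_ip_norm ipm.
pose Ct := C * C4.
have Ct0 : 0 < Ct by exact: mulr_gt0.
have Tip (v : 'cV[R]_q) : snorm T v <= Ct * ip_norm ipm v.
  by apply: le_trans (TC v) _; rewrite -mulrA; apply: (ler_wpM2l (ltW C0)).
pose Ba := Ce `^ a * k.+1%:R.
have Ba0 : 0 <= Ba by exact: mulr_ge0 (powR_ge0 _ _) (ler0n _ _).
pose K1 := 4 * C ^+ 2; pose B1 := 1 + Ba.
have K10 : 0 < K1 by exact: mulr_gt0 (ltr0Sn R 3) (exprn_gt0 2 C0).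
have B10 : 0 < B1 by exact: ltr_pwDl ltr01 Ba0.
(* The cap [40 * K1 * B1] is there for [hbl], which keeps [th] at most 1. *)
pose bl := Num.min (k.+1%:R^-1 / Cs) (40 * K1 * B1).
have bl0 : 0 < bl.
  rewrite /bl lt_min; apply/andP; split; first by rewrite divr_gt0// invr_gt0.
  exact: mulr_gt0 (mulr_gt0 (ltr0Sn R 39) K10) B10.
have hbl : bl <= 40 * K1 * B1 by rewrite /bl ge_min lexx orbT.
have hbl' : bl <= k.+1%:R^-1 / Cs by rewrite /bl ge_min lexx.
have b80 : 0 < bl / (8 * B1) by exact: divr_gt0 bl0 (mulr_gt0 (ltr0Sn R 7) B10).
(* The second term gives [hdel]. It involves only constants already fixed, whereas the chart
   obtained below depends on [del]. *)
pose del := Num.min 1 (Num.sqrt (bl / (8 * B1)) / C).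
have del0 : 0 < del.
  by rewrite /del lt_min ltr01/=; apply: divr_gt0 C0; rewrite sqrtr_gt0.
have del1 : del <= 1 by rewrite /del ge_min lexx.
have hdel : (del * C) ^+ 2 * B1 <= bl / 8.
  have h : del * C <= Num.sqrt (bl / (8 * B1)) by rewrite -ler_pdivlMr// /del ge_min lexx orbT.
  have h2 : (del * C) ^+ 2 <= bl / (8 * B1).
    rewrite -[leRHS](sqr_sqrtr (ltW b80)) lerXn2r ?nnegrE ?sqrtr_ge0//.
    exact: mulr_ge0 (ltW del0) (ltW C0).
  apply: le_trans (ler_wpM2r (ltW B10) h2) _.
  by rewrite le_eqVlt; apply/orP; left; apply/eqP; field; rewrite (gt_eqF B10).
have del01 : 0 < del <= 1 by rewrite del0.
have [rho [K [Ft [kF [n0 [rho0 K0 FtL FtE fam]]]]]] := charts del01.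
(* [D n] is known at time [n]: the position is, and so are the conditional moments of the next
   noise. Inside the ball the truncated field is the true one. *)
pose D n := [set w | (k.+1%:R^-1%:E <= Vp n w)%E /\ (Va n w <= k.+1%:R%:E)%E] `&`
  [set w | `|y n w| <= rho].
have FD n : F n (D n).
  apply: (sigma_setI (sF n)); last exact: (norm_le_event fF ay).
  have [_ mVa _] := Va_cond n; have [_ mVp _] := Vp_cond n.
  apply: (sigma_setI (sF n)).
    rewrite (_ : (fun w => _) = Vp n @^-1` `[(k.+1%:R^-1)%:E, +oo%E]%classic).
      by apply: mVp; exact: emeasurable_itv.
    by apply/seteqP; split => w /=; rewrite in_itv/= leey andbT.
  rewrite (_ : (fun w => _) = Va n @^-1` `[-oo%E, (k.+1%:R)%:E]%classic).
    by apply: mVa; exact: emeasurable_itv.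
  by apply/seteqP; split => w /=; rewrite in_itv/= leNye.
have meps n i : measurable_fun setT (fun w => eps n w i 0).
  exact: (measurable_wrt_measurable (@FM n) (aeps n i)).
have me n i : measurable_fun setT (fun w => e n w i 0).
  exact: (measurable_wrt_measurable (@FM n) (aen n i)).
have DVa n w : D n w -> (Va n w <= k.+1%:R%:E)%E by move=> [[]].
have DVp n w : D n w -> (k.+1%:R^-1%:E <= Vp n w)%E by move=> [[]].
have mom n B : F n B -> B `<=` D n ->
    P.-integrable B (EFin \o (fun w => `|e n.+1 w| `^ a)) /\
    \int[P]_(w in B) (`|e n.+1 w| `^ a) <= Ba * fine (P B).
  by move=> FB BD; apply: (norm_moment (@FM n) (meps n.+1) a2 (Va_cond n) (DVa n) (me n.+1)
    (ltW Ce0) (fun w => linip _) FB BD).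
have H2 n B : F n B -> B `<=` D n ->
    bl * fine (P B) <= \int[P]_(w in B) (snorm S (usubmx (e n.+1 w)) ^+ 2).
  move=> FB BD; apply: le_trans (ler_wpM2r (fine_prob_ge0 P B) hbl') _.
  have ki : 0 <= k.+1%:R^-1 :> R by rewrite invr_ge0.
  exact: (excitation (@FM n) (meps n.+1) a2 (Va_cond n) (DVa n) (me n.+1)
    (ltW Ce0) (fun w => linip _) (ltW C0) SC ppS Cs0 ki (Vp_cond n) (DVp n) FB BD).
have H3 n B : F n B -> B `<=` D n -> forall i, \int[P]_(w in B) e n.+1 w i 0 = 0.
  move=> FB BD i; have mB := FM FB.
  have ii j : P.-integrable B (EFin \o (fun w => eps n.+1 w j 0)).
    exact: (coord_integrable (@FM n) (meps n.+1) a2 (Va_cond n) (DVa n) j FB BD).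
  have -> : \int[P]_(w in B) e n.+1 w i 0 =
      \int[P]_(w in B) \sum_j invmx Q i j * eps n.+1 w j 0.
    by apply: eq_Rintegral => w _; rewrite mxE.
  rewrite (Rintegral_sum mB) => [|j]; last exact: intgZ.
  rewrite big1// => j _; rewrite (RintegralZl _ mB (ii j)).
  by rewrite (cond_exp_centered (@FM n) (eps_centered n j) FB (ii j)) mulr0.
have rec n : {ae P, forall w, D n w ->
    y n.+1 w = y n w + gamma n.+1 *: Ft (y n w) + c n.+1 *: (e n.+1 w + rr n.+1 w)}.
  by apply: filterS (X_rec n) => w h [_ hy]; exact: (y_rec FtE h hy).
have [kappa kappa0 null] := @trapped_null R disp Omega P F fF p q mp mq S T del nu K C a C0
  (ltW del0) del1 a2 nu0 K0 SC SC' TC y e rr ay aen arr Ft kF FtL c gamma c_ge0 c_neq0 c_sum n0 fam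
  D FD rec bl Ba bl0 Ba0 (fun n => (mom n _ (FD n) (@subset_refl _ _)).1)
  (fun n B FB BD => (mom n B FB BD).2) H2 H3 hdel hbl.
(* The error sums are bounded here in place of the tail conditions, so that [E t0] is a countable
   intersection of events generated by the filtration. *)
pose E t0 := (\bigcap_n (if (t0 <= n)%N then D n else setT)) `&`
  ((\bigcap_t \bigcap_n (if (t0 <= t)%N then
     [set w | \sum_(t.+1 <= j < n.+1) err T nu K C e rr c j w <= kappa * alpha c t] else setT)) `&`
  [set w | y n w @[n --> \oo] --> (0 : 'cV[R]_(p + q))]).
have sG : sigma_algebra setT (<<s \bigcup_n F n >>) by exact: smallest_sigma_algebra.
have sE t0 : <<s \bigcup_n F n >> (E t0).
  have gen n B : F n B -> <<s \bigcup_n F n >> B.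
    by move=> FB; apply: sub_gen_smallest; exists n.
  apply: (sigma_setI sG); last apply: (sigma_setI sG); last exact: cvg0_event.
    apply: (sigma_bigcap sG) => n; case: ifP => _; [exact: (gen n)|exact: (sigma_setT sG)].
  apply: (sigma_bigcap sG) => t; apply: (sigma_bigcap sG) => n.
  case: ifP => _; last exact: (sigma_setT sG).
  apply: (gen n).
  have := err_sum_measurable fF nu K C0 TC aen arr c t n.
  move=> /(_ `]-oo, (kappa * alpha c t)]%classic (measurable_itv _)).
  by congr (F n _); apply/seteqP; split => w /=; rewrite in_itv.
have nE t0 : P.-negligible (E t0).
  have mE : measurable (E t0).
    suff : <<s \bigcup_n F n >> `<=` measurable by move=> h; exact: h (sE t0).
    apply: smallest_sub; first exact: sigma_algebra_measurable.
    by move=> B [n _]; exact: FM.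
  exists (E t0); split=> //; apply: (null (E t0) t0 (sE t0)) => w [h1 [h2 h3]]; split=> //.
    by move=> n tn; have := h1 n I; rewrite tn.
  by move=> t n tt; have := h2 t I n I; rewrite tt.
apply: negligibleS (negligible_bigcup nE) => w [Xxs rsum usum usmall hV].
have cvy : y n w @[n --> \oo] --> (0 : 'cV[R]_(p + q)).
  apply/cvgrPdist_le => x x0; have x1 : 0 < x / C1 by exact: divr_gt0.
  have [N _ hN] := (cvgrPdist_le _ _).1 Xxs _ x1.
  exists N => // n /hN /= h; rewrite sub0r normrN; apply: le_trans (hC1 _) _.
  by rewrite mulrC -ler_pdivlMr// distrC.
have [t2 _ ht2] := (cvgrPdist_le _ _).1 cvy _ rho0.
have errle j : err T nu K C e rr c j w <=
    2 * C * Ce * (c j * ip_norm ip (r j w)) + K * Ct `^ (1 + nu) * minus_noise j w.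
  rewrite /err; apply: lerD.
    have := ler_wpM2l (mulr_ge0 (mulr_ge0 (ler0n R 2) (ltW C0)) (c_ge0 j)) (linip (r j w)).
    by move/le_trans; apply; rewrite le_eqVlt; apply/orP; left; apply/eqP; ring.
  rewrite -mulrA; apply: (ler_wpM2l K0); rewrite /minus_noise.
  have i0 := ip_norm_ge0 ipm (dsubmx (invmx Q *m eps j w)).
  rewrite -(powRM _ (c_ge0 j) i0) -(powRM _ (ltW Ct0) (mulr_ge0 (c_ge0 j) i0)).
  have nu1 : 0 <= 1 + nu by exact: addr_ge0 ler01 (ltW nu0).
  apply: ge0_ler_powR => //; rewrite ?nnegrE.
  - exact: mulr_ge0 (c_ge0 j) (snorm_ge0 _ _).
  - exact: mulr_ge0 (ltW Ct0) (mulr_ge0 (c_ge0 j) i0).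
  - by rewrite mulrCA; apply: (ler_wpM2l (c_ge0 j)); exact: Tip.
have noise0 j : 0 <= minus_noise j w by exact: mulr_ge0 (powR_ge0 _ _) (powR_ge0 _ _).
have A0 : 0 <= 2 * C * Ce by exact: mulr_ge0 (mulr_ge0 (ler0n R 2) (ltW C0)) (ltW Ce0).
have A1 : 0 <= K * Ct `^ (1 + nu) by exact: mulr_ge0 K0 (powR_ge0 _ _).
(* [kappa] was fixed before the path; the tail conditions now provide a time, depending on the path,
   after which the errors respect it. *)
have [t3 ht3] := error_tail c_neq0 c_sum rsum noise0 usum usmall A0 A1 errle kappa0.
exists (maxn t1 (maxn t2 t3)) => //; split; last split=> //.
- move=> n _; case: ifP => //; rewrite !geq_max => /and3P[n1 n2 n3]; split; first exact: hV.
  by have := ht2 n n2; rewrite /= sub0r normrN.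
- move=> t _ n _; case: ifP => //; rewrite !geq_max => /and3P[_ _ n3]; exact: ht3.
Qed.

End Escape.

Theorem theorem2p2p4
  (R : realType) (disp : measure_display) (Omega : measurableType disp)
  (P : probability Omega R)
  (* R^d = R^dp x R^dm, each space with an inner product *)
  (dp dm : nat) (dp_gt0 : (0 < dp)%N)
  (ip : {dot 'cV[R]_(dp + dm) for idfun})
  (ipp : {dot 'cV[R]_dp for idfun}) (ipm : {dot 'cV[R]_dm for idfun})
  (* the vector field and its linearization at the unstable equilibrium *)
  (xs : 'cV[R]_(dp + dm)) (f : 'cV[R]_(dp + dm) -> 'cV[R]_(dp + dm))
  (N : set 'cV[R]_(dp + dm)) (nbhs_N : nbhs xs N) (convex_N : convex_set N)
  (C1_f : C1_on N f) (unstable_xs : unstable f xs)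
  (Q : 'M[R]_(dp + dm)) (Hp : 'M[R]_dp) (Hm : 'M[R]_dm)
  (Q_unit : Q \in unitmx)
  (Q_blocks : invmx Q *m Dmx f xs *m Q = block_mx Hp 0 0 Hm)
  (Hp_eig : forall z, complex_eigenvalue Hp z -> 0 < complex.Re z)
  (Hm_eig : forall z, complex_eigenvalue Hm z -> complex.Re z <= 0)
  (* the step sequences *)
  (gamma c : nat -> R)
  (gamma_ge0 : forall n, 0 <= gamma n) (c_ge0 : forall n, 0 <= c n)
  (c_neq0 : forall m, exists2 n, (m <= n)%N & c n != 0)
  (c_sum : finite_sum (fun n => c n ^+ 2))
  (* the stochastic algorithm *)
  (F : nat -> set (set Omega)) (filtration_F : filtration F)
  (X eps r : nat -> Omega -> 'cV[R]_(dp + dm))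
  (X_adapted : adapted F X) (eps_adapted : adapted F eps)
  (r_adapted : adapted F r)
  (X_rec : forall n, {ae P, forall w,
     X n.+1 w - X n w
       = gamma n.+1 *: f (X n w) + c n.+1 *: (eps n.+1 w + r n.+1 w)})
  (epsp := fun n w => usubmx (invmx Q *m eps n w))
  (epsm := fun n w => dsubmx (invmx Q *m eps n w))
  (a : R) (a_gt2 : 2 < a)
  (* versions of E[|eps_(n+1)|^2 | F_n], E[|eps_(n+1)|^a | F_n] and
     E[|eps^+_(n+1)|^2 | F_n] *)
  (V2 Va Vp : nat -> Omega -> \bar R)
  (V2_cond : forall n, is_cond_exp_nneg P (F n)
     (fun w => (ip_norm ip (eps n.+1 w) ^+ 2)%:E) (V2 n))
  (Va_cond : forall n, is_cond_exp_nneg P (F n)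
     (fun w => (ip_norm ip (eps n.+1 w) `^ a)%:E) (Va n))
  (Vp_cond : forall n, is_cond_exp_nneg P (F n)
     (fun w => (ip_norm ipp (epsp n.+1 w) ^+ 2)%:E) (Vp n))
  (eps_centered : forall n i,
     is_cond_exp P (F n) (fun w => eps n.+1 w i 0) (fun=> 0))
  (V2_fin : forall n, {ae P, forall w, (V2 n w < +oo)%E})
  (* the event *)
  (Gamma : set Omega) (measurable_Gamma : measurable Gamma)
  (on_Gamma : {ae P, forall w, Gamma w ->
     [/\ (0 < limn_einf (fun n => Vp n w))%E,
         (limn_esup (fun n => Va n w) < +oo)%E
       & finite_sum (fun n => ip_norm ip (r n w) ^+ 2)]})
  (i_or_ii :
     repulsive f xs \/
     [/\ finite_sum (fun n => gamma n ^+ 2),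
         tail_sum (fun n => gamma n ^+ 2) =O_\oo alpha c
       & exists nu : R,
         [/\ 0 < nu <= 1, C1_holder_on nu N f
           & {ae P, forall w,
               Gamma w -> (fun n => X n w) @ \oo --> xs ->
               let u n :=
                 c n `^ (1 + nu) * ip_norm ipm (epsm n w) `^ (1 + nu) in
               finite_sum u /\ tail_sum u =o_\oo alpha c}]]) :
  P (Gamma `&` [set w | (fun n => X n w) @ \oo --> xs]) = 0%E.
Proof.
have fxs : f xs = 0 by case: unstable_xs.
(* One exponent serves both conditions: under (i) there is no [-] component, its noise vanishes, and
   [nu = 1] will do. *)
have [nu [nu0 hq minus_ok]] : exists nu : R, [/\ 0 < nu,
    dm = 0%N \/ [/\ nu <= 1, C1_holder_on nu N f & finite_sum (fun n => gamma n ^+ 2)]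
  & {ae P, forall w, Gamma w -> (fun n => X n w) @ \oo --> xs ->
      let u := (minus_noise ipm Q c eps nu)^~ w in finite_sum u /\ tail_sum u =o_\oo alpha c}].
  case: i_or_ii => [rep|[gsum _ [nu [/andP[nu0 nu1] hf hu]]]]; last first.
    by exists nu; split=> //; right.
  have dm0 := repulsive_flat Q_unit Q_blocks Hm_eig rep.
  exists 1; split=> //; first by left.
  apply: aeW => w _ _; pose u := (minus_noise ipm Q c eps 1)^~ w; rewrite -/u.
  have u0 n : u n = 0.
    rewrite /u /minus_noise (_ : dsubmx _ = 0); last first.
      by apply/matrixP => i; move: (ltn_ord i); rewrite {2}dm0.
    by rewrite /ip_norm dot0l sqrtr0 powR0 ?mulr0// gt_eqF.
  have sum0 m : (\sum_(m <= n <oo) (u n)%:E = 0)%E by apply: eseries0 => n _ _; rewrite u0.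
  split; first by rewrite /finite_sum sum0 ltry.
  have -> : tail_sum u = fun=> 0 by apply/funext => t; rewrite /tail_sum sum0.
  apply/eqoP => d d0; apply: nearW => t; rewrite normr0.
  exact: (mulr_ge0 (ltW d0) (normr_ge0 _)).
have [mp [mq [S [T [C [C0 SC SC' TC charts]]]]]] :=
  charts_exist nbhs_N C1_f fxs (esym Q_blocks) Hp_eig Hm_eig gamma_ge0 nu0 hq.
pose W k t1 := [set w |
  [/\ X n w @[n --> \oo] --> xs, finite_sum (fun n => ip_norm ip (r n w) ^+ 2),
    finite_sum ((minus_noise ipm Q c eps nu)^~ w),
    tail_sum ((minus_noise ipm Q c eps nu)^~ w) =o_\oo alpha c
  & forall n, (t1 <= n)%N -> (k.+1%:R^-1%:E <= Vp n w)%E /\ (Va n w <= k.+1%:R%:E)%E]].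
have nW k t1 : P.-negligible (W k t1).
  exact: (window_negligible ipm Q_unit c_ge0 c_neq0 c_sum filtration_F X_adapted eps_adapted
    r_adapted X_rec a_gt2 Va_cond Vp_cond eps_centered nu0 C0 SC SC' TC charts).
have nWU : P.-negligible (\bigcup_k \bigcup_t W k t).
  by apply: negligible_bigcup => k; exact: negligible_bigcup.
(* Being negligible only says that the event is contained in a null set; the value of [P] requires
   measurability as well. *)
have mE : measurable (Gamma `&` [set w | (fun n => X n w) @ \oo --> xs]).
  apply: measurableI => //.
  have h := cvg0_event filtration_F (mulmx_adapted 1%:M xs filtration_F X_adapted).
  rewrite (_ : [set _ | _] = [set w | (1%:M *m (X k w - xs)) @[k --> \oo] --> (0 : 'cV[R]_(dp + dm))]).
    suff : <<s \bigcup_n F n >> `<=` measurable by move=> le; exact: le h.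
    apply: smallest_sub; first exact: sigma_algebra_measurable.
    by move=> B [n _]; case: filtration_F => _ FM _; exact: FM.
  apply/seteqP; split => w /= /cvgrPdist_le h'; apply/cvgrPdist_le => x /h'; apply: filterS => n;
    by rewrite mul1mx sub0r normrN distrC.
have neg : P.-negligible (Gamma `&` [set w | (fun n => X n w) @ \oo --> xs]).
  apply: negligibleS (negligibleU (negligibleU on_Gamma minus_ok) nWU) => w [Gw Xw].
  have [h|h] := pselect (~ (Gamma w ->
     [/\ (0 < limn_einf (fun n => Vp n w))%E, (limn_esup (fun n => Va n w) < +oo)%E
       & finite_sum (fun n => ip_norm ip (r n w) ^+ 2)])); first by left; left.
  have [h'|h'] := pselect (~ (Gamma w -> (fun n => X n w) @ \oo --> xs ->
      let u := (minus_noise ipm Q c eps nu)^~ w in finite_sum u /\ tail_sum u =o_\oo alpha c)).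
    by left; right.
  right; have [p1 p2 p3] := contrapT h Gw; have [u1 u2] := contrapT h' Gw Xw.
  have [k1 [t1 hk1]] := limn_einf_bound p1; have [k2 [t2 hk2]] := limn_esup_bound p2.
  exists (maxn k1 k2) => //; exists (maxn t1 t2) => //; split=> // n.
  rewrite geq_max => /andP[/hk1 n1 /hk2 n2]; split.
    by apply: le_trans n1; rewrite lee_fin lef_pV2 ?posrE// ler_nat ltnS leq_maxl.
  by apply: le_trans n2 _; rewrite lee_fin ler_nat ltnS leq_maxr.
have [A [mA A0 EA]] := neg.
by apply: subset_measure0 EA _.
Qed.
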